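(* Let $(M,g)$ be a smooth Riemannian manifold, $\phi:M\to\mathbb{R}$ a smooth function, $\Omega=\{\phi>0\}$, $\Gamma=\{\phi=0\}$, and assume $d\phi\neq 0$ on $\Gamma$, so that $\overline{\Omega}=\Omega\cup\Gamma$ is a manifold with smooth boundary $\Gamma$. Let $H(x,p_x)=\phi(x)\|p_x\|_g^2$ on $T^*\Omega$. Then there exist a smooth manifold $\hat\Omega$ and a smooth map $\pi:\hat\Omega\to M$ such that: 1. $\pi(\hat\Omega)=\overline{\Omega}$, $\pi$ is a double covering over $\Omega$, and, with $\hat\Gamma=\pi^{-1}(\Gamma)$, the map $\pi:\hat\Gamma\to\Gamma$ is a diffeomorphism. 2. Let $\Pi:T^*(\hat\Omega\setminus\hat\Gamma)\to T^*\Omega$ be the projection $\Pi(y,p_y)=\big(\pi(y),(d\pi(y)^* )^{-1}p_y\big)$. Then $\hat H=H\circ\Pi$ extends to a smooth function on $T^*\hat\Omega$ (again denoted $\hat H$). 3. The projection $\Pi$ maps trajectories (away from $\hat\Gamma$) of the regularized Hamiltonian system on $T^*\hat\Omega$ with Hamiltonian $\hat H$ and the standard symplectic form $dp_y\wedge dy$ to trajectories of the original Hamiltonian system on $T^*\Omega$ with Hamiltonian $H$ and symplectic form $dp_x\wedge dx$. 4. For every $h>0$, trajectories of the regularized Hamiltonian system cross the Poincaré section $$\mathcal{S}_h=\{(y,p_y)\in T^*\hat\Omega: y\in\hat\Gamma\}\cap\{\hat H=h\}$$ transversely on the energy level $\{\hat H=h\}$.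
   Context: $\|p_x\|_g$ denotes the norm on $T_x^*M$ dual to the norm defined by the Riemannian metric $g$ on $T_xM$. The Hamiltonian $H$ generates (up to time parametrization) the geodesic flow of the metric $G=g/\phi$ on $\Omega$. Hamilton's equations are $\dot x=\partial_{p_x}H$, $\dot p_x=-\partial_xH$, and similarly for $\hat H$. $d\pi(y)^*:T^*_{\pi(y)}M\to T^*_y\hat\Omega$ is the dual of $d\pi(y)$; it is invertible for $y\in\hat\Omega\setminus\hat\Gamma$. *)

(* Defs.v *)
From HB Require Import structures.
From mathcomp Require Import all_boot all_order all_algebra.
From mathcomp Require Import all_classical all_reals all_analysis.

Set Implicit Arguments.
Unset Strict Implicit.
Unset Printing Implicit Defensive.

Import Order.TTheory GRing.Theory Num.Theory.
Import numFieldNormedType.Exports.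

Local Open Scope classical_set_scope.
Local Open Scope ring_scope.

Section Smooth.
Context {R : realType} {V W : normedModType R}.
Implicit Types (f : V -> W) (U : set V).

(* Only meant for open U and finite-dimensional V: then asking for the
   directional derivatives to be C^k is asking for the differential to be. *)
Fixpoint Ck (k : nat) U f : Prop :=
  match k with
  | 0 => forall x, U x -> {for x, continuous f}
  | k'.+1 => (forall x, U x -> differentiable f x) /\
             (forall v, Ck k' U (fun x => 'D_v f x))
  end.

Definition smooth_on U f : Prop := forall k, Ck k U f.

End Smooth.

(* Near z, A is the zero set of the smooth submersion F (with values in R^k);
   so near z it is an embedded submanifold of codimension k, with tangent space
   the kernel of 'd F z. *)
Definition cut_out {R : realType} {V : normedModType R} (A : set V) (z : V)
    (k : nat) (F : V -> 'rV[R]_k) : Prop :=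
  (exists U : set V, [/\ open_nbhs z U, smooth_on U F &
     forall x, U x -> (A x <-> F x = 0)]) /\
  (forall w, exists v, 'd F z v = w).

(* X is transverse at z, inside the hypersurface E, to the codimension one
   submanifold S of E, i.e. T_z E = T_z S + R X. *)
Definition transverse_at {R : realType} {V : normedModType R} (E S : set V)
    (z X : V) : Prop :=
  exists (F : V -> 'rV[R]_1) (G : V -> 'rV[R]_2),
  [/\ cut_out E z F, cut_out S z G &
      forall v, 'd F z v = 0 <->
        exists (s : V) (a : R), 'd G z s = 0 /\ v = s + a *: X].

(* [bwd] is the inverse of [fwd] on the image of [dom], and arbitrary outside. *)
Record chart (R : realType) (n : nat) (T : topologicalType) := Chart {
  dom : set T;
  fwd : T -> 'rV[R]_n;
  bwd : 'rV[R]_n -> T;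
  dom_open : open dom;
  img_open : open (fwd @` dom);
  fwdK : {in dom, cancel fwd bwd};
  fwd_continuous : forall x, dom x -> {for x, continuous fwd};
  bwd_continuous : forall u, (fwd @` dom) u -> {for u, continuous bwd}
}.

Definition img {R : realType} {n : nat} {T : topologicalType}
  (c : chart R n T) : set 'rV[R]_n := fwd c @` dom c.

(* Besides its atlas a manifold carries a preferred chart around each point x;
   it serves only to identify the fibres T_x M and T_x^* M with R^n. *)
Record manifold (R : realType) (n : nat) := Manifold {
  carrier :> topologicalType;
  mfd_hausdorff : hausdorff_space carrier;
  mfd_second_countable : @second_countable carrier;
  atlas : set (chart R n carrier);
  chart_at : carrier -> chart R n carrier;
  atlas_chart_at : forall x, atlas (chart_at x);
  dom_chart_at : forall x, dom (chart_at x) x;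
  atlas_compat : forall c d, atlas c -> atlas d ->
    smooth_on (fwd c @` (dom c `&` dom d)) (fwd d \o bwd c)
}.

Section Manifolds.
Context {R : realType} {n : nat}.
Implicit Types M N : manifold R n.

Definition smooth_fun {M} (f : M -> R) : Prop :=
  forall c, atlas c -> smooth_on (img c) (f \o bwd c).

Definition differential {M} (f : M -> R) (x : M) (v : 'rV[R]_n) : R :=
  'd (f \o bwd (chart_at x)) (fwd (chart_at x) x) v.

Definition smooth_map_on {M N} (U : set M) (f : M -> N) : Prop :=
  (forall x, U x -> {for x, continuous f}) /\
  (forall c d, atlas c -> atlas d ->
    smooth_on (fwd c @` (U `&` dom c `&` f @^-1` dom d))
              (fwd d \o f \o bwd c)).

Definition smooth_map {M N} (f : M -> N) : Prop := smooth_map_on setT f.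

(* As with [jacobian], matrices act on row vectors from the right: df(x) is
   v |-> v *m tangent_map f x. *)
Definition tangent_map {M N} (f : M -> N) (x : M) : 'M[R]_n :=
  jacobian (fwd (chart_at (f x)) \o f \o bwd (chart_at x)) (fwd (chart_at x) x).

(* Smoothness on an arbitrary subset means local extendability to a smooth map
   on an open set. The inverse is handled through its local extensions, as a
   globally defined N -> M need not exist when M is empty. *)
Definition diffeo_on {M N} (A : set M) (B : set N) (f : M -> N) : Prop :=
  [/\ set_bij A B f,
      forall x, A x -> exists (U : set M) (F : M -> N),
        [/\ open_nbhs x U, smooth_map_on U F &
            forall x', A x' -> U x' -> F x' = f x'] &
      forall y, B y -> exists (U : set N) (G : N -> M),
        [/\ open_nbhs y U, smooth_map_on U G &
            forall x', A x' -> U (f x') -> G (f x') = x']].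

Definition double_covering {M N} (f : M -> N) (B : set N) : Prop :=
  forall x, B x -> exists (U : set N) (V1 V2 : set M),
    [/\ open_nbhs x U /\ U `<=` B, open V1 /\ open V2,
        V1 `&` V2 = set0 /\ f @^-1` U = V1 `|` V2,
        diffeo_on V1 U f & diffeo_on V2 U f].

Definition embedded_hypersurface {M} (A : set M) : Prop :=
  forall x c, A x -> atlas c -> dom c x ->
    exists F : 'rV[R]_n -> 'rV[R]_1, cut_out (fwd c @` (A `&` dom c)) (fwd c x) F.

(* [met x] is the Gram matrix of g_x in the preferred chart at x; smoothness is
   that of the Gram matrix in the chart c. *)
Record metric (M : manifold R n) := Metric {
  met :> M -> 'M[R]_n;
  met_sym : forall x, (met x)^T = met x;
  met_pos : forall x (v : 'rV[R]_n), v != 0 -> 0 < (v *m met x *m v^T) ord0 ord0;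
  met_smooth : forall c : chart R n M, atlas c -> smooth_on (img c) (fun u =>
    let J := jacobian (fwd (chart_at (bwd c u)) \o bwd c) u in
    J *m met (bwd c u) *m J^T)
}.

(* (x, p) stands for the covector v |-> v *m p on T_x M = R^n, both expressed in
   the preferred chart at x. *)
Definition cotangent (M : manifold R n) : Type := (M * 'cV[R]_n)%type.

Definition metric_norm {M} (g : metric M) (x : M) (v : 'rV[R]_n) : R :=
  Num.sqrt ((v *m g x *m v^T) ord0 ord0).

Definition dual_norm {M} (g : metric M) (x : M) (p : 'cV[R]_n) : R :=
  sup [set `|(v *m p) ord0 ord0| | v in [set v | metric_norm g x v <= 1]].

Definition hamiltonian {M} (g : metric M) (phi : M -> R) (z : cotangent M) : R :=
  phi z.1 * dual_norm g z.1 z.2 ^+ 2.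

(* The canonical coordinates on T^*M induced by the chart c, and the inverse
   map. *)
Definition ct_fwd {M} (c : chart R n M) (z : cotangent M) :
    ('rV[R]_n * 'cV[R]_n)%type :=
  (fwd c z.1, jacobian (fwd (chart_at z.1) \o bwd c) (fwd c z.1) *m z.2).

Definition ct_bwd {M} (c : chart R n M) (w : ('rV[R]_n * 'cV[R]_n)%type) :
    cotangent M :=
  let x := bwd c w.1 in
  (x, jacobian (fwd c \o bwd (chart_at x)) (fwd (chart_at x) x) *m w.2).

Definition ct_img {M} (c : chart R n M) (A : set (cotangent M)) :
    set ('rV[R]_n * 'cV[R]_n)%type :=
  [set w | img c w.1 /\ A (ct_bwd c w)].

Definition smooth_ct {M} (F : cotangent M -> R) : Prop :=
  forall c : chart R n M, atlas c -> smooth_on (ct_img c setT) (F \o ct_bwd c).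

(* (y, p) |-> (f y, (df(y)^* )^-1 p), where df(y)^* is q |-> tangent_map f y *m q *)
Definition ct_proj {M N} (f : M -> N) (z : cotangent M) : cotangent N :=
  (f z.1, invmx (tangent_map f z.1) *m z.2).

(* The right-hand side (dF/dp, - dF/dx) of Hamilton's equations. *)
Definition ham_field (F : ('rV[R]_n * 'cV[R]_n)%type -> R)
    (w : ('rV[R]_n * 'cV[R]_n)%type) : ('rV[R]_n * 'cV[R]_n)%type :=
  (\row_i 'D_(0, delta_mx i ord0) F w, \col_i (- 'D_(delta_mx ord0 i, 0) F w)).

Definition trajectory {M} (F : cotangent M -> R) (I : set R)
    (gamma : R -> cotangent M) : Prop :=
  [/\ open I, is_interval I,
      forall t, I t -> {for t, continuous (fun s => (gamma s).1)} &
      forall t (c : chart R n M), I t -> atlas c -> dom c (gamma t).1 ->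
        is_derive t 1 (ct_fwd c \o gamma)
          (ham_field (F \o ct_bwd c) (ct_fwd c (gamma t)))].

(* The Hamiltonian field of F at z is the velocity of the trajectories through
   z; it has to be transverse to S inside E at every point of S. *)
Definition cross_transversely {M} (F : cotangent M -> R)
    (E S : set (cotangent M)) : Prop :=
  forall z (c : chart R n M), S z -> atlas c -> dom c z.1 ->
    transverse_at (ct_img c E) (ct_img c S) (ct_fwd c z)
      (ham_field (F \o ct_bwd c) (ct_fwd c z)).

End Manifolds.

(* Main.v *)
(* The double is [{(x, s) | s^2 = phi x}], a submanifold of M x R because 0 is a
   regular value of [s^2 - phi x], with [pi (x, s) = x]; it is a graph over x where
   [s != 0] and over the remaining coordinates and [s] near the fold [s = 0].

   In coordinates let [J] be the Jacobian matrix of [pi], [a] the gradient of [s]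
   and [b] that of [phi], so that [J b = 2 s a].  Off the fold
   [phi |p_x|^2 = |s J^-1 p_y|^2], and [K = s J^-1] satisfies [K J = s] and
   [K a = b / 2].  As [(J | a)] is the Jacobian matrix of an immersion, these
   equations determine [K] by a smooth formula across the fold, whence the smooth
   extension [|K p_y|^2] of the Hamiltonian.

   Off the fold the projection is the canonical lift of a local diffeomorphism,
   hence maps solutions of Hamilton's equations to solutions.  On the fold
   [s = 0] gives [K = b k] for some row [k]; at energy [h = (k p)^2 |b|^2 > 0] the
   derivative of [s] along the flow is
   [a . dH/dp = 2 <K a, K p> = (k p) |b|^2 != 0]. *)
Require Import Defs.
From HB Require Import structures.
From mathcomp Require Import all_boot all_order all_algebra.
From mathcomp Require Import all_classical all_reals all_analysis.
From mathcomp Require Import ring lra.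

Set Implicit Arguments.
Unset Strict Implicit.
Unset Printing Implicit Defensive.

Import Order.TTheory GRing.Theory Num.Theory.
Import numFieldNormedType.Exports.

Local Open Scope classical_set_scope.
Local Open Scope ring_scope.

(** * Calculus of smooth maps *)

(** Near the fold, coordinates come from solving [phi = s ^+ 2] for one coordinate of the base
    point, and the solution is at first known only to be continuous. Smoothness is recovered
    afterwards by one principle, [Ck_lift]: a continuous map is as smooth as its composite with an
    immersion. The same principle makes charts compatible. The atlas of the double consists of all
    charts in which the inclusion into M x R is an immersion, so a map into the double is smooth as
    soon as its base point and its height are, and sheet charts and fold charts never have to be
    compared case by case.

    On the fold J has no inverse, so K cannot be carried from chart to chart through J^-1. Its two
    linear equations make sense everywhere and have a single solution, hence the rule for changing
    charts follows from uniqueness. That a solution exists on the fold uses d phi <> 0 once more: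
    there J b = 0 with b <> 0, and J + a b^T is invertible. *)

Section Differentiability.
Context {R : realType} {V W : normedModType R}.
Implicit Types (f g : V -> W) (U A : set V).

Lemma near_open U x (P : V -> Prop) : open U -> U x -> (forall y, U y -> P y) ->
  \forall y \near x, P y.
Proof.
by move=> oU Ux UP; apply: (filterS UP); exact: open_nbhs_nbhs.
Qed.

Lemma near_ball x (P Q : V -> Prop) :
  (\forall y \near x, P y) -> (\forall y \near x, Q y) ->
  exists2 d : R, 0 < d & forall y, ball x d y -> P y /\ Q y.
Proof.
move=> Px Qx.
have /nbhs_ballP[d /= d0 Hd] : \forall y \near x, P y /\ Q y by exact: filterI.
by exists d.
Qed.

Lemma differentiable_eps f x : differentiable f x -> forall e : R, 0 < e ->
  \forall h \near (0 : V), `|f (h + x) - f x - 'd f x h| <= e * `|h|.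
Proof.
move=> /diff_locallyP[_ /eqaddoP fx] e e0.
by apply: filterS (fx e e0) => h /=; rewrite !fctE /= opprD addrA.
Qed.

Lemma differentiable_ex f x (df : {linear V -> W}) : continuous df ->
  (forall e : R, 0 < e ->
     \forall h \near (0 : V), `|f (h + x) - f x - df h| <= e * `|h|) ->
  differentiable f x /\ 'd f x = df :> (V -> W).
Proof.
move=> cdf H.
have E : f \o shift x = cst (f x) + df +o_ 0 id.
  apply/eqaddoP => e e0; apply: filterS (H e e0) => h /=.
  by rewrite !fctE /= opprD addrA.
have D := diff_unique cdf E.
by split => //; apply/diff_locallyP; rewrite D.
Qed.

Lemma near_eq_differentiable f g x :
  (\forall y \near x, f y = g y) -> differentiable f x -> differentiable g x.
Proof.
move=> fg df; suff [] : differentiable g x /\ 'd g x = 'd f x :> (V -> W) by [].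
apply: differentiable_ex; first exact: diff_continuous.
move=> e e0; have fgx := nbhs_singleton fg.
have fg' : \forall h \near (0 : V), f (h + x) = g (h + x).
  have := fg; rewrite (@near_shift _ _ (0 : V)) subr0 => H.
  by apply: filterS H => h /=.
by apply: filterS2 (differentiable_eps df e0) fg' => h + <-; rewrite -fgx.
Qed.

Lemma near_eq_diff f g x v : differentiable f x ->
  (\forall y \near x, f y = g y) -> 'd f x v = 'd g x v.
Proof.
move=> df fg; rewrite -!deriveE//; first exact: near_eq_derive.
exact: near_eq_differentiable fg df.
Qed.

End Differentiability.

Section CkTheory.
Context {R : realType} {V : normedModType R}.
Implicit Types (U A : set V).

Lemma Ck_sub {W : normedModType R} k U A (f : V -> W) :
  A `<=` U -> Ck k U f -> Ck k A f.
Proof.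
move=> AU; elim: k f => [|k IH] f /=; first by move=> H x /AU; exact: H.
by move=> [H1 H2]; split => [x /AU|v]; [exact: H1|exact: IH].
Qed.

(** The sets [A] need not be open: each clause of [Ck] is a condition at the points of the set, on
    derivatives taken in the whole space. *)
Lemma Ck_local {W : normedModType R} k U (f : V -> W) :
  (forall x, U x -> exists2 A, A x & Ck k A f) -> Ck k U f.
Proof.
elim: k f => [|k IH] f /= H.
  by move=> x /H[A Ax]; exact.
split => [x /H[A Ax [+ _]]|v]; first exact.
by apply: IH => x /H[A Ax [_ /(_ v)]]; exists A.
Qed.

Lemma Ck_eq {W : normedModType R} k U (f g : V -> W) : open U ->
  (forall x, U x -> f x = g x) -> Ck k U f -> Ck k U g.
Proof.
move=> oU; elim: k f g => [|k IH] f g /= fg.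
  move=> cf x Ux; have fgx : \forall y \near x, f y = g y by exact: near_open fg.
  rewrite /prop_for /continuous_at -(fg x Ux).
  by apply: cvg_trans (cf x Ux); exact: near_eq_cvg.
move=> [df cf]; split => [x Ux|v].
  by apply: near_eq_differentiable (df x Ux); exact: near_open fg.
apply: IH (cf v) => x Ux; apply: near_eq_derive.
exact: near_open fg.
Qed.

Lemma CkW {W : normedModType R} k U (f : V -> W) : Ck k.+1 U f -> Ck k U f.
Proof.
elim: k f => [|k IH] f.
  by move=> [df _] x Ux; apply: differentiable_continuous; exact: df.
by move=> [df cf]; split => // v; apply: IH; exact: cf.
Qed.

Lemma Ck_differentiable {W : normedModType R} k U (f : V -> W) x :
  Ck k.+1 U f -> U x -> differentiable f x.
Proof. by move=> [+ _]; exact. Qed.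

Lemma Ck_cst {W : normedModType R} k U (a : W) : Ck k U (fun=> a).
Proof.
elim: k a => [|k IH] a /=; first by move=> x _; exact: cvg_cst.
split => [x _|v]; first exact: differentiable_cst.
have -> : (fun x : V => 'D_v (fun=> a) x) = (fun=> 0 : W).
  by apply/funext => x; exact: derive_cst.
exact: IH.
Qed.

Lemma Ck_linear {W : normedModType R} k U (f : {linear V -> W}) :
  continuous f -> Ck k U f.
Proof.
move=> cf; case: k => [|k] /=; first by move=> x _; exact: cf.
split => [x _|v]; first exact: linear_differentiable.
have -> : (fun x : V => 'D_v f x) = (fun=> f v).
  apply/funext => x; rewrite deriveE; last exact: linear_differentiable.
  by rewrite diff_lin.
exact: Ck_cst.
Qed.

(* Open domain: the derivative of a sum is the sum of the derivatives only where
   both exist. *)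
Lemma CkD {W : normedModType R} k U (f g : V -> W) : open U ->
  Ck k U f -> Ck k U g -> Ck k U (fun x => f x + g x).
Proof.
move=> oU; elim: k f g => [|k IH] f g /=.
  by move=> cf cg x Ux; apply: continuousD; [exact: cf|exact: cg].
move=> [df cf] [dg cg]; split => [x Ux|v].
  by apply: (@differentiableD _ _ _ f g); [exact: df|exact: dg].
apply: (@Ck_eq _ _ _ (fun x => 'D_v f x + 'D_v g x)) => //.
  move=> x Ux; rewrite -(@deriveD _ _ _ f g)//; apply: diff_derivable;
  by [exact: df|exact: dg].
by apply: IH.
Qed.

Lemma Ck_sum {W : normedModType R} k U (I : Type) (r : seq I) (P : pred I)
    (f : I -> V -> W) :
  open U -> (forall i, P i -> Ck k U (f i)) ->
  Ck k U (fun x => \sum_(i <- r | P i) f i x).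
Proof.
move=> oU cf; elim: r => [|i r IH].
  apply: (@Ck_eq _ _ _ (fun=> 0)) => //; last exact: Ck_cst.
  by move=> x _; rewrite big_nil.
have [Pi|/negPf Pi] := boolP (P i); last first.
  by apply: Ck_eq IH => // x _; rewrite big_cons Pi.
apply: (@Ck_eq _ _ _ (fun x => f i x + \sum_(i <- r | P i) f i x)) => //.
  by move=> x _; rewrite big_cons Pi.
by apply: CkD => //; exact: cf.
Qed.

Lemma CkM k U (f g : V -> R) : open U ->
  Ck k U f -> Ck k U g -> Ck k U (fun x => f x * g x).
Proof.
move=> oU; elim: k f g => [|k IH] f g.
  by move=> /= cf cg x Ux; apply: cvgM; [exact: cf|exact: cg].
move=> Cf Cg; have cf1 := CkW Cf; have cg1 := CkW Cg.
case: Cf Cg => df cf [dg cg]; split => [x Ux|v].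
  by apply: (@differentiableM _ _ f g); [exact: df|exact: dg].
apply: (@Ck_eq _ _ _ (fun x => f x * 'D_v g x + g x * 'D_v f x)) => //.
  move=> x Ux; rewrite -[LHS](@deriveM _ _ f g)//; apply: diff_derivable;
  by [exact: df|exact: dg].
by apply: CkD => //; apply: IH => //; [exact: cg|exact: cf].
Qed.

Lemma CkN k U (f : V -> R) : open U -> Ck k U f -> Ck k U (fun x => - f x).
Proof.
move=> oU cf; apply: (@Ck_eq _ _ _ (fun x => -1 * f x)) => //.
  by move=> x _; rewrite mulN1r.
by apply: CkM => //; exact: Ck_cst.
Qed.

Lemma Ck_prod k U (I : Type) (r : seq I) (P : pred I) (f : I -> V -> R) :
  open U -> (forall i, P i -> Ck k U (f i)) ->
  Ck k U (fun x => \prod_(i <- r | P i) f i x).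
Proof.
move=> oU cf; elim: r => [|i r IH].
  apply: (@Ck_eq R _ _ (fun=> 1 : R)) => //; last exact: Ck_cst.
  by move=> x _; rewrite big_nil.
have [Pi|/negPf Pi] := boolP (P i); last first.
  by apply: Ck_eq IH => // x _; rewrite big_cons Pi.
apply: (@Ck_eq _ _ _ (fun x => f i x * \prod_(i <- r | P i) f i x)) => //.
  by move=> x _; rewrite big_cons Pi.
by apply: CkM => //; exact: cf.
Qed.

Lemma CkV k U (f : V -> R) : open U -> (forall x, U x -> f x != 0) ->
  Ck k U f -> Ck k U (fun x => (f x)^-1).
Proof.
move=> oU f0; elim: k => [|k IH].
  by move=> /= cf x Ux; apply: cvgV; [exact: f0|exact: cf].
move=> Cf; have Cf1 := CkW Cf; case: Cf => df cf; split => [x Ux|v].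
  by apply: differentiableV; [exact: df|exact: f0].
apply: (@Ck_eq _ _ _ (fun x => - ((f x)^-1 * (f x)^-1 * 'D_v f x))) => //.
  move=> x Ux; rewrite deriveV; last 2 first.
    exact: f0.
    by apply: diff_derivable; exact: df.
  by rewrite -mulNr scaleNr -invfM -expr2 mulNr.
by apply: CkN => //; apply: CkM => //; [apply: CkM => //; exact: IH|exact: cf].
Qed.

(* The smoothness of a square root, read off [D s = D f / 2 s]. *)
Lemma Ck_root k U (f s : V -> R) : open U -> (forall x, U x -> s x != 0) ->
  (forall x, U x -> differentiable s x) ->
  (forall x, U x -> s x * s x = f x) -> Ck k U f -> Ck k U s.
Proof.
move=> oU s0 ds sf; elim: k => [_|k IH Cf].
  by move=> x Ux; apply: differentiable_continuous; exact: ds.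
split => // v; have Cs := IH (CkW Cf).
apply: (@Ck_eq _ _ _ (fun x => 'D_v f x * (2 * s x)^-1)) => //; last first.
  apply: CkM => //; first by have [_] := Cf; apply.
  apply: CkV => //; last by apply: CkM => //; exact: Ck_cst.
  by move=> x Ux; rewrite mulf_neq0 ?pnatr_eq0// s0.
move=> x Ux.
have -> : 'D_v f x = 'D_v (s * s) x.
  by apply: near_eq_derive; apply: near_open oU Ux _ => y Uy; rewrite -sf.
have dsx : derivable s x v by apply: diff_derivable; exact: ds.
rewrite deriveM// -scalerDl -mulr2n -mulr_natl -[_ *: _]/(_ * _).
rewrite mulr_natl -[s x *+ 2]mulr_natl mulrAC.
by rewrite mulfV ?mul1r// mulf_neq0 ?pnatr_eq0// s0.
Qed.

Lemma Ck_coord k U m n (f : V -> 'M[R]_(m, n)) i j : open U ->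
  Ck k U f -> Ck k U (fun x => f x i j).
Proof.
move=> oU; elim: k f => [|k IH] f.
  move=> cf x Ux.
  apply: (@continuous_comp _ _ _ f (fun N : 'M[R]_(m, n) => N i j)).
    exact: cf.
  exact: coord_continuous.
move=> [df cf]; split => [x Ux|v].
  apply: (@differentiable_comp _ _ _ _ f (fun N : 'M[R]_(m, n) => N i j : R)).
    exact: df.
  exact: differentiable_coord.
apply: Ck_eq (IH _ (cf v)) => // x Ux.
by rewrite derive_mx ?mxE//; apply: diff_derivable; exact: df.
Qed.

End CkTheory.

Section CkMatrix.
Context {R : realType} {V : normedModType R}.
Implicit Types (U A : set V).

Lemma CkZl {W : normedModType R} k U (f : V -> R) (w : W) : open U ->
  Ck k U f -> Ck k U (fun x => f x *: w).
Proof.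
move=> oU; elim: k f => [|k IH] f.
  by move=> /= cf x Ux; apply: cvgZr_tmp; exact: cf.
move=> [df cf]; split => [x Ux|v].
  by apply: differentiableZl; exact: df.
apply: (@Ck_eq _ _ _ _ _ (fun x => 'D_v f x *: w)) => //; last first.
  by apply: IH; exact: cf.
move=> x Ux; have dfx := df x Ux.
rewrite [RHS]deriveE; last exact: differentiableZl.
by rewrite diffZl// deriveE.
Qed.

Lemma Ck_mx k U m n (f : V -> 'M[R]_(m, n)) : open U ->
  (forall i j, Ck k U (fun x => f x i j)) -> Ck k U f.
Proof.
move=> oU cf.
apply: (@Ck_eq _ _ _ _ _ (fun x => \sum_i \sum_j f x i j *: delta_mx i j)) => //.
  by move=> x _; rewrite -matrix_sum_delta.
by apply: Ck_sum => // i _; apply: Ck_sum => // j _; exact: CkZl.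
Qed.

Lemma Ck_mulmx k U m n p (f : V -> 'M[R]_(m, n)) (g : V -> 'M[R]_(n, p)) :
  open U -> Ck k U f -> Ck k U g -> Ck k U (fun x => f x *m g x).
Proof.
move=> oU cf cg; apply: Ck_mx => // i j.
apply: (@Ck_eq _ _ _ _ _ (fun x => \sum_l f x i l * g x l j)) => //.
  by move=> x _; rewrite mxE.
by apply: Ck_sum => // l _; apply: CkM => //; exact: Ck_coord.
Qed.

Lemma Ck_trmx k U m n (f : V -> 'M[R]_(m, n)) :
  open U -> Ck k U f -> Ck k U (fun x => (f x)^T).
Proof.
move=> oU cf; apply: Ck_mx => // i j.
apply: (@Ck_eq _ _ _ _ _ (fun x => f x j i)) => //; last exact: Ck_coord.
by move=> x _; rewrite mxE.
Qed.

Lemma CkZ k U m n (s : V -> R) (f : V -> 'M[R]_(m, n)) :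
  open U -> Ck k U s -> Ck k U f -> Ck k U (fun x => s x *: f x).
Proof.
move=> oU cs cf; apply: Ck_mx => // i j.
apply: (@Ck_eq _ _ _ _ _ (fun x => s x * f x i j)) => //.
  by move=> x _; rewrite mxE.
by apply: CkM => //; exact: Ck_coord.
Qed.

Lemma Ck_det k U n (f : V -> 'M[R]_n) :
  open U -> Ck k U f -> Ck k U (fun x => \det (f x)).
Proof.
move=> oU cf; apply: Ck_sum => // s _; apply: CkM => //; first exact: Ck_cst.
by apply: Ck_prod => // i _; exact: Ck_coord.
Qed.

(** Cramer's rule: the entries of the inverse are polynomials in the entries of the matrix, divided
    by its determinant. *)
Lemma Ck_invmx k U n (f : V -> 'M[R]_n) :
  open U -> (forall x, U x -> f x \in unitmx) -> Ck k U f ->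
  Ck k U (fun x => invmx (f x)).
Proof.
move=> oU fu cf.
apply: (@Ck_eq _ _ _ _ _ (fun x => (\det (f x))^-1 *: \adj (f x))) => //.
  by move=> x Ux; rewrite /invmx fu.
apply: CkZ => //.
  apply: CkV => //; last exact: Ck_det.
  by move=> x /fu; rewrite unitmxE unitfE.
apply: Ck_mx => // i j.
apply: (@Ck_eq _ _ _ _ _
  (fun x => (-1) ^+ (j + i) * \det (row' j (col' i (f x))))) => //.
  by move=> x _; rewrite mxE.
apply: CkM => //; first exact: Ck_cst.
apply: Ck_det => //; apply: Ck_mx => // a b.
apply: (@Ck_eq _ _ _ _ _ (fun x => f x (lift j a) (lift i b))) => //.
  by move=> x _; rewrite !mxE.
exact: Ck_coord.
Qed.

Lemma Ck_row_mx k U m n p (f : V -> 'M[R]_(m, n)) (g : V -> 'M[R]_(m, p)) :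
  open U -> Ck k U f -> Ck k U g -> Ck k U (fun x => row_mx (f x) (g x)).
Proof.
move=> oU cf cg; apply: Ck_mx => // i j.
case E : (fintype.split j) => [l|l].
  apply: (@Ck_eq _ _ _ _ _ (fun x => f x i l)) => //; last exact: Ck_coord.
  by move=> x _; rewrite mxE E.
apply: (@Ck_eq _ _ _ _ _ (fun x => g x i l)) => //; last exact: Ck_coord.
by move=> x _; rewrite mxE E.
Qed.

Lemma Ck_scalar_mx k U (f : V -> R) : open U -> Ck k U f ->
  Ck k U (fun x => (f x)%:M : 'M[R]_1).
Proof.
move=> oU cf; apply: Ck_mx => // i j; apply: Ck_eq cf => // x _.
by rewrite !ord1 mxE.
Qed.

End CkMatrix.

Section FiniteDimension.
Context {R : realType}.

Lemma Ck_id {V : normedModType R} k (U : set V) : Ck k U id.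
Proof. by apply: (@Ck_linear _ _ _ _ _ idfun) => x; exact: cvg_id. Qed.

Lemma linear_rV_sum m {W : lmodType R} (f : {linear 'rV[R]_m -> W}) v :
  f v = \sum_i v ord0 i *: f (delta_mx ord0 i).
Proof.
rewrite {1}(row_sum_delta v) linear_sum.
by apply: eq_bigr => i _; rewrite linearZ.
Qed.

Lemma linear_rV_continuous m {W : normedModType R}
  (f : {linear 'rV[R]_m -> W}) : continuous f.
Proof.
have : Ck 0 setT (fun v : 'rV[R]_m => \sum_i v ord0 i *: f (delta_mx ord0 i)).
  have oT : open [set: 'rV[R]_m] by exact: openT.
  by apply: Ck_sum => // i _; apply: CkZl => //; apply: Ck_coord => //; exact: Ck_id.
move=> H v; have := H v I.
by rewrite (_ : (fun v => _) = f)//; apply/funext => w; rewrite -linear_rV_sum.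
Qed.

Definition grad n (f : 'rV[R]_n -> R) (u : 'rV[R]_n) : 'cV[R]_n :=
  \col_i 'D_(delta_mx ord0 i) f u.

Lemma grad_derive n (f : 'rV[R]_n -> R) u v : differentiable f u ->
  'D_v f u = (v *m grad f u) ord0 ord0.
Proof.
move=> df; rewrite deriveE// linear_rV_sum mxE.
by apply: eq_bigr => i _; rewrite mxE deriveE.
Qed.

Lemma Ck_grad k n U (f : 'rV[R]_n -> R) : open U -> Ck k.+1 U f ->
  Ck k U (grad f).
Proof.
move=> oU [_ cf]; apply: Ck_mx => // i j; apply: Ck_eq (cf (delta_mx ord0 i)) => //.
by move=> x _; rewrite mxE.
Qed.

Lemma Ck_jacobian k m n U (f : 'rV[R]_m -> 'rV[R]_n) : open U -> Ck k.+1 U f ->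
  Ck k U (jacobian f).
Proof.
move=> oU [df cf]; apply: Ck_mx => // i j.
apply: (@Ck_eq _ _ _ _ _ (fun x => ('D_(delta_mx ord0 i) f x) ord0 j)) => //.
  by move=> x Ux; rewrite deriveE ?mxE//; exact: df.
by apply: Ck_coord => //; exact: cf.
Qed.

(** Induction on [k] with [f] fixed and [g] varying: by the chain rule the derivative of the
    composite is the sum over i of the i-th coordinate of the derivative of [f] times the i-th
    partial derivative of [g], composed with [f]. *)
Lemma Ck_comp {V : normedModType R} k m (A : set V) (B : set 'rV[R]_m)
    (f : V -> 'rV[R]_m) (g : 'rV[R]_m -> R) :
  open A -> (forall x, A x -> B (f x)) -> Ck k A f -> Ck k B g ->
  Ck k A (g \o f).
Proof.
move=> oA AB; elim: k g => [|k IH] g cf cg.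
  by move=> x Ax; apply: continuous_comp; [exact: cf|apply: cg; exact: AB].
have cf1 := CkW cf; move: cf cg => [df cf] [dg cg]; split => [x Ax|v].
  by apply: differentiable_comp; [exact: df|apply: dg; exact: AB].
apply: (@Ck_eq _ _ _ _ _
  (fun x => \sum_i ('D_v f x) ord0 i * 'D_(delta_mx ord0 i) g (f x))) => //.
  move=> x Ax; have dgx := dg _ (AB _ Ax); have dfx := df _ Ax.
  rewrite [RHS]deriveE; last exact: differentiable_comp.
  rewrite diff_comp//= linear_rV_sum.
  by apply: eq_bigr => i _; rewrite !deriveE.
apply: Ck_sum => // i _; apply: CkM => //.
  by apply: Ck_coord => //; exact: cf.
by apply: (IH ('D_(delta_mx ord0 i) g)) => //; exact: cg.
Qed.

Lemma Ck_comp_mx {V : normedModType R} k m p q (A : set V) (B : set 'rV[R]_m)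
    (f : V -> 'rV[R]_m) (g : 'rV[R]_m -> 'M[R]_(p, q)) :
  open A -> open B -> (forall x, A x -> B (f x)) -> Ck k A f -> Ck k B g ->
  Ck k A (g \o f).
Proof.
move=> oA oB AB cf cg; apply: Ck_mx => // i j.
by apply: (@Ck_comp _ _ _ _ B f (fun y => g y i j)) => //; exact: Ck_coord.
Qed.

Lemma jacobian_comp m n p (f : 'rV[R]_m -> 'rV[R]_n) (g : 'rV[R]_n -> 'rV[R]_p)
    u w : f u = w -> differentiable f u -> differentiable g w ->
  jacobian (g \o f) u = jacobian f u *m jacobian g w.
Proof.
move=> <- df dg; apply/row_matrixP => i; rewrite !rowE mulmxA.
by rewrite /jacobian !mul_rV_lin1/= diff_comp.
Qed.

Lemma lin1_mx_eq m n (f g : {linear 'rV[R]_m -> 'rV[R]_n}) : f =1 g ->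
  lin1_mx f = lin1_mx g.
Proof. by move=> fg; apply/matrixP => i j; rewrite mxE fg [RHS]mxE. Qed.

Lemma jacobian_near_eq m n (f g : 'rV[R]_m -> 'rV[R]_n) u :
  differentiable f u -> (\forall x \near u, f x = g x) ->
  jacobian f u = jacobian g u.
Proof.
by move=> df fg; apply: lin1_mx_eq => v; exact: near_eq_diff.
Qed.

Lemma jacobian_id n (u : 'rV[R]_n) : jacobian id u = 1%:M.
Proof.
apply/row_matrixP => i; rewrite !rowE mulmx1 /jacobian mul_rV_lin1/=.
by rewrite diff_val.
Qed.

Lemma grad_comp m n (f : 'rV[R]_m -> 'rV[R]_n) (g : 'rV[R]_n -> R) u w :
  f u = w -> differentiable f u -> differentiable g w ->
  grad (g \o f) u = jacobian f u *m grad g w.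
Proof.
move=> <- df dg; apply/row_matrixP => i; rewrite !rowE.
apply/rowP => j; rewrite ord1 -[LHS]grad_derive; last exact: differentiable_comp.
rewrite deriveE; last exact: differentiable_comp.
by rewrite diff_comp//= -deriveE// grad_derive// mulmxA /jacobian mul_rV_lin1.
Qed.

Lemma trmx_norm_eq0 m (w : 'rV[R]_m) : w *m w^T = 0 -> w = 0.
Proof.
move=> /matrixP/(_ ord0 ord0); rewrite !mxE => /eqP.
rewrite psumr_eq0; last by move=> i _; rewrite mxE -expr2 sqr_ge0.
move=> /allP H; apply/rowP => i; rewrite mxE.
have := H i (mem_index_enum i); rewrite implyTb mxE -expr2 sqrf_eq0.
by move/eqP.
Qed.

Lemma unitmx_inj n (A : 'M[R]_n) :
  (forall v : 'rV[R]_n, v *m A = 0 -> v = 0) -> A \in unitmx.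
Proof. by move=> H; rewrite -row_free_unit; exact: inj_row_free. Qed.

(** If [v *m (N *m N^T)] vanishes, so does the squared norm of [v *m N]. *)
Lemma gram_unit n m (N : 'M[R]_(n, m)) :
  (forall v : 'rV[R]_n, v *m N = 0 -> v = 0) -> N *m N^T \in unitmx.
Proof.
move=> Ninj; apply: unitmx_inj => v vN; apply: Ninj; apply: trmx_norm_eq0.
by rewrite trmx_mul mulmxA -(mulmxA v) vN mul0mx.
Qed.

End FiniteDimension.

(** * Immersions, second derivatives and implicit functions *)

Section Lift.
Context {R : realType} {V : normedModType R}.

Lemma linear_rV_bound m {W : normedModType R} (f : {linear 'rV[R]_m -> W}) :
  exists2 C : R, 0 < C & forall v, `|f v| <= C * `|v|.
Proof.
have [C C0 HC] := linear_lipschitz (@linear_rV_continuous R m W f).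
by exists C.
Qed.

Lemma differentiable_bound {W : normedModType R} (f : V -> W) x :
  differentiable f x -> exists2 C : R, 0 < C & forall v, `|'d f x v| <= C * `|v|.
Proof.
move=> df; have [C C0 HC] := linear_lipschitz (@diff_continuous _ _ _ _ _ df).
by exists C.
Qed.

(** With k the increment of [t], k = di(k) L, and di(k) is the increment of [i \o t] up to o(|k|),
    that is d(i o t)(h) + o(|h|) + o(|k|). The obstacle is the error in |k|: it is first absorbed to
    give |k| = O(|h|), and only then is it small with respect to |h|. *)
Lemma lift_differentiable n m (i : 'rV[R]_n -> 'rV[R]_m) (t : V -> 'rV[R]_n)
    (L : 'M[R]_(m, n)) x :
  {for x, continuous t} -> differentiable i (t x) ->
  jacobian i (t x) *m L = 1%:M -> differentiable (i \o t) x ->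
  differentiable t x /\ forall v, 'D_v t x = 'D_v (i \o t) x *m L.
Proof.
move=> ct di NL dit.
have [C C0 HC] := linear_rV_bound (mulmxr L).
have [D D0 HD] := differentiable_bound dit.
pose df := (mulmxr L \o 'd (i \o t) x)%R.
have cdf : continuous (df : V -> 'rV[R]_n).
  move=> v; apply: continuous_comp; first exact: diff_continuous.
  exact: linear_rV_continuous.
suff [dt Edt] : differentiable t x /\ 'd t x = df :> (V -> 'rV[R]_n).
  by split => // v; rewrite !deriveE// Edt.
apply: differentiable_ex => // e e0.
(* [e2] makes C e2 = e / 2. The first bound in [e1] gives C e1 <= 1/2, which yields |k| <= B |h|;
   the second then gives C e1 B <= e / 2, and the two halves add up to [e]. *)
pose e2 := e / (2 * C).
have e20 : 0 < e2 by rewrite divr_gt0// mulr_gt0.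
pose B := 2 * C * (D + e2).
have B0 : 0 < B by rewrite !mulr_gt0// addr_gt0.
pose e1 := Num.min (1 / (2 * C)) (e / (2 * C * B)).
have e10 : 0 < e1.
  rewrite lt_min; apply/andP; split; apply: divr_gt0 => //; first exact: mulr_gt0.
  by apply: mulr_gt0 => //; exact: mulr_gt0.
have Hi := differentiable_eps di e10.
have Ht := differentiable_eps dit e20.
have ct0 : (fun h => t (h + x) - t x) @ (0 : V) --> (0 : 'rV[R]_n).
  rewrite -(subrr (t x)); apply: cvgB; last exact: cvg_cst.
  rewrite -{2}(add0r x); apply: (@continuous_comp _ _ _ (fun h => h + x) t).
    by apply: cvgD; [exact: cvg_id|exact: cvg_cst].
  by rewrite add0r.
have Hi' : \forall h \near (0 : V),
    `|i (t (h + x) - t x + t x) - i (t x) - 'd i (t x) (t (h + x) - t x)| <=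
    e1 * `|t (h + x) - t x| := ct0 _ Hi.
move: Hi' Ht; apply: filterS2 => h; rewrite subrK => H1 H2.
set k := t (h + x) - t x in H1 *.
(* [L] undoes the differential of the immersion, so an estimate on di(k) becomes one on k, at the
   cost of the factor [C]. *)
have kL : 'd i (t x) k *m L = k.
  by rewrite -deriveE// deriveEjacobian// -mulmxA NL mulmx1.
have H3 : `|k - df h| <= C * (e1 * `|k| + e2 * `|h|).
  rewrite -{1}kL /df /= -mulmxBl.
  apply: le_trans (HC _) _; rewrite ler_pM2l//.
  set a := 'd i _ _ in H1 *; set b := 'd (i \o t) _ _ in H2 *.
  set c := i (t (h + x)) - i (t x) in H1 H2.
  rewrite -(subrKA c) addrC; apply: le_trans (ler_normD _ _) _.
  by rewrite addrC lerD// distrC.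
have Ce1 : C * e1 <= 1 / 2.
  rewrite (@le_trans _ _ (C * (1 / (2 * C))))//.
    by rewrite ler_pM2l// ge_min lexx.
  by rewrite mul1r invfM mulrCA mulfV ?gt_eqF// mulr1 mul1r.
have Ce2 : C * e2 = e / 2.
  by rewrite /e2; field; rewrite gt_eqF.
(* Since C e1 <= 1/2, half of |k| moves to the left-hand side. *)
have H4 : `|k| <= B * `|h|.
  have : `|k| <= C * (e1 * `|k| + e2 * `|h|) + C * D * `|h|.
    rewrite -{1}(subrK (df h) k); apply: le_trans (ler_normD _ _) _.
    rewrite lerD// /df /=; apply: le_trans (HC _) _.
    by rewrite -mulrA ler_pM2l.
  have k0 : 0 <= `|k| by [].
  have : C * e1 * `|k| <= 1 / 2 * `|k| by rewrite ler_wpM2r.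
  rewrite /B; nra.
apply: le_trans H3 _.
rewrite mulrDr (mulrA C e1) (mulrA C e2) Ce2.
have -> : e * `|h| = e / 2 * `|h| + e / 2 * `|h| by rewrite -mulrDl -splitr.
rewrite lerD//.
have : C * e1 * B <= e / 2.
  have : e1 <= e / (2 * C * B) by rewrite ge_min lexx orbT.
  have CB0 : 0 < 2 * C * B by apply: mulr_gt0 => //; exact: mulr_gt0.
  by rewrite ler_pdivlMr// => H; rewrite ler_pdivlMr//; clear -H; lra.
move=> H5; apply: (@le_trans _ _ (C * e1 * (B * `|h|))).
  by rewrite ler_pM2l// mulr_gt0.
by rewrite mulrA ler_wpM2r.
Qed.

(* The components of a continuous map into an immersed submanifold are as smooth
   as those of its composite with the immersion: differentiating
   [D (i \o t) = D t *m N(t)] can be undone by the pseudo-inverse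
   [N^T *m (N *m N^T)^-1] of the injective matrix [N] of the immersion. *)
Lemma Ck_lift k n m (A : set V) (B : set 'rV[R]_n)
    (i : 'rV[R]_n -> 'rV[R]_m) (t : V -> 'rV[R]_n) :
  open A -> open B -> (forall x, A x -> B (t x)) ->
  (forall x, A x -> {for x, continuous t}) ->
  smooth_on B i ->
  (forall u, B u -> forall v : 'rV[R]_n, v *m jacobian i u = 0 -> v = 0) ->
  Ck k A (i \o t) -> Ck k A t.
Proof.
move=> oA oB AB ct si inj.
pose L u := (jacobian i u)^T *m invmx (jacobian i u *m (jacobian i u)^T).
have NL u : B u -> jacobian i u *m L u = 1%:M.
  by move=> Bu; rewrite mulmxA mulmxV// gram_unit//; exact: inj.
have cL j : Ck j B L.
  have cj : Ck j B (jacobian i) by exact/Ck_jacobian.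
  apply: Ck_mulmx => //; first exact: Ck_trmx.
  apply: Ck_invmx => // [u Bu|]; first by apply: gram_unit; exact: inj.
  by apply: Ck_mulmx => //; exact: Ck_trmx.
elim: k => [//|k IH] Cit.
have H x (Ax : A x) : differentiable t x /\
    forall v, 'D_v t x = 'D_v (i \o t) x *m L (t x).
  have Btx := AB _ Ax.
  apply: lift_differentiable; first exact: ct.
  - exact: Ck_differentiable (si 1%N) Btx.
  - exact: NL.
  - exact: Ck_differentiable Cit Ax.
split => [x /H[]//|v].
apply: (@Ck_eq _ _ _ _ _ (fun x => 'D_v (i \o t) x *m L (t x))) => //.
  by move=> x /H[_ ->].
(* The formula for the derivative of [t] involves [t] itself only through [L], and [t] is of class
   [k] by induction: each round gains one order. *)
apply: Ck_mulmx => //; first by have [_] := Cit; apply.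
apply: (@Ck_comp_mx _ _ _ _ _ _ A B t L) => //.
exact: IH (CkW Cit).
Qed.

End Lift.

(** * Derivatives along lines and the symmetry of second derivatives *)

Section Curves.
Context {R : realType}.

Lemma is_derive_comp1 {V W : normedModType R} (c : R -> V) (g : V -> W) (t : R)
    (dc : V) :
  is_derive t 1 c dc -> differentiable g (c t) ->
  is_derive t 1 (g \o c) ('d g (c t) dc).
Proof.
move=> [/derivable1_diffP dct <-] dg.
have dgc : differentiable (g \o c) t by exact: differentiable_comp.
split; first exact/derivable1_diffP.
by rewrite deriveE// diff_comp//= deriveE.
Qed.

Lemma derive_comp {U V W : normedModType R} (f : U -> V) (g : V -> W) x y v :
  f x = y -> differentiable f x -> differentiable g y ->
  'D_v (g \o f) x = 'D_('D_v f x) g y.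
Proof.
move=> <- df dg; rewrite [LHS]deriveE; last exact: differentiable_comp.
by rewrite diff_comp// (deriveE _ dg) (deriveE _ df).
Qed.

Lemma line_derive {V W : normedModType R} (f : V -> W) y v (a : R) :
  differentiable f (y + a *: v) ->
  is_derive a 1 (fun s : R => f (y + s *: v)) ('D_v f (y + a *: v)).
Proof.
move=> df; rewrite deriveE//.
apply: (@is_derive_comp1 _ _ (fun s : R => y + s *: v) f a v) => //.
have dl : is_diff a (fun s : R => y + s *: v) (0 + (fun s : R => s *: v)).
  exact: is_diffD.
have dd : differentiable (fun s : R => y + s *: v) a by exact: ex_diff.
split; first exact/derivable1_diffP.
by rewrite deriveE// (@diff_val _ _ _ _ _ _ _ dl) !fctE add0r scale1r.
Qed.

Lemma shift_derive {V W : normedModType R} (f : V -> W) y z v :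
  differentiable f (y + z) -> differentiable (fun x => f (x + z)) y /\
    'D_v (fun x => f (x + z)) y = 'D_v f (y + z).
Proof.
move=> df.
have dS : is_diff y (fun x => x + z) (id + 0).
  exact: is_diffD.
have dC : differentiable (fun x => f (x + z)) y.
  by apply: (@differentiable_comp _ _ _ _ (fun x => x + z) f).
split; first exact: dC.
rewrite !deriveE// (@diff_comp _ _ _ _ (fun x => x + z) f)//=.
by rewrite (@diff_val _ _ _ _ _ _ _ dS) !fctE addr0.
Qed.

Lemma MVT_line {V : normedModType R} (f : V -> R) y v (a b : R) : a < b ->
  (forall s, a <= s <= b -> differentiable f (y + s *: v)) ->
  exists2 c, a < c < b &
    f (y + b *: v) - f (y + a *: v) = 'D_v f (y + c *: v) * (b - a).
Proof.
move=> ab df.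
have dl s : a <= s <= b ->
    is_derive s 1 (fun s : R => f (y + s *: v)) ('D_v f (y + s *: v)).
  by move=> /df; exact: line_derive.
have [||c + ->] := @MVT R (fun s => f (y + s *: v))
    (fun s => 'D_v f (y + s *: v)) a b ab.
- move=> s sab; apply: dl.
  by move: sab; rewrite in_itv /= => /andP[/ltW -> /ltW ->].
- apply: derivable_within_continuous => s; rewrite in_itv /= => sab.
  by have [] := dl s sab.
- by rewrite in_itv /= => cab; exists c.
Qed.

(** Two mean value theorems: one along [v] for [g y = f (y + r *: w) - f y], then one along [w] for
    the derivative of [f] in the direction [v]. *)
Lemma second_difference {V : normedModType R} (U : set V) (f : V -> R) x v w
    (r : R) :
  Ck 2 U f -> 0 < r ->
  (forall a b : R, 0 <= a <= r -> 0 <= b <= r -> U (x + a *: v + b *: w)) ->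
  exists a b : R, [/\ 0 <= a <= r, 0 <= b <= r &
    f (x + r *: v + r *: w) - f (x + r *: v) - (f (x + r *: w) - f x) =
    'D_w ('D_v f) (x + a *: v + b *: w) * r * r].
Proof.
move=> [df cf] r0 inU; have [dvf _] := cf v.
have r1 : (0 : R) <= r <= r by rewrite (ltW r0) lexx.
have r00 : (0 : R) <= 0 <= r by rewrite (ltW r0) lexx.
have inU0 (a : R) : 0 <= a <= r -> U (x + a *: v).
  by move=> /inU-/(_ 0 r00); rewrite scale0r addr0.
pose g y := f (y + r *: w) - f y.
have dg (a : R) : 0 <= a <= r -> differentiable g (x + a *: v) /\
    'D_v g (x + a *: v) = 'D_v f (x + a *: v + r *: w) - 'D_v f (x + a *: v).
  move=> ar; have d0 := df _ (inU0 _ ar).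
  have [d1 <-] := shift_derive v (df _ (inU _ _ ar r1)).
  split; first exact: differentiableB.
  by rewrite -deriveB//; exact: diff_derivable.
have [|a /andP[/ltW a0 /ltW ar] Ea] := @MVT_line _ g x v 0 r r0.
  by move=> s /dg[].
have a0r : 0 <= a <= r by rewrite a0.
have [|b /andP[/ltW b0 /ltW br] Eb] := @MVT_line _ ('D_v f) (x + a *: v) w 0 r r0.
  by move=> s sr; apply: dvf; exact: inU.
exists a, b; split; rewrite ?a0 ?b0//.
move: Ea Eb; rewrite (dg _ a0r).2 !subr0 !scale0r !addr0 => + <-.
by rewrite /g.
Qed.

(** Serves Schwarz's theorem, where the mean value theorem produces different intermediate points
    for the two orders of differentiation. *)
Lemma continuous_eq_at {V : normedModType R} (f g : V -> R) x :
  {for x, continuous f} -> {for x, continuous g} ->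
  (forall d : R, 0 < d -> exists y z,
     [/\ ball x d y, ball x d z & f y = g z]) -> f x = g x.
Proof.
move=> cf cg H; apply/eqP; rewrite -subr_eq0 -normr_le0; apply/ler_addgt0Pl => e e0.
rewrite addr0; have e20 : 0 < e / 2 by rewrite divr_gt0.
have /cvgrPdist_le/(_ _ e20)/nbhs_ballP[d1 /= d10 H1] := cf.
have /cvgrPdist_le/(_ _ e20)/nbhs_ballP[d2 /= d20 H2] := cg.
have d0 : 0 < Num.min d1 d2 by rewrite lt_min d10.
have [y [z [By Bz fgyz]]] := H _ d0.
have {}By : ball x d1 y by apply: le_ball By; rewrite ge_min lexx.
have {}Bz : ball x d2 z by apply: le_ball Bz; rewrite ge_min lexx orbT.
have := H2 _ Bz; have := H1 _ By; rewrite /= fgyz distrC => h1 h2.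
rewrite -(subrKA (g z)) addrC; apply: le_trans (ler_normD _ _) _.
by rewrite (splitr e) lerD// distrC.
Qed.

Lemma ball_plane {V : normedModType R} (x v w : V) (d : R) : 0 < d ->
  exists2 r : R, 0 < r & forall a b : R, 0 <= a <= r -> 0 <= b <= r ->
    ball x d (x + a *: v + b *: w).
Proof.
move=> d0; pose N := `|v| + `|w| + 1.
have N0 : 0 < N by rewrite ltr_wpDl// addr_ge0.
pose r := d / (2 * N).
have r0 : 0 < r by rewrite divr_gt0// mulr_gt0.
have rN : r * N = d / 2 by rewrite /r; field; rewrite gt_eqF.
exists r => // a b /andP[a0 ar] /andP[b0 br]; rewrite -ball_normE /=.
rewrite -addrA opprD addNKr normrN.
apply: le_lt_trans (ler_normD _ _) _; rewrite !normrZ !ger0_norm//.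
have h1 : a * `|v| <= r * `|v| by rewrite ler_wpM2r.
have h2 : b * `|w| <= r * `|w| by rewrite ler_wpM2r.
have h3 : r * (`|v| + `|w|) < r * N by rewrite ltr_pM2l// ltrDl.
by clear -h1 h2 h3 rN d0; lra.
Qed.

(** Schwarz's theorem. The second difference over a small parallelogram does not depend on the order
    of [v] and [w], while it equals r^2 times either mixed derivative at some point nearby. *)
Lemma derive_sym {V : normedModType R} (U : set V) (f : V -> R) x v w :
  open U -> Ck 2 U f -> U x -> 'D_w ('D_v f) x = 'D_v ('D_w f) x.
Proof.
move=> oU Cf Ux; have [_ cf] := Cf.
have [_ cvw] := cf v; have [_ cwv] := cf w.
apply: (continuous_eq_at (cvw w x Ux) (cwv v x Ux)) => d d0.
have /nbhs_ballP[d1 /= d10 Hd1] : nbhs x U by exact: open_nbhs_nbhs.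
have d20 : 0 < Num.min d d1 by rewrite lt_min d0.
have [r1 r10 Hr1] := ball_plane x v w d20.
have [r2 r20 Hr2] := ball_plane x w v d20.
pose r := Num.min r1 r2.
have r0 : 0 < r by rewrite lt_min r10.
have rr1 (a : R) : 0 <= a <= r -> 0 <= a <= r1.
  by move=> /andP[-> /le_trans]/=; apply; rewrite ge_min lexx.
have rr2 (a : R) : 0 <= a <= r -> 0 <= a <= r2.
  by move=> /andP[-> /le_trans]/=; apply; rewrite ge_min lexx orbT.
have in1 y : ball x (Num.min d d1) y -> U y.
  by move=> yd; apply: Hd1; apply: le_ball yd; rewrite ge_min lexx orbT.
have in2 y : ball x (Num.min d d1) y -> ball x d y.
  by move=> yd; apply: le_ball yd; rewrite ge_min lexx.
have [|a [b [ar br E1]]] := @second_difference _ U f x v w r Cf r0.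
  by move=> a b /rr1 ha /rr1 hb; apply: in1; exact: Hr1.
have [|a' [b' [ar' br' E2]]] := @second_difference _ U f x w v r Cf r0.
  by move=> a' b' /rr2 ha /rr2 hb; apply: in1; exact: Hr2.
exists (x + a *: v + b *: w), (x + a' *: w + b' *: v); split.
- by apply: in2; apply: Hr1; exact: rr1.
- by apply: in2; apply: Hr2; exact: rr2.
have aux (p q A B : R) : p = q -> p = A * r * r -> q = B * r * r -> A = B.
  by move=> -> ->; do 2![move/(mulIf (negbT (gt_eqF r0)))].
apply: (aux _ _ _ _ _ E1 E2); rewrite (addrAC x).
by clear; ring.
Qed.

End Curves.

(** * Implicit functions *)

Section MonotoneSolution.
Context {R : realType} {T : topologicalType}.
Variables (G : T -> R -> R) (B : set T) (a b : R).
Hypothesis ab : a < b.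
Hypothesis oB : open B.
Hypothesis contG : forall y t, B y -> a <= t <= b -> {for y, continuous (G ^~ t)}.
Hypothesis contG2 : forall y, B y -> {within `[a, b], continuous (G y)}.
Hypothesis incrG : forall y s t, B y -> a <= s -> s < t -> t <= b -> G y s < G y t.
Hypothesis signG : forall y, B y -> G y a < 0 < G y b.

(** The root exists by the intermediate value theorem and is unique by monotonicity. It is
    continuous because the signs of [G y] slightly below and slightly above the root persist for
    nearby parameters and trap their roots. *)
Lemma monotone_solution : exists t : T -> R,
  [/\ forall y, B y -> a < t y < b /\ G y (t y) = 0,
      forall y s, B y -> a <= s <= b -> G y s = 0 -> s = t y &
      forall y, B y -> {for y, continuous t}].
Proof.
have ex y : exists s, B y -> a < s < b /\ G y s = 0.
  have [By|nBy] := pselect (B y); last by exists 0 => /nBy.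
  have /andP[Ga Gb] := signG By.
  have [|c] := @IVT R (G y) a b 0 (ltW ab) (contG2 By).
    by rewrite ge_min (ltW Ga) le_max (ltW Gb) orbT.
  rewrite in_itv /= => /andP[ac cb] Gc; exists c => _; split => //.
  rewrite !lt_neqAle ac cb !andbT; apply/andP; split; apply/eqP => E.
    by move: Ga; rewrite E Gc ltxx.
  by move: Gb; rewrite -E Gc ltxx.
have {ex}[t Ht] := choice ex.
have uniq y s : B y -> a <= s <= b -> G y s = 0 -> s = t y.
  move=> By /andP[sa sb] Gs; have [/andP[ta tb] Gt] := Ht y By.
  have [st|ts|//] := ltgtP s (t y).
    by have := incrG By sa st (ltW tb); rewrite Gs Gt ltxx.
  by have := incrG By (ltW ta) ts sb; rewrite Gs Gt ltxx.
exists t; split => // y By; apply/cvgrPdist_lt => e e0.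
have [/andP[ta tb] Gt] := Ht y By.
(* Clamped to [a, b], outside of which nothing is known of [G]. *)
pose lo := Num.max a (t y - e); pose hi := Num.min b (t y + e).
have alo : a <= lo by rewrite le_max lexx.
have hib : hi <= b by rewrite ge_min lexx.
have tlo : lo < t y by rewrite gt_max ta ltrBlDr ltrDl.
have thi : t y < hi by rewrite lt_min tb ltrDl.
have lob : lo <= b by apply: ltW; exact: lt_trans tlo tb.
have ahi : a <= hi by apply: ltW; exact: lt_trans ta thi.
have Glo : G y lo < 0 by rewrite -Gt; apply: incrG => //; exact: ltW.
have Ghi : 0 < G y hi by rewrite -Gt; apply: incrG => //; exact: ltW.
have N1 : \forall z \near y, G z lo < 0.
  exact: (@contG y lo By (introT andP (conj alo lob)) _ (lt_nbhsl Glo)).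
have N2 : \forall z \near y, 0 < G z hi.
  exact: (@contG y hi By (introT andP (conj ahi hib)) _ (lt_nbhsr Ghi)).
have N3 : \forall z \near y, B z by exact: open_nbhs_nbhs.
move: N1 N2 N3; apply: filterS3 => z G1 G2 Bz.
have [/andP[tza tzb] Gtz] := Ht z Bz.
have h1 : lo < t z.
  rewrite ltNge; apply/negP; rewrite le_eqVlt => /orP[/eqP E|E].
    by move: G1; rewrite -E Gtz ltxx.
  by have := lt_trans (incrG Bz (ltW tza) E lob) G1; rewrite Gtz ltxx.
have h2 : t z < hi.
  rewrite ltNge; apply/negP; rewrite le_eqVlt => /orP[/eqP E|E].
    by move: G2; rewrite E Gtz ltxx.
  by have := lt_trans G2 (incrG Bz ahi E (ltW tzb)); rewrite Gtz ltxx.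
move: h1 h2; rewrite gt_max lt_min => /andP[_ h1] /andP[_ h2].
by rewrite ltr_norml; lra.
Qed.

End MonotoneSolution.

Section ImplicitFunction.
Context {R : realType} {n : nat}.
Implicit Types (u y : 'rV[R]_n) (i : 'I_n).

(** The coordinates near the fold have this form: a coordinate of the base point along which [phi]
    has nonzero derivative gives way to the height. *)
Definition update u i (t : R) : 'rV[R]_n :=
  \row_j (if j == i then t else u ord0 j).

Lemma update_same u i t : update u i t ord0 i = t.
Proof. by rewrite mxE eqxx. Qed.

Lemma update_update u i s t : update (update u i s) i t = update u i t.
Proof. by apply/rowP => j; rewrite !mxE; case: eqP. Qed.

Lemma update_id u i : update u i (u ord0 i) = u.
Proof. by apply/rowP => j; rewrite !mxE; case: eqP => [->|]. Qed.

Lemma update_line u i t : update u i t = update u i 0 + t *: delta_mx ord0 i.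
Proof.
apply/rowP => j; rewrite !mxE eqxx andTb; case: eqP => _ /=.
  by rewrite add0r mulr1.
by rewrite mulr0 addr0.
Qed.

Lemma Ck_update {V : normedModType R} k (U : set V) i (f : V -> 'rV[R]_n)
    (g : V -> R) : open U -> Ck k U f -> Ck k U g ->
  Ck k U (fun x => update (f x) i (g x)).
Proof.
move=> oU cf cg; apply: Ck_mx => // a j; rewrite ord1.
have [E|E] := eqVneq j i.
  by apply: Ck_eq cg => // x _; rewrite mxE E eqxx.
apply: (@Ck_eq _ _ _ _ _ (fun x => f x ord0 j)) => //; last exact: Ck_coord.
by move=> x _; rewrite mxE (negPf E).
Qed.

Lemma ball_rV u (d : R) y : 0 < d ->
  ball u d y <-> forall j, `|u ord0 j - y ord0 j| < d.
Proof.
move=> d0; split => [[_ H] j|H]; first exact: H.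
by split => // a j; rewrite !ord1; exact: H.
Qed.

(** Coordinate [i] of [y] plays two roles: on the left it is overwritten by the unknown [s], on the
    right it is the height, squared. Hence the ball around [update x0 i 0], the coordinates of the
    fold point at height 0. Because the height appears squared, one solution serves both sheets.
    Only continuity of [t] is obtained here. *)
Lemma implicit_function (f : 'rV[R]_n -> R) (U : set 'rV[R]_n) x0 i :
  open U -> Ck 1 U f -> U x0 -> f x0 = 0 -> 'D_(delta_mx ord0 i) f x0 != 0 ->
  exists (d e : R) (t : 'rV[R]_n -> R), [/\ 0 < d, 0 < e,
    forall y s, ball (update x0 i 0) d y -> `|s - x0 ord0 i| < e ->
      U (update y i s) /\ 'D_(delta_mx ord0 i) f (update y i s) != 0,
    forall y, ball (update x0 i 0) d y ->
      [/\ `|t y - x0 ord0 i| < e, f (update y i (t y)) = y ord0 i ^+ 2 &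
          {for y, continuous t}] &
    forall y s, ball (update x0 i 0) d y -> `|s - x0 ord0 i| < e ->
      f (update y i s) = y ord0 i ^+ 2 -> s = t y].
Proof.
move=> oU [df cf] Ux0 fx0; set F : 'rV[R]_n -> R := 'D_(delta_mx ord0 i) f => Fx0.
(* Multiplying by the partial derivative at [x0] makes the equation increasing in the unknown,
   whatever the sign of that derivative. *)
pose k := F x0.
have k0 : 0 < k * F x0 by rewrite -expr2 exprn_even_gt0.
have ckF : Ck 0 U (fun u => k * F u).
  by apply: CkM => //; [exact: Ck_cst|exact: cf].
have N1 : \forall u \near x0, U u by exact: open_nbhs_nbhs.
have N2 : \forall u \near x0, 0 < k * F u by exact: (ckF _ Ux0 _ (lt_nbhsr k0)).
have [r r0 Hr] := near_ball N1 N2.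
pose e := r / 2; have e0 : 0 < e by rewrite divr_gt0.
have er : e < r by rewrite /e ltr_pdivrMr// ltr_pMr// ltr1n.
pose a := x0 ord0 i - e; pose b := x0 ord0 i + e.
have ab : a < b by rewrite /a /b; clear -e0; lra.
set y0 := update x0 i 0.
have inU y s : ball y0 r y -> a <= s <= b ->
    U (update y i s) /\ 0 < k * F (update y i s).
  move=> /(ball_rV _ _ r0) Hy /andP[as_ sb]; apply: Hr; apply/(ball_rV _ _ r0) => j.
  have := Hy j; rewrite !mxE; case: eqP => [-> _|//].
  by rewrite ltr_norml; move: as_ sb er; rewrite /a /b; clear; lra.
pose G y s := k * (f (update y i s) - y ord0 i ^+ 2).
have incrG y s t : ball y0 r y -> a <= s -> s < t -> t <= b -> G y s < G y t.
  move=> Hy as_ st tb.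
  have [|c /andP[sc ct]] := @MVT_line _ _ f (update y i 0) (delta_mx ord0 i) s t st.
    move=> c /andP[sc ct]; rewrite -update_line; apply: df.
    by have [] := inU _ c Hy; first by rewrite (le_trans as_)//= (le_trans ct).
  rewrite -!update_line -/F => E.
  have [|_ kF] := inU _ c Hy.
    by rewrite (le_trans as_ (ltW sc))/= (le_trans (ltW ct)).
  rewrite -subr_gt0 /G -mulrBr opprB addrA subrK E mulrA.
  by rewrite mulr_gt0// subr_gt0.
have contG y s : ball y0 r y -> a <= s <= b -> {for y, continuous (G ^~ s)}.
  move=> Hy sab.
  have oB : open (ball y0 r) by exact: ball_open.
  suff : Ck 0 (ball y0 r) (G ^~ s) by apply.
  apply: CkM => //; first exact: Ck_cst.
  apply: (CkD oB).
    apply: (@Ck_comp _ _ _ _ _ U (fun y => update y i s) f) => //.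
    - by move=> z Hz; exact: (inU _ _ Hz sab).1.
    - by apply: Ck_update => //; [exact: Ck_id|exact: Ck_cst].
    - by move=> z Uz; apply: differentiable_continuous; exact: df.
  apply: (CkN oB); apply: (CkM oB); apply: (Ck_coord _ _ oB); exact: Ck_id.
have contG2 y : ball y0 r y -> {within `[a, b], continuous (G y)}.
  move=> Hy; apply: derivable_within_continuous => s; rewrite in_itv /= => sab.
  apply: derivableM; first exact: derivable_cst.
  apply: derivableB; last exact: derivable_cst.
  rewrite (_ : (fun s => f _) = (fun s => f (update y i 0 + s *: delta_mx ord0 i))).
    have [|//] := @line_derive _ _ _ f (update y i 0) (delta_mx ord0 i) s.
    by rewrite -update_line; apply: df; exact: (inU _ _ Hy sab).1.
  by apply/funext => z; rewrite -update_line.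
have y0r : ball y0 r y0 by exact: ballxx.
have Gx0 : G y0 (x0 ord0 i) = 0.
  by rewrite /G update_update update_id fx0 update_same expr0n subr0 mulr0.
have x0a : a < x0 ord0 i by rewrite ltrBlDr ltrDl.
have x0b : x0 ord0 i < b by rewrite ltrDl.
have Ga : G y0 a < 0 by rewrite -Gx0; apply: incrG => //; exact: ltW.
have Gb : 0 < G y0 b by rewrite -Gx0; apply: incrG => //; exact: ltW.
have aa : a <= a <= b by rewrite lexx ltW.
have bb : a <= b <= b by rewrite lexx ltW.
have N3 : \forall y \near y0, G y a < 0 by exact: (contG _ _ y0r aa _ (lt_nbhsl Ga)).
have N4 : \forall y \near y0, 0 < G y b by exact: (contG _ _ y0r bb _ (lt_nbhsr Gb)).
have [d1 d10 Hd1] := near_ball N3 N4.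
pose d := Num.min d1 r.
have d0 : 0 < d by rewrite lt_min d10.
have dr y : ball y0 d y -> ball y0 r y by apply: le_ball; rewrite ge_min lexx orbT.
have [|||||t [Ht1 Ht2 Ht3]] := @monotone_solution _ _ G (ball y0 d) a b ab.
- exact: ball_open.
- by move=> y s /dr; exact: contG.
- by move=> y /dr; exact: contG2.
- by move=> y s u /dr; exact: incrG.
- move=> y Hy; have /Hd1[Gy1 Gy2] : ball y0 d1 y.
    by apply: le_ball Hy; rewrite ge_min lexx.
  by rewrite Gy1.
have itvE s : `|s - x0 ord0 i| < e = (a < s < b).
  by rewrite ltr_norml ltrBrDr ltrBlDr /a /b (addrC (- e)) (addrC e).
have G0 y s : G y s = 0 <-> f (update y i s) = y ord0 i ^+ 2.
  split; last by rewrite /G => ->; rewrite subrr mulr0.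
  by move=> /eqP; rewrite mulf_eq0 (negPf Fx0) subr_eq0 => /eqP.
exists d, e, t; split => //.
- move=> y s /dr Hy; rewrite itvE => /andP[/ltW as_ /ltW sb].
  have [|Us kF] := inU _ s Hy; first by rewrite as_.
  split => //; change (F (update y i s) != 0).
  by apply: contraTneq kF => ->; rewrite mulr0 ltxx.
- move=> y Hy; have [tab Gt] := Ht1 y Hy; split; last exact: Ht3.
    by rewrite itvE.
  exact/G0.
- move=> y s Hy; rewrite itvE => /andP[/ltW as_ /ltW sb] /G0.
  by apply: Ht2 => //; rewrite as_.
Qed.

End ImplicitFunction.

(** * Charts and their changes *)

Section Charts.
Context {R : realType} {n : nat} {T : topologicalType}.
Implicit Types (c d : chart R n T) (A : set T).

Lemma chartK c x : dom c x -> bwd c (fwd c x) = x.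
Proof. by move=> cx; apply: fwdK; rewrite inE. Qed.

Lemma img_fwd c x : dom c x -> img c (fwd c x).
Proof. by move=> cx; exists x. Qed.

Lemma dom_bwd c u : img c u -> dom c (bwd c u).
Proof. by move=> [x cx <-]; rewrite chartK. Qed.

Lemma chart_bwdK c u : img c u -> fwd c (bwd c u) = u.
Proof. by move=> [x cx <-]; rewrite chartK. Qed.

Lemma fwd_imageP c A u : A `<=` dom c ->
  (fwd c @` A) u <-> img c u /\ A (bwd c u).
Proof.
move=> Ac; split => [[x Ax <-]|[cu Au]].
  by rewrite chartK; [split => //; apply: img_fwd|]; exact: Ac.
by exists (bwd c u); rewrite ?chart_bwdK.
Qed.

Lemma chart_img_open c : open (img c).
Proof. exact: img_open. Qed.

Lemma open_preimage {X Y : topologicalType} (f : X -> Y) (B : set X) (A : set Y) :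
  open B -> (forall x, B x -> {for x, continuous f}) -> open A ->
  open (B `&` f @^-1` A).
Proof.
move=> oB cf oA; rewrite openE => x [Bx Afx].
apply: filterI; first exact: open_nbhs_nbhs.
by apply: (cf x Bx); exact: open_nbhs_nbhs.
Qed.

Lemma open_fwd c A : open A -> A `<=` dom c -> open (fwd c @` A).
Proof.
move=> oA Ac.
have -> : fwd c @` A = img c `&` bwd c @^-1` A.
  by apply/seteqP; split => u; rewrite fwd_imageP.
apply: open_preimage => //; first exact: chart_img_open.
exact: bwd_continuous.
Qed.

End Charts.

(* Keeps unification from unfolding distinct derivatives down to limits. *)
#[local] Opaque diff derive jacobian.

Section ChangeOfCharts.
Context {R : realType} {n : nat}.
Implicit Types M N : manifold R n.

Definition trans {M} (c d : chart R n M) (x : M) : 'M[R]_n :=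
  jacobian (fwd d \o bwd c) (fwd c x).

Lemma open_overlap {M} (c d : chart R n M) : open (fwd c @` (dom c `&` dom d)).
Proof. by apply: open_fwd; [apply: openI; exact: dom_open|move=> x []]. Qed.

Lemma trans_differentiable {M} (c d : chart R n M) x : atlas c -> atlas d ->
  dom c x -> dom d x -> differentiable (fwd d \o bwd c) (fwd c x).
Proof.
move=> ac ad cx dx; have [+ _] := atlas_compat ac ad 1%N.
by apply; exists x.
Qed.

Lemma near_fwd {M} (c : chart R n M) x (P : M -> Prop) : dom c x ->
  (\forall y \near x, P y) ->
  \forall u \near fwd c x, img c u /\ P (bwd c u).
Proof.
move=> cx Px; apply: filterI.
  by apply: open_nbhs_nbhs; split; [exact: chart_img_open|exact: img_fwd].
have /(_ _ (img_fwd cx)) := @bwd_continuous _ _ _ c; apply.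
by rewrite chartK.
Qed.

Lemma dom_near {M} (c : chart R n M) x : dom c x -> \forall y \near x, dom c y.
Proof. by move=> cx; apply: open_nbhs_nbhs; split => //; exact: dom_open. Qed.

Lemma trans_comp {M} (c d e : chart R n M) x : atlas c -> atlas d -> atlas e ->
  dom c x -> dom d x -> dom e x -> trans c e x = trans c d x *m trans d e x.
Proof.
move=> ac ad ae cx dx ex.
have Dcd := trans_differentiable ac ad cx dx.
have Dde := trans_differentiable ad ae dx ex.
have E : (fwd d \o bwd c) (fwd c x) = fwd d x by rewrite /= chartK.
rewrite /trans -(jacobian_comp E Dcd Dde).
apply: jacobian_near_eq; first exact: trans_differentiable.
apply: filterS (near_fwd cx (dom_near dx)) => u [_ du] /=.
by rewrite chartK.
Qed.

Lemma trans_id {M} (c : chart R n M) x : dom c x -> trans c c x = 1%:M.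
Proof.
move=> cx; rewrite -(jacobian_id (fwd c x)); apply/esym.
apply: jacobian_near_eq; first exact: ex_diff.
have : \forall y \near x, True by exact: filterT.
by move=> /(near_fwd cx); apply: filterS => u [/chart_bwdK cu _] /=.
Qed.

Lemma transK {M} (c d : chart R n M) x : atlas c -> atlas d ->
  dom c x -> dom d x -> trans c d x *m trans d c x = 1%:M.
Proof. by move=> ac ad cx dx; rewrite -trans_comp// trans_id. Qed.

Lemma trans_unit {M} (c d : chart R n M) x : atlas c -> atlas d ->
  dom c x -> dom d x -> trans c d x \in unitmx.
Proof.
by move=> ac ad cx dx; exact: (mulmx1_unit (transK ac ad cx dx)).1.
Qed.

(** [tangent_map] is the case of the preferred charts at [x] and [f x]. *)
Definition rep {M N} (c : chart R n M) (d : chart R n N) (f : M -> N) (x : M) :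
  'M[R]_n := jacobian (fwd d \o f \o bwd c) (fwd c x).

(** Continuity of [f] is asked separately: it keeps [f y] in the domain of [d] for [y] near [x],
    where the two chart expressions then differ by changes of charts. *)
Lemma rep_change {M N} (c c' : chart R n M) (d d' : chart R n N) (f : M -> N) x :
  atlas c -> atlas c' -> atlas d -> atlas d' ->
  dom c x -> dom c' x -> dom d (f x) -> dom d' (f x) ->
  {for x, continuous f} -> differentiable (fwd d \o f \o bwd c) (fwd c x) ->
  differentiable (fwd d' \o f \o bwd c') (fwd c' x) /\
  rep c' d' f x = trans c' c x *m rep c d f x *m trans d d' (f x).
Proof.
move=> ac ac' ad ad' cx cx' dx dx' cf df.
have D1 := trans_differentiable ac' ac cx' cx.
have D3 := trans_differentiable ad ad' dx dx'.
have E1 : (fwd c \o bwd c') (fwd c' x) = fwd c x by rewrite /= chartK.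
have E2 : (fwd d \o f \o bwd c) (fwd c x) = fwd d (f x) by rewrite /= chartK.
have D12 : differentiable ((fwd d \o f \o bwd c) \o (fwd c \o bwd c')) (fwd c' x).
  by apply: differentiable_comp; [exact: D1|rewrite E1; exact: df].
have E3 : ((fwd d \o f \o bwd c) \o (fwd c \o bwd c')) (fwd c' x) = fwd d (f x).
  by rewrite [LHS]/comp E1.
have D : differentiable ((fwd d' \o bwd d) \o
    ((fwd d \o f \o bwd c) \o (fwd c \o bwd c'))) (fwd c' x).
  by apply: differentiable_comp; [exact: D12|rewrite E3; exact: D3].
have near_eq : \forall u \near fwd c' x, ((fwd d' \o bwd d) \o
    ((fwd d \o f \o bwd c) \o (fwd c \o bwd c'))) u = (fwd d' \o f \o bwd c') u.
  have N1 : \forall y \near x, dom c y /\ dom d (f y).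
    by apply: filterI; [exact: dom_near|apply: cf; exact: dom_near].
  apply: filterS (near_fwd cx' N1) => u [_ [cu du]] /=.
  by rewrite (chartK cu) (chartK du).
split; first exact: near_eq_differentiable near_eq D.
rewrite {1}/rep -(jacobian_near_eq D near_eq).
by rewrite (jacobian_comp E3 D12 D3) (jacobian_comp E1 D1 df).
Qed.

Definition dcol {M} (c : chart R n M) (s : M -> R) (x : M) : 'cV[R]_n :=
  grad (s \o bwd c) (fwd c x).

Lemma grad_near_eq (f g : 'rV[R]_n -> R) u :
  (\forall x \near u, f x = g x) -> grad f u = grad g u.
Proof.
by move=> fg; apply/colP => i; rewrite mxE [RHS]mxE; exact: near_eq_derive.
Qed.

Lemma dcol_change {M} (c c' : chart R n M) (s : M -> R) x :
  atlas c -> atlas c' -> dom c x -> dom c' x ->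
  differentiable (s \o bwd c) (fwd c x) ->
  differentiable (s \o bwd c') (fwd c' x) /\
  dcol c' s x = trans c' c x *m dcol c s x.
Proof.
move=> ac ac' cx cx' ds.
have D1 := trans_differentiable ac' ac cx' cx.
have E1 : (fwd c \o bwd c') (fwd c' x) = fwd c x by rewrite /= chartK.
have D : differentiable ((s \o bwd c) \o (fwd c \o bwd c')) (fwd c' x).
  by apply: differentiable_comp; [exact: D1|rewrite E1; exact: ds].
have near_eq : \forall u \near fwd c' x,
    ((s \o bwd c) \o (fwd c \o bwd c')) u = (s \o bwd c') u.
  apply: filterS (near_fwd cx' (dom_near cx)) => u [_ cu] /=.
  by rewrite (chartK cu).
split; first exact: near_eq_differentiable near_eq D.
by rewrite {1}/dcol -(grad_near_eq near_eq) (grad_comp E1 D1 ds).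
Qed.

End ChangeOfCharts.

Lemma near_eq_continuous {T X : topologicalType} (B : set T) (f g : T -> X) x :
  open B -> B x -> (forall y, B y -> f y = g y) ->
  {for x, continuous f} -> {for x, continuous g}.
Proof.
move=> oB Bx fg cf; rewrite /prop_for /continuous_at -(fg x Bx).
apply: cvg_trans cf; apply: near_eq_cvg.
have NB : \forall y \near x, B y by exact: open_nbhs_nbhs.
by apply: filterS NB.
Qed.

(** * The double as a topological space *)

Section DoubleTopology.
Context {R : realType} {M : topologicalType}.
Variable phi : M -> R.

Definition double_set : set (M * R)%type := [set z | z.2 ^+ 2 = phi z.1].

Definition double : topologicalType := set_type double_set.

Definition base (y : double) : M := (val y).1.
Definition height (y : double) : R := (val y).2.

Lemma height_sqr y : height y ^+ 2 = phi (base y).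
Proof. exact: (set_valP y). Qed.

Definition double_pt (x : M) (s : R) (xs : s ^+ 2 = phi x) : double :=
  exist _ (x, s) (mem_set (xs : double_set (x, s))).

Lemma double_inj (y z : double) : base y = base z -> height y = height z -> y = z.
Proof.
move=> bE hE; apply: val_inj; move: bE hE; rewrite /base /height.
by case: (val y) (val z) => [a b] [a' b'] /= -> ->.
Qed.

Lemma val_double_continuous : continuous (val : double -> (M * R)%type).
Proof. exact: initial_continuous. Qed.

Lemma base_continuous : continuous base.
Proof.
by move=> y; apply: (continuous_comp (@val_double_continuous y)); exact: cvg_fst.
Qed.

Lemma height_continuous : continuous height.
Proof.
by move=> y; apply: (continuous_comp (@val_double_continuous y)); exact: cvg_snd.
Qed.

Lemma into_double_continuous {T : topologicalType} (f : T -> double) t :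
  {for t, continuous (base \o f)} -> {for t, continuous (height \o f)} ->
  {for t, continuous f}.
Proof.
move=> cb ch U [_ /= [[W oW <-] /= Wft /filterS]]; apply.
have : nbhs (base (f t), height (f t)) W.
  by apply: open_nbhs_nbhs; split => //; rewrite /base /height -surjective_pairing.
move=> [[P Q] /= [nP nQ] PQW].
have nPt : \forall s \near t, P (base (f s)) := cb _ nP.
have nQt : \forall s \near t, Q (height (f s)) := ch _ nQ.
move: nPt nQt; apply: filterS2 => s Ps Qs.
suff : W (base (f s), height (f s)) by rewrite /base /height -surjective_pairing.
exact: PQW.
Qed.

Lemma double_hausdorff : hausdorff_space M -> hausdorff_space double.
Proof.
move=> hM y z yz; apply: double_inj.
  apply: hM => A B /base_continuous nA /base_continuous nB.
  by have [w [Aw Bw]] := yz _ _ nA nB; exists (base w).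
apply: (@Rhausdorff R) => A B /height_continuous nA /height_continuous nB.
by have [w [Aw Bw]] := yz _ _ nA nB; exists (height w).
Qed.

Lemma double_second_countable :
  @second_countable M -> @second_countable double.
Proof.
move=> [B cB [oB bB]].
(* Candidate basis: a basic open set of [M] for the base point and a rational interval for the
   height. *)
pose F (b : set M * (rat * rat)) : set double :=
  base @^-1` b.1 `&` height @^-1` `]ratr b.2.1, ratr b.2.2[%classic.
exists (F @` (B `*` setT)).
  apply: card_le_trans (card_image_le _ _) _.
  by apply: countableX => //; exact: countableP.
split.
  move=> _ [[b [p q]] [/oB ob _] <-]; apply: openI.
    by move/continuousP: base_continuous; apply.
  by move/continuousP: height_continuous; apply; exact: interval_open.
move=> y U [_ /= [[W oW <-] /= Wy WU]].
have : nbhs (base y, height y) W.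
  by apply: open_nbhs_nbhs; split => //; rewrite /base /height -surjective_pairing.
move=> [[P Q] /= [nP nQ] PQW].
have [b [Bb by_] bP] := bB _ _ nP.
have [e /= e0 eQ] := (nbhs_ballP _ _).1 nQ.
have [p] := @rat_in_itvoo R (height y - e) (height y) (ltac:(by rewrite ltrBlDr ltrDl)).
have [q] := @rat_in_itvoo R (height y) (height y + e) (ltac:(by rewrite ltrDl)).
rewrite !in_itv /= => /andP[q1 q2] /andP[p1 p2].
exists (F (b, (p, q))); first split.
- by exists (b, (p, q)).
- by split => //=; rewrite in_itv /= p2.
move=> z [bz]; rewrite /= in_itv /= => /andP[z1 z2]; apply: WU => /=.
suff : W (base z, height z) by rewrite /base /height -surjective_pairing.
apply: PQW; split => /=; first exact: bP.
apply: eQ; rewrite /ball /= ltr_norml.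
by move: p1 q2 z1 z2; rewrite /height; lra.
Qed.

End DoubleTopology.

Arguments base {R M phi}.
Arguments height {R M phi}.

(** * Charts of the double *)

Section Adapted.
Context {R : realType} {n : nat} {M : manifold R n}.
Variable phi : M -> R.
Let D := double phi.
Implicit Types (c : chart R n M) (d : chart R n D).

(* The charts in which the inclusion of [double phi] into M x R, expressed in any
   chart of M, is an immersion. *)
Definition adapted d : Prop := forall c, atlas c ->
  let Q := fwd d @` (dom d `&` base @^-1` dom c) in
  [/\ smooth_on Q (fwd c \o base \o bwd d),
      smooth_on Q (height \o bwd d) &
      forall u (v : 'rV[R]_n), Q u -> v *m jacobian (fwd c \o base \o bwd d) u = 0 ->
        v *m grad (height \o bwd d) u = 0 -> v = 0].

Lemma open_adapted d c : open (fwd d @` (dom d `&` base @^-1` dom c)).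
Proof.
apply: open_fwd; last by move=> x [].
apply: openI; first exact: dom_open.
by move/continuousP: (@base_continuous R M phi); apply; exact: dom_open.
Qed.

(** Splits the kernel of the joint Jacobian into the two conditions in which [adapted] is
    phrased. *)
Lemma row_mx_immersion m (P : 'rV[R]_n -> 'rV[R]_m) (s : 'rV[R]_n -> R) u
    (v : 'rV[R]_n) :
  differentiable (fun u => row_mx (P u) (s u)%:M : 'rV[R]_(m + 1)) u ->
  differentiable P u -> differentiable s u ->
  v *m jacobian (fun u => row_mx (P u) (s u)%:M : 'rV[R]_(m + 1)) u = 0 ->
  v *m jacobian P u = 0 /\ v *m grad s u = 0.
Proof.
move=> dPs dP ds; rewrite -!deriveEjacobian// derive_mx; last exact: diff_derivable.
move=> /matrixP E; split.
  rewrite derive_mx; last exact: diff_derivable.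
  apply/rowP => j; have := E ord0 (lshift 1 j); rewrite !mxE.
  have -> : (fun t => row_mx (P t) (s t)%:M ord0 (lshift 1 j)) =
      (fun t => P t ord0 j) by apply/funext => w; rewrite row_mxEl.
  exact.
apply/rowP => j; rewrite ord1 -grad_derive//.
have := E ord0 (rshift m ord0); rewrite !mxE.
have -> : (fun t => row_mx (P t) (s t)%:M ord0 (rshift m ord0)) = s.
  by apply/funext => w; rewrite row_mxEr mxE eqxx mulr1n.
exact.
Qed.

(** In an adapted chart the pair of base point and height is an immersion, so [Ck_lift] reduces the
    smoothness of a continuous map into the double to that of these two components, each tested near
    a point with a single chart of [M]. *)
Lemma adapted_smooth {V : normedModType R} (A : set V) (t : V -> D) d :
  open A -> adapted d -> (forall x, A x -> dom d (t x)) ->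
  (forall x, A x -> {for x, continuous t}) ->
  (forall x, A x -> exists c A', [/\ atlas c, open_nbhs x A',
     forall y, A' y -> dom c (base (t y)),
     smooth_on A' (fwd c \o base \o t) &
     smooth_on A' (height \o t)]) ->
  smooth_on A (fwd d \o t).
Proof.
move=> oA ad Ad ct H k; apply: Ck_local => x Ax.
have [c [A' [ac [oA' A'x] A'c sP sh]]] := H x Ax.
exists (A `&` A') => //.
set Q := fwd d @` (dom d `&` base @^-1` dom c).
have oQ : open Q by exact: open_adapted.
have [sPd shd inj] := ad c ac.
pose i u : 'rV[R]_(n + 1) := row_mx ((fwd c \o base \o bwd d) u)
  ((height \o bwd d) u)%:M.
have si : smooth_on Q i.
  move=> j; apply: (Ck_row_mx oQ); first exact: sPd.
  by apply: (Ck_scalar_mx oQ); exact: shd.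
have oAA : open (A `&` A') by exact: openI.
apply: (@Ck_lift _ _ k _ _ (A `&` A') Q i (fwd d \o t) oAA oQ _ _ si).
- by move=> y [Ay A'y]; exists (t y) => //; split; [exact: Ad|exact: A'c].
- move=> y [Ay A'y]; apply: (continuous_comp (ct y Ay)).
  by apply: fwd_continuous; exact: Ad.
- move=> u Qu v vi.
  have [//|||v1 v2] := @row_mx_immersion n (fwd c \o base \o bwd d)
    (height \o bwd d) u v _ _ _ vi.
  + exact: Ck_differentiable (si 1%N) Qu.
  + exact: Ck_differentiable (sPd 1%N) Qu.
  + exact: Ck_differentiable (shd 1%N) Qu.
  + exact: inj v1 v2.
apply: (@Ck_eq _ _ _ _ _ (fun y =>
    row_mx ((fwd c \o base \o t) y) ((height \o t) y)%:M)) => //.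
  by move=> y [Ay A'y]; rewrite /i /= chartK//; exact: Ad.
apply: (Ck_row_mx oAA); first by apply: Ck_sub (sP k) => y [].
by apply: (Ck_scalar_mx oAA); apply: Ck_sub (sh k) => y [].
Qed.

(** The base point and the height of [bwd d] are smooth because [d] is adapted; [adapted_smooth]
    then makes [bwd d] smooth as seen from [d']. *)
Lemma adapted_compat d d' : adapted d -> adapted d' ->
  smooth_on (fwd d @` (dom d `&` dom d')) (fwd d' \o bwd d).
Proof.
move=> ad ad'; apply: adapted_smooth => //.
- by apply: open_fwd; [apply: openI; exact: dom_open|move=> x []].
- by move=> _ [x [dx dx'] <-]; rewrite chartK.
- by move=> _ [x [dx dx'] <-]; apply: bwd_continuous; exact: img_fwd.
move=> _ [x [dx dx'] <-]; exists (chart_at (base x)).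
have ac := atlas_chart_at (base x).
have [sP sh _] := ad _ ac.
exists (fwd d @` (dom d `&` base @^-1` dom (chart_at (base x)))).
split; [exact: ac| | |exact: sP|exact: sh].
  by split; [exact: open_adapted|exists x => //; split => //; exact: dom_chart_at].
by move=> _ [z [dz cz] <-]; rewrite chartK.
Qed.

End Adapted.

Section SmoothFunctions.
Context {R : realType} {n : nat} {M : manifold R n}.

Lemma continuous_chart {X : topologicalType} (f : M -> X) (c : chart R n M) x :
  dom c x -> {for fwd c x, continuous (f \o bwd c)} -> {for x, continuous f}.
Proof.
move=> cx cf.
have E : \forall y \near x, (f \o bwd c \o fwd c) y = f y.
  by apply: filterS (dom_near cx) => y cy /=; rewrite chartK.
have cfc : {for x, continuous (f \o bwd c \o fwd c)}.
  by apply: (continuous_comp (fwd_continuous cx)); exact: cf.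
rewrite /prop_for /continuous_at -{2}(chartK cx).
by apply: cvg_trans cfc; exact: near_eq_cvg.
Qed.

Lemma smooth_fun_continuous (f : M -> R) : smooth_fun f -> continuous f.
Proof.
move=> sf x; apply: (@continuous_chart _ f (chart_at x)); first exact: dom_chart_at.
by apply: (sf _ (atlas_chart_at x) 0%N); apply: img_fwd; exact: dom_chart_at.
Qed.

End SmoothFunctions.

(** * Charts on the two sheets *)

Section Sheets.
Context {R : realType} {n : nat} {M : manifold R n}.
Variable phi : M -> R.
Hypothesis phi_smooth : smooth_fun phi.
Let D := double phi.
Implicit Types (y : D) (x : M) (c : chart R n M).

(* [y0] is a junk value for points outside the projection of the double. *)
Definition sheet (y0 : D) (b : bool) (x : M) : D :=
  match pselect (((-1) ^+ b * Num.sqrt (phi x)) ^+ 2 = phi x) with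
  | left E => double_pt E
  | right _ => y0
  end.

Lemma sheetE y0 b x : 0 <= phi x ->
  base (sheet y0 b x) = x /\ height (sheet y0 b x) = (-1) ^+ b * Num.sqrt (phi x).
Proof.
move=> x0; rewrite /sheet; case: pselect => // -[].
by rewrite exprMn sqrr_sign mul1r sqr_sqrtr.
Qed.

Lemma sheet_base y0 (b : bool) y : 0 <= (-1) ^+ b * height y ->
  sheet y0 b (base y) = y.
Proof.
move=> hy; have p0 : 0 <= phi (base y) by rewrite -height_sqr sqr_ge0.
have [E1 E2] := sheetE y0 b p0; apply: double_inj => //.
rewrite E2 -height_sqr sqrtr_sqr; case: b hy {E1 E2} => /=.
  by rewrite expr1 !mulN1r oppr_ge0 => /ler0_norm ->; rewrite opprK.
by rewrite expr0 !mul1r => /ger0_norm.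
Qed.

Lemma sheet_continuous y0 b x : 0 < phi x -> {for x, continuous (sheet y0 b)}.
Proof.
move=> x0; have cphi := smooth_fun_continuous phi_smooth.
have N : \forall z \near x, 0 < phi z by exact: (cphi x _ (lt_nbhsr x0)).
have [E1 E2] := sheetE y0 b (ltW x0).
apply: into_double_continuous; rewrite /prop_for /continuous_at /= ?E1 ?E2.
  have : (id z @[z --> x]) --> x by exact: cvg_id.
  apply: cvg_trans; apply: near_eq_cvg; apply: filterS N => z z0 /=.
  by have [-> _] := sheetE y0 b (ltW z0).
have : ((-1) ^+ b * Num.sqrt (phi z) @[z --> x]) --> (-1) ^+ b * Num.sqrt (phi x).
  apply: cvgM; first exact: cvg_cst.
  by apply: (continuous_comp (cphi x)); exact: sqrt_continuous.
apply: cvg_trans; apply: near_eq_cvg; apply: filterS N => z z0 /=.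
by have [_ ->] := sheetE y0 b (ltW z0).
Qed.

Section SheetChart.
Variables (c : chart R n M) (y0 : D) (b : bool).
Hypothesis ac : atlas c.

Let V : set D :=
  base @^-1` dom c `&` (fun y => (-1) ^+ b * height y) @^-1` [set t | 0 < t].

Let W : set 'rV[R]_n := img c `&` (phi \o bwd c) @^-1` [set t | 0 < t].

Lemma sheet_phi_pos y : V y -> 0 < phi (base y).
Proof.
move=> [_ /= h0]; rewrite -height_sqr exprn_even_gt0//=.
by apply: contraTneq h0 => ->; rewrite mulr0 ltxx.
Qed.

Lemma sheet_dom_open : open V.
Proof.
apply: openI.
  by move/continuousP: (@base_continuous R M phi); apply; exact: dom_open.
have ch : continuous (fun y : D => (-1) ^+ b * height y).
  move=> y; apply: (@continuousM R D (fun=> (-1) ^+ b) height y).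
    exact: cst_continuous.
  exact: height_continuous.
by move/continuousP: ch; apply; exact: open_gt.
Qed.

Lemma sheet_img_open : open W.
Proof.
apply: open_preimage; [exact: chart_img_open| |exact: open_gt].
by move=> u cu; exact: (phi_smooth ac 0%N).
Qed.

Lemma sheet_imgE : (fwd c \o base) @` V = W.
Proof.
apply/seteqP; split => [_ [y Vy <-]|u [cu u0]].
  have [cy _] := Vy; split; first exact: img_fwd.
  by rewrite /= chartK//; exact: sheet_phi_pos.
have [E1 E2] := sheetE y0 b (ltW u0).
exists (sheet y0 b (bwd c u)); last by rewrite /= E1 chart_bwdK.
split; first by rewrite /= E1; exact: dom_bwd.
by rewrite /= E2 mulrA -expr2 sqrr_sign mul1r sqrtr_gt0.
Qed.

Lemma sheet_chartK : {in V, cancel (fwd c \o base) (sheet y0 b \o bwd c)}.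
Proof.
move=> y; rewrite inE => -[cy h0] /=.
by rewrite chartK// sheet_base//; exact: ltW.
Qed.

Definition sheet_chart : chart R n D.
Proof.
refine (@Chart R n D V (fwd c \o base) (sheet y0 b \o bwd c)
  sheet_dom_open _ sheet_chartK _ _).
- by rewrite sheet_imgE; exact: sheet_img_open.
- move=> y [cy _]; apply: (continuous_comp (@base_continuous R M phi y)).
  exact: fwd_continuous.
- rewrite sheet_imgE => u [cu u0]; apply: (continuous_comp (bwd_continuous cu)).
  exact: sheet_continuous.
Defined.

(** On a sheet the base point, read in another chart of [M], is a change of charts of [M]: it is
    immersive by itself, without the help of the height. The height is a signed square root of
    [phi], smooth where [phi] is positive. *)
Lemma sheet_chart_adapted : adapted sheet_chart.
Proof.
move=> c' ac' Q.
have oQ : open Q by exact: open_adapted.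
have QW u : Q u -> W u.
  by move=> [y [Vy _] <-]; rewrite -sheet_imgE; exists y.
have Qc u : Q u -> (fwd c @` (dom c `&` dom c')) u.
  by move=> [y [[cy _] c'y] <-]; exists (base y).
have EP u : Q u -> (fwd c' \o bwd c) u = (fwd c' \o base \o bwd sheet_chart) u.
  by move=> /QW[_ u0] /=; rewrite (sheetE y0 b (ltW u0)).1.
have Es u : Q u -> (-1) ^+ b * Num.sqrt (phi (bwd c u)) =
    (height \o bwd sheet_chart) u.
  by move=> /QW[_ u0] /=; rewrite (sheetE y0 b (ltW u0)).2.
have df u : Q u -> differentiable (fwd c' \o bwd c) u.
  by move=> /Qc; exact: Ck_differentiable (atlas_compat ac ac' 1%N).
split.
- move=> k; apply: (Ck_eq oQ EP).
  exact: Ck_sub Qc (atlas_compat ac ac' k).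
- move=> k; apply: (Ck_eq oQ Es); apply: (CkM oQ); first exact: Ck_cst.
  apply: (@Ck_root _ _ _ _ (phi \o bwd c)) => //.
  + by move=> u /QW[_ u0]; rewrite gt_eqF// sqrtr_gt0.
  + move=> u /QW[cu u0].
    apply: (@differentiable_comp _ _ _ _ (phi \o bwd c) Num.sqrt).
      exact: Ck_differentiable (phi_smooth ac 1%N) cu.
    apply/derivable1_diffP; exact: (@ex_derive _ _ _ _ _ _ _ (is_derive1_sqrt u0)).
  + by move=> u /QW[_ u0]; rewrite -expr2 sqr_sqrtr// ltW.
  + by apply: Ck_sub (phi_smooth ac k) => u /QW[].
move=> u v Qu.
rewrite -(jacobian_near_eq (df u Qu) (near_open oQ Qu EP)) => vJ _.
have [x [cx c'x] xu] := Qc u Qu.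
have := trans_unit ac ac' cx c'x; rewrite /trans xu => Ju.
by apply: (can_inj (mulmxK Ju)); rewrite vJ mul0mx.
Qed.

End SheetChart.

End Sheets.

(** * Charts around the fold *)

Section Updates.
Context {R : realType} {n : nat}.

Lemma continuous_mx {T : topologicalType} m p (f : T -> 'M[R]_(m, p)) x :
  (forall i j, {for x, continuous (fun y => f y i j)}) -> {for x, continuous f}.
Proof.
move=> cf U [P /= nP PU].
have N i j : \forall y \near x, P i j (f y i j) by exact: cf (nP i j).
have N2 : \forall y \near x, forall i j, P i j (f y i j).
  by apply: filter_forall => i; apply: filter_forall => j; exact: N.
by apply: filterS N2 => y Py; exact: PU.
Qed.

Lemma update_continuous {T : topologicalType} (f : T -> 'rV[R]_n) (g : T -> R) i x :
  {for x, continuous f} -> {for x, continuous g} ->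
  {for x, continuous (fun y => update (f y) i (g y))}.
Proof.
move=> cf cg; apply: continuous_mx => a j; rewrite ord1.
have -> : (fun y => update (f y) i (g y) ord0 j) =
    if j == i then g else (fun y => f y ord0 j).
  by apply/funext => z; rewrite mxE; case: eqP.
case: eqP => _ //.
apply: (@continuous_comp _ _ _ f (fun u : 'rV[R]_n => u ord0 j)) => //.
exact: coord_continuous.
Qed.

Lemma derive_coord {V : normedModType R} m p (f : V -> 'M[R]_(m, p)) x v i j :
  differentiable f x -> 'D_v (fun y => f y i j) x = ('D_v f x) i j.
Proof. by move=> df; rewrite derive_mx ?mxE//; exact: diff_derivable. Qed.

Lemma derive_update {V : normedModType R} (i : 'I_n) (f : V -> 'rV[R]_n)
    (g : V -> R) x v : differentiable f x -> differentiable g x ->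
  'D_v (fun y => update (f y) i (g y)) x = update ('D_v f x) i ('D_v g x).
Proof.
move=> df dg.
have /derivable_mxP dfv : derivable f x v by exact: diff_derivable.
have E j : (fun y => update (f y) i (g y) ord0 j) =
    if j == i then g else (fun y => f y ord0 j).
  by apply/funext => y; rewrite mxE; case: eqP.
rewrite derive_mx; last first.
  apply/derivable_mxP => a j; rewrite ord1 E; case: eqP => _.
    exact: diff_derivable.
  exact: dfv.
apply/rowP => j; rewrite [LHS]mxE [RHS]mxE E; case: eqP => // _.
exact: derive_coord.
Qed.

Lemma update_eq0 (v : 'rV[R]_n) i s : update v i s = 0 -> v ord0 i = 0 -> v = 0.
Proof.
move=> /rowP E vi; apply/rowP => j; have := E j; rewrite !mxE.
by case: eqP => [->|].
Qed.

End Updates.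

Section Fold.
Context {R : realType} {n : nat} {M : manifold R n}.
Variable phi : M -> R.
Hypothesis phi_smooth : smooth_fun phi.
Let D := double phi.
Variables (c : chart R n M) (p : D) (i : 'I_n).
Hypothesis ac : atlas c.
Let f : 'rV[R]_n -> R := phi \o bwd c.
Let x0 := fwd c (base p).
Variables (d e : R) (t : 'rV[R]_n -> R).
Let B : set 'rV[R]_n := ball (update x0 i 0) d.
Hypothesis e0 : 0 < e.
Hypothesis in_img : forall y s, B y -> `|s - x0 ord0 i| < e ->
  img c (update y i s) /\ 'D_(delta_mx ord0 i) f (update y i s) != 0.
Hypothesis t_sol : forall y, B y ->
  [/\ `|t y - x0 ord0 i| < e, f (update y i (t y)) = y ord0 i ^+ 2 &
      {for y, continuous t}].
Hypothesis t_uniq : forall y s, B y -> `|s - x0 ord0 i| < e ->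
  f (update y i s) = y ord0 i ^+ 2 -> s = t y.

(** From the coordinates [u] near the fold back to the coordinates of the base point: the height
    stored in entry [i] is replaced by the coordinate that [t] recovers. *)
Let tau (u : 'rV[R]_n) := update u i (t u).

Let ffwd (y : D) : 'rV[R]_n := update (fwd c (base y)) i (height y).

(** The bound on coordinate [i] of the base point singles out the root given by [t]. The condition
    on [dom c] is repeated so that each half is visibly an open preimage. *)
Let fdom : set D := (base @^-1` dom c `&` ffwd @^-1` B) `&`
  (base @^-1` dom c `&`
   (fun y => fwd c (base y) ord0 i) @^-1` [set s | `|s - x0 ord0 i| < e]).

(** [p] is a junk value: the equation holds at every point of [B]. *)
Let fbwd (u : 'rV[R]_n) : D :=
  match pselect (u ord0 i ^+ 2 = phi (bwd c (tau u))) with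
  | left E => double_pt E
  | right _ => p
  end.

Let openB : open B. Proof. exact: ball_open. Qed.

Lemma fold_bwdE u : B u ->
  base (fbwd u) = bwd c (tau u) /\ height (fbwd u) = u ord0 i.
Proof.
by move=> /t_sol[_ E _]; rewrite /fbwd; case: pselect => // -[]; rewrite -E.
Qed.

Lemma fold_tau_img u : B u ->
  img c (tau u) /\ 'D_(delta_mx ord0 i) f (tau u) != 0.
Proof. by move=> Bu; apply: in_img => //; have [] := t_sol Bu. Qed.

Lemma fold_coord_continuous (y : D) j : dom c (base y) ->
  {for y, continuous (fun z => fwd c (base z) ord0 j)}.
Proof.
move=> cy; apply: (@continuous_comp _ _ _ (fwd c \o base)
  (fun u : 'rV[R]_n => u ord0 j)); last exact: coord_continuous.
apply: (continuous_comp (@base_continuous R M phi y)).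
exact: fwd_continuous.
Qed.

Lemma fold_fwd_continuous (y : D) : dom c (base y) -> {for y, continuous ffwd}.
Proof.
move=> cy; apply: update_continuous; last exact: height_continuous.
apply: (continuous_comp (@base_continuous R M phi y)).
exact: fwd_continuous.
Qed.

Lemma fold_dom_open : open fdom.
Proof.
have ob : open (base @^-1` dom c : set D).
  by move/continuousP: (@base_continuous R M phi); apply; exact: dom_open.
apply: openI; apply: (open_preimage ob).
- by move=> y; exact: fold_fwd_continuous.
- exact: openB.
- by move=> y cy; exact: fold_coord_continuous.
rewrite (_ : mkset _ = ball (x0 ord0 i) e); first exact: ball_open.
by apply/seteqP; split => s; rewrite /ball /= distrC.
Qed.

(** Coordinate [i] of the base point solves the implicit equation, because the squared height is the
    value of [phi]; uniqueness of the root identifies it with [t]. *)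
Lemma fold_chartK y : fdom y -> fbwd (ffwd y) = y.
Proof.
move=> [[cy By] [_ /= ye]].
have E : tau (ffwd y) = fwd c (base y).
  rewrite /tau -(@t_uniq _ (fwd c (base y) ord0 i) By ye).
    by rewrite /ffwd update_update update_id.
  by rewrite /ffwd update_update update_id update_same height_sqr /f /= chartK.
have [E1 E2] := fold_bwdE By; apply: double_inj.
  by rewrite E1 E chartK.
by rewrite E2 update_same.
Qed.

Lemma fold_imgE : ffwd @` fdom = B.
Proof.
apply/seteqP; split => [_ [y [[_ By] _] <-]//|u Bu].
have [E1 E2] := fold_bwdE Bu; have [cu _] := fold_tau_img Bu.
have Ef : fwd c (base (fbwd u)) = tau u by rewrite E1 chart_bwdK.
have Eu : ffwd (fbwd u) = u by rewrite /ffwd Ef E2 update_update update_id.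
have cb : dom c (base (fbwd u)) by rewrite E1; exact: dom_bwd.
exists (fbwd u) => //; split; split => //=; first by rewrite Eu.
by rewrite Ef update_same; have [] := t_sol Bu.
Qed.

Let tau_Ck0 : Ck 0 B tau.
Proof.
apply: (Ck_update _ openB); first exact: Ck_id.
by move=> u /t_sol[].
Qed.

Lemma fold_bwd_continuous u : B u -> {for u, continuous fbwd}.
Proof.
move=> Bu.
apply: into_double_continuous.
  have cb : {for u, continuous (bwd c \o tau)}.
    apply: (continuous_comp (tau_Ck0 Bu)); apply: bwd_continuous.
    by have [] := fold_tau_img Bu.
  by apply: (near_eq_continuous openB Bu _ cb) => v /fold_bwdE[/= -> _].
have ci : {for u, continuous (fun v : 'rV[R]_n => v ord0 i)} by exact: coord_continuous.
by apply: (near_eq_continuous openB Bu _ ci) => v /fold_bwdE[_ /= ->].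
Qed.

Definition fold_chart : chart R n D.
Proof.
refine (@Chart R n D fdom ffwd fbwd fold_dom_open _ _ _ _).
- by rewrite fold_imgE; exact: openB.
- by move=> y; rewrite inE; exact: fold_chartK.
- by move=> y [[cy _] _]; exact: fold_fwd_continuous.
- by rewrite fold_imgE; exact: fold_bwd_continuous.
Defined.

(** The map [iota] overwriting coordinate [i] by the value of [f] is an immersion where the i-th
    partial derivative of [f] is nonzero, and [iota \o tau] only squares coordinate [i] of [u], by
    the equation defining [t]. Hence [Ck_lift] upgrades the continuous [tau] to a smooth map. *)
Lemma fold_tau_smooth : smooth_on B tau.
Proof.
have oU : open (img c) by exact: chart_img_open.
have sf : smooth_on (img c) f by exact: phi_smooth.
pose U' := img c `&` ('D_(delta_mx ord0 i) f) @^-1` [set s | s != 0].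
have oU' : open U'.
  apply: open_preimage => //.
  by have [_ /(_ (delta_mx ord0 i))] := sf 1%N.
pose iota (u : 'rV[R]_n) := update u i (f u).
have si : smooth_on U' iota.
  move=> k; apply: (Ck_update _ oU'); first exact: Ck_id.
  by apply: Ck_sub (sf k) => u [].
move=> k; apply: (@Ck_lift _ _ k _ _ B U' iota tau openB oU') => //.
- by move=> u Bu; exact: fold_tau_img.
- move=> u [cu Du] v.
  have df : differentiable f u by exact: Ck_differentiable (sf 1%N) cu.
  rewrite -deriveEjacobian; last exact: Ck_differentiable (si 1%N) (conj cu Du).
  rewrite derive_update//.
  rewrite derive_id => E.
  (* A vector killed by the derivative of [iota] has no component outside coordinate [i]; along that
     coordinate the derivative of [f] detects it. *)
  have v_line : v = v ord0 i *: delta_mx ord0 i.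
    apply/rowP => j; move/rowP: E => /(_ j); rewrite !mxE eqxx andTb.
    by case: eqP => [-> _|_ ->]; rewrite ?mulr1 ?mulr0.
  have : 'D_v f u = 0 by move/rowP: E => /(_ i); rewrite !mxE eqxx.
  rewrite deriveE// v_line linearZ -deriveE// => /eqP.
  by rewrite mulf_eq0 (negPf Du) orbF v_line => /eqP ->; rewrite scale0r.
apply: (@Ck_eq _ _ _ _ _ (fun u : 'rV[R]_n => update u i (u ord0 i * u ord0 i))) => //.
  move=> u Bu; have [_ E _] := t_sol Bu.
  by rewrite /iota /= E /tau update_update expr2.
apply: (Ck_update _ openB); first exact: Ck_id.
by apply: (CkM openB); apply: (Ck_coord _ _ openB); exact: Ck_id.
Qed.

(** A vector killed by the derivative of [tau] vanishes outside coordinate [i], and in this chart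
    the height is coordinate [i] itself. *)
Lemma fold_chart_adapted : adapted fold_chart.
Proof.
move=> c' ac' Q.
have oQ : open Q by exact: open_adapted.
have QB u : Q u -> B u by move=> [y [Vy _] <-]; rewrite -fold_imgE; exists y.
have Qc u : Q u -> (fwd c @` (dom c `&` dom c')) (tau u).
  move=> Qu; have [y [yV c'y] yu] := Qu; have Bu := QB u Qu.
  have [E1 _] := fold_bwdE Bu; have [cu _] := fold_tau_img Bu.
  exists (bwd c (tau u)); last exact: chart_bwdK.
  split; first exact: dom_bwd.
  by rewrite -E1 -yu -[fbwd _]/(fbwd (ffwd y)) fold_chartK.
have EP u : Q u -> ((fwd c' \o bwd c) \o tau) u =
    (fwd c' \o base \o bwd fold_chart) u.
  by move=> /QB Bu /=; rewrite (fold_bwdE Bu).1.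
have Es u : Q u -> u ord0 i = (height \o bwd fold_chart) u.
  by move=> /QB Bu /=; rewrite (fold_bwdE Bu).2.
have oO := open_overlap (c := c) (d := c').
have stau k : Ck k Q tau by apply: Ck_sub QB (fold_tau_smooth k).
split.
- move=> k; apply: (Ck_eq oQ EP).
  exact: (Ck_comp_mx oQ oO Qc (stau k) (atlas_compat ac ac' k)).
- by move=> k; apply: (Ck_eq oQ Es); apply: (Ck_coord _ _ oQ); exact: Ck_id.
move=> u v Qu.
have dtau : differentiable tau u by exact: Ck_differentiable (stau 1%N) Qu.
have dT : differentiable (fwd c' \o bwd c) (tau u).
  exact: Ck_differentiable (atlas_compat ac ac' 1%N) (Qc u Qu).
have dPt : differentiable ((fwd c' \o bwd c) \o tau) u.
  exact: differentiable_comp.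
rewrite -(jacobian_near_eq dPt (near_open oQ Qu EP)).
rewrite (jacobian_comp erefl dtau dT) mulmxA => vJ.
have [x [cx c'x] xu] := Qc u Qu.
have := trans_unit ac ac' cx c'x; rewrite /trans xu => Ju.
have vtau : v *m jacobian tau u = 0.
  by apply: (can_inj (mulmxK Ju)); rewrite vJ mul0mx.
have dt : differentiable t u.
  have -> : t = fun u => tau u ord0 i by apply/funext => w; rewrite update_same.
  by apply: (@Ck_differentiable _ _ _ 0%N Q) => //; apply: (Ck_coord _ _ oQ); exact: stau.
move: vtau; rewrite -deriveEjacobian// /tau derive_update//.
rewrite derive_id => vu vs; apply: (update_eq0 vu).
have did : differentiable (fun u : 'rV[R]_n => u) u by exact: ex_diff.
have ds : differentiable (fun u : 'rV[R]_n => u ord0 i) u.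
  exact: differentiable_coord.
have Eg : grad (height \o bwd fold_chart) u = grad (fun u : 'rV[R]_n => u ord0 i) u.
  by apply/esym; apply: grad_near_eq; exact: near_open oQ Qu Es.
have := derive_coord v ord0 i did; rewrite derive_id => <-.
by rewrite grad_derive// -Eg vs mxE.
Qed.

End Fold.

(** * The double as a manifold and the fold map *)

Section DoubleManifold.
Context {R : realType} {n : nat} {M : manifold R n}.
Variable phi : M -> R.
Hypothesis phi_smooth : smooth_fun phi.
Hypothesis dphi_neq0 :
  forall x, phi x = 0 -> exists v, differential phi x v != 0.

Lemma differential_coord x v : differential phi x v != 0 ->
  exists i, 'D_(delta_mx ord0 i) (phi \o bwd (chart_at x)) (fwd (chart_at x) x) != 0.
Proof.
rewrite /differential => dv; apply: contrapT => H; move/eqP: dv; apply.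
rewrite linear_rV_sum big1// => i _; rewrite -deriveE.
  by have [->|Di] := eqVneq ('D_(delta_mx ord0 i) (phi \o bwd (chart_at x))
    (fwd (chart_at x) x)) 0; [rewrite scaler0|case: H; exists i].
apply: Ck_differentiable (phi_smooth (atlas_chart_at x) 1%N) _.
by apply: img_fwd; exact: dom_chart_at.
Qed.

(** [U] serves the inverse of the fold map on the boundary: over it, setting coordinate [i] to
    height 0 stays in the image of [q], and the points of height 0 lie in the domain of [q]. *)
Lemma fold_exists (p : double phi) : height p = 0 ->
  exists (c : chart R n M) (i : 'I_n) (q : chart R n (double phi)) (U : set M),
  [/\ atlas c, adapted q, dom q p,
      forall y, dom q y ->
        dom c (base y) /\ fwd q y = update (fwd c (base y)) i (height y) &
      [/\ open U, U (base p),
          forall x, U x -> dom c x /\ img q (update (fwd c x) i 0) &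
          forall y, height y = 0 -> U (base y) -> dom q y]].
Proof.
move=> p0; have phip : phi (base p) = 0 by rewrite -height_sqr p0 expr0n.
have [v /differential_coord[i Di]] := dphi_neq0 phip.
pose c := chart_at (base p); have ac : atlas c by exact: atlas_chart_at.
have cp : dom c (base p) by exact: dom_chart_at.
have [|d [e [t [d0 e0 in_img t_sol t_uniq]]]] := implicit_function
  (@chart_img_open _ _ _ c) (phi_smooth ac 1%N) (img_fwd cp) _ Di.
  by rewrite /= chartK.
pose q := @fold_chart R n M phi c p i d e t in_img t_sol t_uniq.
have iq : img q = ball (update (fwd c (base p)) i 0) d.
  exact: (fold_imgE in_img t_sol).
have Bp : ball (update (fwd c (base p)) i 0) d (update (fwd c (base p)) i 0).
  exact: ballxx.
pose U1 := dom c `&` (fun x => update (fwd c x) i 0) @^-1`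
  ball (update (fwd c (base p)) i 0) d.
pose U2 := dom c `&` (fun x => fwd c x ord0 i) @^-1` ball (fwd c (base p) ord0 i) e.
have cj x j : dom c x -> {for x, continuous (fun y => fwd c y ord0 j)}.
  move=> cx; apply: (@continuous_comp _ _ _ (fwd c) (fun u : 'rV[R]_n => u ord0 j)).
    exact: fwd_continuous.
  exact: coord_continuous.
exists c, i, q, (U1 `&` U2); split => //.
- exact: fold_chart_adapted.
- split; split => //=; first by rewrite p0.
  by rewrite subrr normr0.
- by move=> y [[cy _] _].
split.
- apply: openI; apply: (open_preimage (dom_open c)).
  + move=> x cx; apply: update_continuous; last exact: cst_continuous.
    exact: fwd_continuous.
  + exact: ball_open.
  + by move=> x; exact: cj.
  + exact: ball_open.
- by split; split => //=; exact: ballxx.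
- by move=> x [[cx Bx] _]; rewrite iq.
- move=> y y0 [[cy By] [_ ye]]; split; split => //=; first by rewrite y0.
  by move: ye; rewrite /ball /= distrC.
Qed.

Lemma adapted_chart_exists (y : double phi) :
  exists d : chart R n (double phi), adapted d /\ dom d y.
Proof.
have [y0|yN0] := eqVneq (height y) 0.
  by have [c [i [q [U [_ aq qy _ _]]]]] := fold_exists y0; exists q.
have ac := atlas_chart_at (base y).
exists (sheet_chart phi_smooth y (height y < 0) ac).
split; first exact: sheet_chart_adapted.
split; first exact: dom_chart_at.
rewrite /=; case: (ltgtP (height y) 0) yN0 => //= h _.
  by rewrite expr1 mulN1r oppr_gt0.
by rewrite expr0 mul1r.
Qed.

Definition double_mfd : manifold R n := @Manifold R n (double phi)
  (@double_hausdorff R M phi (@mfd_hausdorff _ _ M))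
  (@double_second_countable R M phi (@mfd_second_countable _ _ M))
  [set d | adapted d]
  (fun y => projT1 (cid (adapted_chart_exists y)))
  (fun y => (projT2 (cid (adapted_chart_exists y))).1)
  (fun y => (projT2 (cid (adapted_chart_exists y))).2)
  (fun c d => @adapted_compat R n M phi c d).

Definition fold_map (y : double_mfd) : M := base (y : double phi).

Lemma fold_map_smooth : smooth_map fold_map.
Proof.
split; first by move=> y _; exact: base_continuous.
move=> d c ad ac; have [sP _ _] := ad c ac.
by move=> k; apply: Ck_sub (sP k) => _ [y [[_ dy] cy] <-]; exists y.
Qed.

Let Om := [set x | 0 < phi x].
Let Gam := [set x | phi x = 0].
Let Gh := fold_map @^-1` Gam.

Lemma fold_bdryE y : Gh y <-> height (y : double phi) = 0.
Proof.
rewrite /Gh /Gam /= -height_sqr; split => [/eqP|->]; last by rewrite expr0n.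
by rewrite sqrf_eq0 => /eqP.
Qed.

Lemma range_fold_map : range fold_map = [set x | 0 <= phi x].
Proof.
apply/seteqP; split => [_ [y _ <-]|x x0]; first by rewrite /= -height_sqr sqr_ge0.
have E : Num.sqrt (phi x) ^+ 2 = phi x by rewrite sqr_sqrtr.
by exists (double_pt E).
Qed.

(** If a zero of [phi] had a neighbourhood without positive values, it would be a maximum of [phi]
    along every coordinate line through it, and the differential would vanish there. *)
Lemma closure_pos : closure Om = [set x | 0 <= phi x].
Proof.
have cphi := smooth_fun_continuous phi_smooth.
apply/seteqP; split => [x clx|x].
  rewrite /= leNgt; apply/negP => x0.
  have [z [/= z0 z1]] := clx _ (cphi x _ (lt_nbhsl x0)).
  by move: (lt_trans z0 z1); rewrite ltxx.
rewrite /= le_eqVlt => /orP[/eqP x0|x0]; last exact: (@subset_closure _ Om).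
have [v dv] := dphi_neq0 (esym x0).
pose c := chart_at x; have ac : atlas c by exact: atlas_chart_at.
have cx : dom c x by exact: dom_chart_at.
pose f := phi \o bwd c; pose u := fwd c x.
have df : differentiable f u.
  by apply: Ck_differentiable (phi_smooth ac 1%N) _; exact: img_fwd.
move=> B /(near_fwd cx) NB; apply: contrapT => noB.
have N w : \forall s \near (0 : R), img c (u + s *: w) /\ B (bwd c (u + s *: w)).
  have : {for (0 : R), continuous (fun s : R => u + s *: w)}.
    by apply: cvgD; [exact: cvg_cst|apply: cvgZr_tmp; exact: cvg_id].
  have NB' : nbhs (u + (0 : R) *: w) (fun v => img c v /\ B (bwd c v)).
    by rewrite scale0r addr0.
  by move=> cu; exact: (cu _ NB').
have le0 w : \forall s \near (0 : R),
    img c (u + s *: w) /\ f (u + s *: w) <= 0.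
  apply: filterS (N w) => s [cs Bs]; split => //; rewrite leNgt; apply/negP => fs.
  by apply: noB; exists (bwd c (u + s *: w)).
have D0 w : 'D_w f u = 0.
  have [e /= e0 He] := (nbhs_ballP _ _).1 (le0 w).
  have in_ball s : s \in `](- e), e[ -> ball (0 : R) e s.
    by rewrite in_itv /= /ball /= sub0r normrN ltr_norml.
  have f0 : f (u + 0 *: w) = 0 by rewrite scale0r addr0 /f /= chartK.
  have /line_derive Dl : differentiable f (u + 0 *: w) by rewrite scale0r addr0.
  have [||||_] := @derive1_at_max R (fun s => f (u + s *: w)) (- e) e 0.
  - by rewrite ltW// gtrN.
  - move=> s /in_ball/He[cs _].
    have /line_derive[] // : differentiable f (u + s *: w).
    exact: Ck_differentiable (phi_smooth ac 1%N) cs.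
  - by rewrite in_itv /= oppr_lt0 e0.
  - by move=> s /in_ball/He[_]; rewrite f0.
  by case: Dl => _ ->; rewrite scale0r addr0.
by move/eqP: dv; apply; rewrite /differential -deriveE.
Qed.

End DoubleManifold.

Section FoldMap.
Context {R : realType} {n : nat} {M : manifold R n}.
Variable phi : M -> R.
Hypothesis phi_smooth : smooth_fun phi.
Hypothesis dphi_neq0 :
  forall x, phi x = 0 -> exists v, differential phi x v != 0.
Let N := double_mfd phi_smooth dphi_neq0.
Let pi : N -> M := @fold_map R n M phi phi_smooth dphi_neq0.
Let ht : N -> R := @height R M phi.
Let Om := [set x | 0 < phi x].
Let Gam := [set x | phi x = 0].
Let Gh : set N := pi @^-1` Gam.
Implicit Types (d : chart R n N) (c : chart R n M) (y : N).

Lemma fold_map_continuous : continuous pi.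
Proof. exact: base_continuous. Qed.

Lemma fold_map_rep d c y : atlas d -> atlas c -> dom d y -> dom c (pi y) ->
  [/\ differentiable (fwd c \o pi \o bwd d) (fwd d y),
      differentiable (ht \o bwd d) (fwd d y) &
      forall v : 'rV[R]_n, v *m rep d c pi y = 0 -> v *m dcol d ht y = 0 -> v = 0].
Proof.
move=> ad ac dy cy; have [sP sh inj] := ad c ac.
have Qy : (fwd d @` (dom d `&` base @^-1` dom c)) (fwd d y) by exists y.
split.
- exact: Ck_differentiable (sP 1%N) Qy.
- exact: Ck_differentiable (sh 1%N) Qy.
- by move=> v; exact: inj.
Qed.

Lemma phi_differentiable c x : atlas c -> dom c x ->
  differentiable (phi \o bwd c) (fwd c x).
Proof.
by move=> ac cx; apply: Ck_differentiable (phi_smooth ac 1%N) (img_fwd cx).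
Qed.

(* The derivative of [ht ^+ 2 = phi \o pi]. *)
Lemma fold_map_dphi d c y : atlas d -> atlas c -> dom d y -> dom c (pi y) ->
  rep d c pi y *m dcol c phi (pi y) = (2 * ht y) *: dcol d ht y.
Proof.
move=> ad ac dy cy; have [dP dh _] := fold_map_rep ad ac dy cy.
have dphi := phi_differentiable ac cy.
have E : (fwd c \o pi \o bwd d) (fwd d y) = fwd c (pi y) by rewrite /= chartK.
rewrite /rep /dcol -(grad_comp E dP dphi).
rewrite (_ : grad _ _ = grad ((ht \o bwd d) * (ht \o bwd d)) (fwd d y)).
  have dh' v : derivable (ht \o bwd d) (fwd d y) v by exact: diff_derivable.
  apply/colP => i; rewrite mxE deriveM// !mxE /= chartK//.
  by rewrite -scalerDl -[_ *: _]/(_ * _) mulr_natl mulr2n.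
apply: grad_near_eq; have N1 : \forall z \near y, dom c (pi z).
  by apply: (@fold_map_continuous y); exact: dom_near.
apply: filterS (near_fwd dy N1) => u [_ cu] /=.
by rewrite (chartK cu) -[phi _]height_sqr expr2.
Qed.

Lemma dcol_phi_neq0 c x : atlas c -> dom c x -> phi x = 0 -> dcol c phi x != 0.
Proof.
move=> ac cx /dphi_neq0[v dv].
have ax := atlas_chart_at x; have dx := dom_chart_at x.
have [dphi E] := dcol_change ac ax cx dx (phi_differentiable ac cx).
apply: contraNneq dv => c0; rewrite /differential -deriveE//.
by rewrite grad_derive// -/(dcol (chart_at x) phi x) E c0 !mulmx0 mxE.
Qed.

(** If the gradient of the height vanished on the fold, the immersion condition alone would make the
    Jacobian of [pi] invertible; but there it kills the gradient of [phi], which is nonzero. *)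
Lemma dcol_ht_neq0 d y : atlas d -> dom d y -> ht y = 0 ->
  exists v : 'rV[R]_n, (v *m dcol d ht y) ord0 ord0 = 1.
Proof.
move=> ad dy y0; pose c := chart_at (pi y).
have ac : atlas c by exact: atlas_chart_at.
have cy : dom c (pi y) by exact: dom_chart_at.
have [_ _ inj] := fold_map_rep ad ac dy cy.
have phi0 : phi (pi y) = 0 by rewrite -[phi _]height_sqr -/(ht y) y0 expr0n.
have : exists v : 'rV[R]_n, (v *m dcol d ht y) ord0 ord0 != 0.
  apply: contrapT => H; have := dcol_phi_neq0 ac cy phi0.
  have Ju : rep d c pi y \in unitmx.
    apply: unitmx_inj => v vJ; apply: inj => //; apply/rowP => j; rewrite ord1 [RHS]mxE.
    by have [->//|v0] := eqVneq ((v *m dcol d ht y) ord0 ord0) 0; case: H; exists v.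
  rewrite -(mulKmx Ju (dcol c phi (pi y))) fold_map_dphi// y0 mulr0 scale0r mulmx0.
  by rewrite eqxx.
move=> [v v0]; exists (((v *m dcol d ht y) ord0 ord0)^-1 *: v).
by rewrite -scalemxAl mxE mulVf.
Qed.

(** In coordinates a sheet is the inverse of its own chart of the double followed by another chart:
    a change of charts of the double. *)
Lemma sheet_smooth (y0 : N) (b : bool) : smooth_map_on Om (sheet y0 b : M -> N).
Proof.
split => [x x0|c d ac ad]; first exact: sheet_continuous.
have as_ := sheet_chart_adapted phi_smooth y0 b ac.
move=> k; apply: Ck_sub (adapted_compat as_ ad k).
move=> _ [x [[x0 cx] dx] <-]; have [E1 E2] := sheetE y0 b (ltW x0).
exists (sheet y0 b x); last by rewrite /= E1.
split => //; split; first by rewrite /= E1.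
by rewrite /= E2 mulrA -expr2 sqrr_sign mul1r sqrtr_gt0.
Qed.

Lemma fold_map_diffeo_sheet (b : bool) :
  diffeo_on [set y | 0 < (-1) ^+ b * ht y] Om pi.
Proof.
have pos y : 0 < (-1) ^+ b * ht y -> 0 < phi (pi y).
  move=> y0; rewrite -[phi _]height_sqr exprn_even_gt0//=.
  by apply: contraTneq y0; rewrite /ht => ->; rewrite mulr0 ltxx.
split; first split.
- by move=> y /pos.
- move=> y z; rewrite !inE => y0 z0 yz.
  rewrite -[LHS](sheet_base y (ltW y0)) -[RHS](sheet_base y (ltW z0)).
  by congr (sheet y b _).
- move=> x x0; have E : Num.sqrt (phi x) ^+ 2 = phi x by rewrite sqr_sqrtr// ltW.
  have [E1 E2] := sheetE (double_pt E) b (ltW x0).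
  exists (sheet (double_pt E) b x) => //.
  by rewrite /= /ht E2 mulrA -expr2 sqrr_sign mul1r sqrtr_gt0.
- move=> y y0; exists setT, pi; split => //; last exact: fold_map_smooth.
  by split => //; exact: openT.
- move=> x x0; have E : Num.sqrt (phi x) ^+ 2 = phi x by rewrite sqr_sqrtr// ltW.
  exists Om, (sheet (double_pt E) b); split.
  + split => //; move/continuousP: (smooth_fun_continuous phi_smooth).
    by move/(_ _ (@open_gt _ 0)).
  + exact: sheet_smooth.
  + by move=> y y0 _; apply: sheet_base; exact: ltW.
Qed.

(** The covering is trivial: all of [Om] serves as the neighbourhood, and the sign of the height
    separates the sheets. *)
Lemma fold_map_covering : double_covering pi Om.
Proof.
move=> x x0; exists Om, [set y | 0 < (-1) ^+ false * ht y],
  [set y | 0 < (-1) ^+ true * ht y].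
have cht (b : bool) : continuous (fun y => (-1) ^+ b * ht y).
  move=> y; apply: (@continuousM R N (fun=> (-1) ^+ b) ht y).
    exact: cst_continuous.
  exact: height_continuous.
split.
- split => //; split => //; move/continuousP: (smooth_fun_continuous phi_smooth).
  by move/(_ _ (@open_gt _ 0)).
- by split; [move/continuousP: (cht false)|move/continuousP: (cht true)];
    move/(_ _ (@open_gt _ 0)).
- split; apply/seteqP; split => [y|y] //=.
  + by rewrite expr0 expr1 mul1r mulN1r oppr_gt0 => -[y0 /(lt_trans y0)]; rewrite ltxx.
  + rewrite /Om /= -[phi _]height_sqr exprn_even_gt0//= expr0 expr1 mul1r mulN1r.
    rewrite oppr_gt0.
    by rewrite -/(ht y) => y0; case: (ltgtP (ht y) 0) y0 => // h _; [right|left].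
  + rewrite expr0 expr1 mul1r mulN1r oppr_gt0 /Om /= -[phi _]height_sqr.
    rewrite exprn_even_gt0//= -/(ht y).
    by case=> h; [rewrite gt_eqF|rewrite lt_eqF].
- exact: fold_map_diffeo_sheet.
- exact: fold_map_diffeo_sheet.
Qed.

Lemma fold_bdry_ht y : Gh y <-> ht y = 0.
Proof. exact: fold_bdryE. Qed.

(** The height is a defining function, and [dcol_ht_neq0] makes it a submersion along the fold. *)
Lemma fold_bdry_hypersurface : embedded_hypersurface Gh.
Proof.
move=> y d /fold_bdry_ht y0 ad dy.
have [_ sh _] := ad _ (atlas_chart_at (pi y)).
set Q := fwd d @` _ in sh.
have oQ : open Q by exact: open_adapted.
have Qy : Q (fwd d y) by exists y => //; split => //; exact: dom_chart_at.
have sF : smooth_on Q (fun u => (ht (bwd d u))%:M : 'rV[R]_1).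
  by move=> k; apply: (Ck_scalar_mx oQ); exact: sh.
exists (fun u => (ht (bwd d u))%:M); split.
  exists Q; split => //.
  move=> u [z [dz cz] <-]; split.
    move=> [z' [/fold_bdry_ht z'0 dz'] zz']; rewrite -zz' chartK// z'0.
    by rewrite raddf0.
  rewrite chartK// => /matrixP/(_ ord0 ord0); rewrite !mxE eqxx mulr1n => z0.
  by exists z => //; split => //; apply/fold_bdry_ht.
move=> w; have [v v1] := dcol_ht_neq0 ad dy y0.
exists (w ord0 ord0 *: v); rewrite linearZ /=; apply/rowP => j; rewrite !ord1 mxE.
have dF := Ck_differentiable (sF 1%N) Qy.
rewrite -deriveE// -derive_coord//.
rewrite (_ : (fun u => _) = ht \o bwd d); last first.
  by apply/funext => u; rewrite mxE eqxx mulr1n.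
rewrite grad_derive; first by rewrite -[grad _ _]/(dcol d ht y) v1 mulr1.
exact: Ck_differentiable (sh 1%N) Qy.
Qed.

(** The inverse must extend smoothly off [Gam]. The extension [G] sends a nearby point of [M] to the
    point of the fold with the same coordinates in [c] other than [i], by reading these with height
    0 in the chart [q]. *)
Lemma fold_map_diffeo_bdry : diffeo_on Gh Gam pi.
Proof.
split; first split.
- by move=> y.
- move=> y z; rewrite !inE => /fold_bdry_ht y0 /fold_bdry_ht z0 yz.
  by apply: double_inj => //; rewrite -/(ht y) y0.
- move=> x x0; have E : 0 ^+ 2 = phi x by rewrite expr0n x0.
  by exists (double_pt E).
- move=> y y0; exists setT, pi; split => //; last exact: fold_map_smooth.
  by split => //; exact: openT.
move=> x x0; have E : 0 ^+ 2 = phi x by rewrite expr0n x0.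
have [c [i [q [U [ac aq qp qE [oU Up Uq qU]]]]]] :=
  @fold_exists _ _ _ _ phi_smooth dphi_neq0 (double_pt E) erefl.
pose G (z : M) : N := bwd q (update (fwd c z) i 0).
have cup z : U z -> {for z, continuous (fun z => update (fwd c z) i 0)}.
  move=> /Uq[cz _]; apply: update_continuous; last exact: cst_continuous.
  exact: fwd_continuous.
have cG z : U z -> {for z, continuous G}.
  move=> Uz; apply: (continuous_comp (cup z Uz)).
  by apply: bwd_continuous; have [_ +] := Uq z Uz.
exists U, G; split => //; last first.
  move=> y /fold_bdry_ht y0 Uy; have qy := qU y y0 Uy.
  by have [_] := qE y qy; rewrite [height y]y0 /G => <-; rewrite chartK.
split => // c0 d ac0 ad.
set A := fwd c0 @` _.
have oA : open A.
  apply: open_fwd; last by move=> z [[]].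
  rewrite (_ : _ `&` _ = dom c0 `&` (U `&` G @^-1` dom d)); last first.
    by apply/seteqP; split => z /=; tauto.
  by apply: openI; [exact: dom_open|apply: open_preimage => //; exact: dom_open].
pose B := fwd q @` (dom q `&` dom d).
have oB : open B.
  by apply: open_fwd; [apply: openI; exact: dom_open|move=> z []].
have AB u : A u -> B (update ((fwd c \o bwd c0) u) i 0).
  move=> [z [[Uz cz] dz] <-]; rewrite /= chartK//.
  have [_ iq] := Uq z Uz; exists (G z); last exact: chart_bwdK.
  by split => //; exact: dom_bwd.
have Ac u : A u -> (fwd c0 @` (dom c0 `&` dom c)) u.
  by move=> [z [[Uz cz] dz] <-]; exists z => //; split => //; have [] := Uq z Uz.
move=> k.
apply: (@Ck_comp_mx _ _ k _ _ _ A B (fun u => update ((fwd c \o bwd c0) u) i 0)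
  (fwd d \o bwd q)) => //.
  apply: (Ck_update _ oA); last exact: Ck_cst.
  exact: Ck_sub Ac (atlas_compat ac0 ac k).
exact: (adapted_compat aq ad k).
Qed.

End FoldMap.

(** * The regularized Hamiltonian *)

Section RegularizedInverse.
Context {R : realType} {n : nat}.
Implicit Types (J K A : 'M[R]_n) (a b w : 'cV[R]_n) (s : R).

(* The regularization of [s *: invmx J]: when [J *m b = (2 * s) *: a] it is
   characterized by [K *m J = s%:M] and [K *m a = 2^-1 *: b], equations which keep
   their unique solution when [s] vanishes and [J] becomes singular. *)
Definition reginv J a b s : 'M[R]_n :=
  (s *: J^T + 2^-1 *: (b *m a^T)) *m invmx (J *m J^T + a *m a^T).

Section Spec.
Variables (J : 'M[R]_n) (a b : 'cV[R]_n) (s : R).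
Hypothesis inj : forall v : 'rV[R]_n, v *m J = 0 -> v *m a = 0 -> v = 0.

Lemma reginv_gram_unit : J *m J^T + a *m a^T \in unitmx.
Proof.
rewrite -mul_row_col -tr_row_mx; apply: gram_unit => v.
by rewrite mul_mx_row -(row_mx0 R 1 n 1) => /eq_row_mx[]; exact: inj.
Qed.

(** Multiply the first equation by [J^T] and the second by [a^T] on the right and add: [K] times the
    invertible Gram matrix of (J | a) is the first factor of [reginv]. *)
Lemma reginv_uniq K : K *m J = s%:M -> K *m a = 2^-1 *: b -> K = reginv J a b s.
Proof.
move=> KJ Ka; apply: (can_inj (mulmxK reginv_gram_unit)).
rewrite mulmxKV ?reginv_gram_unit// mulmxDr !mulmxA KJ Ka.
by rewrite mul_scalar_mx scalemxAl.
Qed.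

Hypothesis Jb : J *m b = (2 * s) *: a.
Hypothesis b0 : s = 0 -> b != 0.

(** By uniqueness it is enough to exhibit some solution: s J^-1 when [s] is nonzero, and (b b^T / 2)
    (J + a b^T)^-1 when it vanishes. *)
Lemma reginv_spec :
  reginv J a b s *m J = s%:M /\ reginv J a b s *m a = 2^-1 *: b.
Proof.
suff [K [KJ Ka]] : exists K, K *m J = s%:M /\ K *m a = 2^-1 *: b.
  by rewrite -(reginv_uniq KJ Ka).
have two0 : (2 : R) != 0 by rewrite pnatr_eq0.
have [s0|s0] := eqVneq s 0; last first.
  have Ju : J \in unitmx.
    apply: unitmx_inj => v vJ; apply: inj => //; apply/eqP.
    have : (2 * s) *: (v *m a) == 0 by rewrite scalemxAr -Jb mulmxA vJ mul0mx.
    by rewrite scaler_eq0 mulf_eq0 (negPf two0) (negPf s0).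
  exists (s *: invmx J); split; first by rewrite -scalemxAl mulVmx// scalemx1.
  have -> : a = (2 * s)^-1 *: (J *m b).
    by rewrite Jb scalerA mulVf ?scale1r// mulf_neq0.
  by rewrite -scalemxAr -scalemxAl mulKmx// scalerA invfM -mulrA mulVf// mulr1.
have bn0 := b0 s0; move: Jb; rewrite s0 mulr0 scale0r => Jb0.
pose m := (b^T *m b) ord0 ord0.
have bb : b^T *m b = m%:M by exact: mx11_scalar.
have m0 : m != 0.
  apply: contraNneq bn0 => m0; have : b^T = 0.
    by apply: trmx_norm_eq0; rewrite trmxK bb m0 raddf0.
  by move=> bT; rewrite -(trmxK b) bT trmx0.
(* The rank one term repairs the kernel of [J]: [B] sends [b] to |b|^2 a. Hence [v *m B = 0] forces
   [v *m a = 0], then [v *m J = 0], so [v = 0]. *)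
pose B := J + a *m b^T.
have Bb : B *m b = m *: a by rewrite mulmxDl Jb0 add0r -mulmxA bb mul_mx_scalar.
have Bu : B \in unitmx.
  apply: unitmx_inj => v vB.
  have va : v *m a = 0.
    apply/eqP; have : m *: (v *m a) == 0 by rewrite scalemxAr -Bb mulmxA vB mul0mx.
    by rewrite scaler_eq0 (negPf m0).
  apply: inj => //; move: vB; rewrite mulmxDr mulmxA va mul0mx addr0.
  exact.
pose K := 2^-1 *: (b *m b^T) *m invmx B.
have KB : K *m B = 2^-1 *: (b *m b^T) by rewrite mulmxKV.
have Ka : K *m a = 2^-1 *: b.
  have -> : a = m^-1 *: (B *m b) by rewrite Bb scalerA mulVf// scale1r.
  rewrite -scalemxAr mulmxA KB -scalemxAl -mulmxA bb mul_mx_scalar.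
  by rewrite !scalerA; congr (_ *: _); field; exact: m0.
exists K; split => //; rewrite raddf0.
have -> : J = B - a *m b^T by rewrite addrK.
by rewrite mulmxBr KB mulmxA Ka -scalemxAl subrr.
Qed.

End Spec.

Definition quad A w : R := (w^T *m A *m w) ord0 ord0.

Lemma quadZ A s w : quad A (s *: w) = s ^+ 2 * quad A w.
Proof.
have wT : (s *: w)^T = s *: w^T by rewrite linearZ.
by rewrite /quad wT -!scalemxAl -scalemxAr scalerA mxE expr2.
Qed.

End RegularizedInverse.

(** * The dual norm as a quadratic form *)

Section DualNorm.
Context {R : realType} {n : nat} {M : manifold R n}.
Variable g : metric M.

Lemma metric_unit x : g x \in unitmx.
Proof.
apply: unitmx_inj => v vg; apply/eqP; apply: contraT => v0.
by have := met_pos g x v0; rewrite vg mul0mx mxE ltxx.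
Qed.

Lemma metric_inv_sym x : (invmx (g x))^T = invmx (g x).
Proof. by rewrite trmx_inv met_sym. Qed.

Lemma metric_ge0 x (v : 'rV[R]_n) : 0 <= (v *m g x *m v^T) ord0 ord0.
Proof.
have [->|v0] := eqVneq v 0; first by rewrite !mul0mx mxE.
by apply: ltW; exact: met_pos.
Qed.

Lemma quad_invE x (p : 'cV[R]_n) :
  quad (invmx (g x)) p =
  (((invmx (g x) *m p)^T) *m g x *m ((invmx (g x) *m p)^T)^T) ord0 ord0.
Proof.
rewrite /quad trmxK trmx_mul metric_inv_sym -!mulmxA; congr ((_ *m _) _ _).
by rewrite mulKVmx ?metric_unit// mulKmx ?metric_unit.
Qed.

Lemma quad_inv_gt0 x (p : 'cV[R]_n) : p != 0 -> 0 < quad (invmx (g x)) p.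
Proof.
move=> p0; rewrite quad_invE; apply: met_pos.
apply: contraNneq p0 => /(congr1 trmx); rewrite trmxK trmx0 => E.
by rewrite -(mulKVmx (metric_unit x) p) E mulmx0.
Qed.

Lemma quad_inv_ge0 x (p : 'cV[R]_n) : 0 <= quad (invmx (g x)) p.
Proof. by rewrite quad_invE metric_ge0. Qed.

(* Cauchy-Schwarz: [0 <= |v - t q|_g^2] with [q = g^-1 p], [t = (v p) / |q|_g^2]. *)
Lemma dual_pairing_le x (v : 'rV[R]_n) (p : 'cV[R]_n) :
  ((v *m p) ord0 ord0) ^+ 2 <= (v *m g x *m v^T) ord0 ord0 * quad (invmx (g x)) p.
Proof.
have [->|p0] := eqVneq p 0.
  by rewrite mulmx0 mxE expr0n/= mulr_ge0 ?metric_ge0// quad_inv_ge0.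
pose q := (invmx (g x) *m p)^T; pose Q := quad (invmx (g x)) p.
have Q0 : 0 < Q by exact: quad_inv_gt0.
set c := (v *m p) ord0 ord0; set X := (v *m g x *m v^T) ord0 ord0.
pose t := c / Q.
have gq : g x *m q^T = p by rewrite trmxK mulKVmx// metric_unit.
have qg : q *m g x = p^T.
  by rewrite -gq trmx_mul trmxK met_sym.
have E1 : (v - t *: q) *m g x = v *m g x - t *: p^T.
  by rewrite mulmxBl -scalemxAl qg.
have E2 : (v - t *: q)^T = v^T - t *: q^T by rewrite linearB linearZ.
have := metric_ge0 x (v - t *: q).
rewrite E1 E2 mulmxBr !mulmxBl -!scalemxAr -!scalemxAl.
rewrite -(mulmxA v (g x) q^T) gq.
have -> : p^T *m v^T = (v *m p)^T by rewrite trmx_mul.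
have -> : p^T *m q^T = (quad (invmx (g x)) p)%:M.
  by rewrite /q trmxK /quad -mx11_scalar mulmxA.
have entry (A B : 'M[R]_1) (r m : R) :
    (A - r *: B^T - (r *: B - r *: (r *: m%:M))) ord0 ord0 =
    A ord0 ord0 - r * B ord0 ord0 - (r * B ord0 ord0 - r * (r * m)).
  by rewrite !mxE eqxx mulr1n.
rewrite entry -/c -/X -/Q => H.
have : 0 <= Q * (X - t * c - (t * c - t * (t * Q))) by rewrite mulr_ge0// ltW.
have -> : Q * (X - t * c - (t * c - t * (t * Q))) = X * Q - c ^+ 2.
  by rewrite /t; field; rewrite gt_eqF.
by rewrite subr_ge0.
Qed.

(** The supremum is bounded by Cauchy-Schwarz and attained at the normalised vector dual to [p];
    this turns the dual norm into a formula whose smoothness can be read off. *)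
Lemma dual_norm_sqr x (p : 'cV[R]_n) :
  dual_norm g x p ^+ 2 = quad (invmx (g x)) p.
Proof.
set Q := quad _ _; have Q0 : 0 <= Q by exact: quad_inv_ge0.
suff -> : dual_norm g x p = Num.sqrt Q by rewrite sqr_sqrtr.
have ub : ubound [set `|(v *m p) ord0 ord0| | v in
    [set v | metric_norm g x v <= 1]] (Num.sqrt Q).
  move=> _ [v /= v1 <-]; rewrite -(@ler_pXn2r _ 2)// ?nnegrE ?sqrtr_ge0//.
  rewrite sqr_sqrtr// real_normK ?num_real//.
  apply: le_trans (dual_pairing_le x v p) _; rewrite ler_piMl//.
  rewrite -[leLHS](sqr_sqrtr (metric_ge0 x v)); exact: exprn_ile1.
apply/eqP; rewrite eq_le; apply/andP; split.
  apply: ge_sup => //.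
  exists `|((0 : 'rV[R]_n) *m p) ord0 ord0|, 0 => //=.
  by rewrite /metric_norm !mul0mx mxE sqrtr0.
apply: ub_le_sup; first by exists (Num.sqrt Q).
have [p0|p0] := eqVneq p 0.
  exists 0; first by rewrite /= /metric_norm !mul0mx mxE sqrtr0.
  by rewrite mul0mx mxE normr0 /Q p0 /quad mulmx0 mxE sqrtr0.
have {}Q0 : 0 < Q by exact: quad_inv_gt0.
have sQ0 : 0 < Num.sqrt Q by rewrite sqrtr_gt0.
(* The equality case of Cauchy-Schwarz, of unit length since g^-1 p has squared length [Q]. *)
exists ((Num.sqrt Q)^-1 *: (invmx (g x) *m p)^T).
  rewrite /= /metric_norm linearZ /= -!scalemxAl -scalemxAr scalerA mxE -quad_invE.
  by rewrite -/Q -invfM -expr2 (sqr_sqrtr (ltW Q0)) mulVf ?gt_eqF// sqrtr1.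
rewrite -scalemxAl mxE trmx_mul metric_inv_sym -/(quad _ _) -/Q.
rewrite ger0_norm; last by rewrite mulr_ge0// ?invr_ge0 ltW.
by rewrite -{2}(sqr_sqrtr (ltW Q0)) expr2 mulKf// gt_eqF.
Qed.

Lemma hamiltonianE (phi : M -> R) x p :
  hamiltonian g phi (x, p) = phi x * quad (invmx (g x)) p.
Proof. by rewrite /hamiltonian dual_norm_sqr. Qed.

End DualNorm.

Section Gram.
Context {R : realType} {n : nat} {M : manifold R n}.
Variable g : metric M.
Implicit Types c : chart R n M.

Definition gram c x : 'M[R]_n :=
  trans c (chart_at x) x *m g x *m (trans c (chart_at x) x)^T.

Lemma gram_unit_chart c x : atlas c -> dom c x -> gram c x \in unitmx.
Proof.
move=> ac cx; have ax := atlas_chart_at x; have dx := dom_chart_at x.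
have Tu := trans_unit ac ax cx dx.
by rewrite !unitmx_mul unitmx_tr Tu metric_unit.
Qed.

Lemma quad_gram c x (p : 'cV[R]_n) : atlas c -> dom c x ->
  quad (invmx (gram c x)) (trans c (chart_at x) x *m p) = quad (invmx (g x)) p.
Proof.
move=> ac cx; have ax := atlas_chart_at x; have dx := dom_chart_at x.
have Tu := trans_unit ac ax cx dx; set T := trans c _ x in Tu *.
have Gu := gram_unit_chart ac cx.
have gu := metric_unit g x.
have -> : invmx (gram c x) = invmx T^T *m invmx (g x) *m invmx T.
  apply: (can_inj (mulKmx Gu)); rewrite mulmxV// /gram -/T.
  have TTu : T^T \in unitmx by rewrite unitmx_tr.
  by rewrite !mulmxA mulmxK// mulmxK// mulmxV.
rewrite /quad trmx_mul !mulmxA mulmxK ?unitmx_tr//.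
by rewrite -[X in (X *m p) _ _]mulmxA mulVmx// mulmx1.
Qed.

Lemma Ck_gram k c : atlas c -> Ck k (img c) (fun u => gram c (bwd c u)).
Proof.
move=> ac; apply: Ck_eq (met_smooth g ac k); first exact: chart_img_open.
by move=> u cu; rewrite /gram /trans chart_bwdK.
Qed.

End Gram.

Section CkPhaseSpace.
Context {R : realType} {V1 V2 : normedModType R}.

Lemma Ck_fst k (U : set (V1 * V2)) : Ck k U (fst : V1 * V2 -> V1).
Proof. by apply: Ck_linear => w; exact: cvg_fst. Qed.

Lemma Ck_snd k (U : set (V1 * V2)) : Ck k U (snd : V1 * V2 -> V2).
Proof. by apply: Ck_linear => w; exact: cvg_snd. Qed.

Lemma open_fst (A : set V1) : open A -> open [set w : V1 * V2 | A w.1].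
Proof.
move=> oA; have : continuous (fst : V1 * V2 -> V1) by move=> w; exact: cvg_fst.
by move/continuousP; apply.
Qed.

End CkPhaseSpace.

Section CkQuad.
Context {R : realType} {V : normedModType R} {n : nat}.

Lemma Ck_quad k (U : set V) (A : V -> 'M[R]_n) (w : V -> 'cV[R]_n) : open U ->
  Ck k U A -> Ck k U w -> Ck k U (fun x => quad (A x) (w x)).
Proof.
move=> oU cA cw; apply: (Ck_coord _ _ oU).
apply: (Ck_mulmx oU) => //; apply: (Ck_mulmx oU) => //.
exact: Ck_trmx.
Qed.

Lemma Ck_reginv k (U : set V) (J : V -> 'M[R]_n) (a b : V -> 'cV[R]_n)
    (s : V -> R) : open U ->
  (forall x, U x -> forall v : 'rV[R]_n, v *m J x = 0 -> v *m a x = 0 -> v = 0) ->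
  Ck k U J -> Ck k U a -> Ck k U b -> Ck k U s ->
  Ck k U (fun x => reginv (J x) (a x) (b x) (s x)).
Proof.
move=> oU inj cJ ca cb cs.
have cJT := Ck_trmx oU cJ; have caT := Ck_trmx oU ca.
apply: (Ck_mulmx oU).
  apply: (CkD oU); first exact: (CkZ oU).
  apply: (CkZ oU); first exact: Ck_cst.
  exact: (Ck_mulmx oU).
apply: (Ck_invmx oU).
  by move=> x Ux; apply: reginv_gram_unit; exact: inj.
by apply: (CkD oU); exact: (Ck_mulmx oU).
Qed.

End CkQuad.

Section RegularizedHamiltonian.
Context {R : realType} {n : nat} {M : manifold R n}.
Variables (g : metric M) (phi : M -> R).
Hypothesis phi_smooth : smooth_fun phi.
Hypothesis dphi_neq0 :
  forall x, phi x = 0 -> exists v, differential phi x v != 0.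
Let N := double_mfd phi_smooth dphi_neq0.
Let pi : N -> M := @fold_map R n M phi phi_smooth dphi_neq0.
Let ht : N -> R := @height R M phi.
Let Gh : set N := pi @^-1` [set x | phi x = 0].
Implicit Types (d : chart R n N) (c : chart R n M) (y : N).

Definition fold_reginv d c y : 'M[R]_n :=
  reginv (rep d c pi y) (dcol d ht y) (dcol c phi (pi y)) (ht y).

Lemma fold_reginv_spec d c y : atlas d -> atlas c -> dom d y -> dom c (pi y) ->
  fold_reginv d c y *m rep d c pi y = (ht y)%:M /\
  fold_reginv d c y *m dcol d ht y = 2^-1 *: dcol c phi (pi y).
Proof.
move=> ad ac dy cy; have [_ _ inj] := fold_map_rep ad ac dy cy.
apply: reginv_spec; [exact: inj|exact: fold_map_dphi|move=> y0].
by apply: dcol_phi_neq0 => //; rewrite -[phi _]height_sqr -/(ht y) y0 expr0n.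
Qed.

Lemma fold_rep_change d d' c c' y :
  atlas d -> atlas d' -> atlas c -> atlas c' ->
  dom d y -> dom d' y -> dom c (pi y) -> dom c' (pi y) ->
  rep d' c' pi y = trans d' d y *m rep d c pi y *m trans c c' (pi y).
Proof.
move=> ad ad' ac ac' dy dy' cy cy'; have [dP _ _] := fold_map_rep ad ac dy cy.
have cpi : {for y, continuous pi} by exact: fold_map_continuous.
by have [_] := rep_change ad ad' ac ac' dy dy' cy cy' cpi dP.
Qed.

Lemma conj_linv (A A' B B' J K : 'M[R]_n) s : A *m A' = 1%:M -> B *m B' = 1%:M ->
  K *m J = s%:M -> (B *m K *m A) *m (A' *m J *m B') = s%:M.
Proof.
move=> AA BB KJ; rewrite !mulmxA -(mulmxA _ A A') AA mulmx1 -(mulmxA B K J) KJ.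
by rewrite -mulmxA mul_scalar_mx -scalemxAr BB scalemx1.
Qed.

Lemma conj_apply (A A' B K : 'M[R]_n) (a b : 'cV[R]_n) r : A *m A' = 1%:M ->
  K *m a = r *: b -> (B *m K *m A) *m (A' *m a) = r *: (B *m b).
Proof.
move=> AA Ka; rewrite !mulmxA -(mulmxA _ A A') AA mulmx1 -(mulmxA B K a) Ka.
by rewrite -scalemxAr.
Qed.

(** The transported matrix satisfies the two defining equations in the new charts, hence is the
    regularized inverse there, also on the fold, where there is no inverse Jacobian to transform. *)
Lemma fold_reginv_change d d' c c' y :
  atlas d -> atlas d' -> atlas c -> atlas c' ->
  dom d y -> dom d' y -> dom c (pi y) -> dom c' (pi y) ->
  fold_reginv d' c' y = trans c' c (pi y) *m fold_reginv d c y *m trans d d' y.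
Proof.
move=> ad ad' ac ac' dy dy' cy cy'.
have [KJ Ka] := fold_reginv_spec ad ac dy cy.
have [_ dh inj'] := fold_map_rep ad' ac' dy' cy'.
have [_ dh0 _] := fold_map_rep ad ac dy cy.
have Td := transK ad ad' dy dy'; have Tc := transK ac' ac cy' cy.
apply/esym; move: KJ Ka; move: (fold_reginv d c y) => K KJ Ka.
apply: reginv_uniq; first exact: inj'.
  rewrite (fold_rep_change ad ad' ac ac' dy dy' cy cy').
  exact: conj_linv.
have [_ ->] := dcol_change ad ad' dy dy' dh0.
have [_ ->] := dcol_change ac ac' cy cy' (phi_differentiable phi_smooth ac cy).
exact: conj_apply.
Qed.

(** The preferred charts need not vary continuously with the point, so smoothness cannot be read off
    this form; [reg_hamiltonianE] rewrites it in fixed charts. *)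
Definition reg_hamiltonian (z : cotangent N) : R :=
  quad (invmx (g (pi z.1)))
    (fold_reginv (chart_at z.1) (chart_at (pi z.1)) z.1 *m z.2).

Lemma reg_hamiltonianE d c u (p : 'cV[R]_n) : atlas d -> atlas c ->
  img d u -> dom c (pi (bwd d u)) ->
  reg_hamiltonian (ct_bwd d (u, p)) =
  quad (invmx (gram g c (pi (bwd d u)))) (fold_reginv d c (bwd d u) *m p).
Proof.
move=> ad ac du; rewrite /reg_hamiltonian /ct_bwd /=.
set y := bwd d u => cy.
have dy : dom d y by exact: dom_bwd.
have ay := atlas_chart_at y; have yy := dom_chart_at y.
have ax := atlas_chart_at (pi y); have xx := dom_chart_at (pi y).
rewrite (fold_reginv_change ay ad ax ac yy dy xx cy) -!mulmxA.
by rewrite -(quad_gram g _ ac cy).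
Qed.

Lemma reg_hamiltonian_smooth : smooth_ct reg_hamiltonian.
Proof.
move=> d ad k; apply: Ck_local => -[u p] [/= du _].
have dy := dom_bwd du; set y := bwd d u in dy.
pose c := chart_at (pi y); have ac : atlas c by exact: atlas_chart_at.
have cy : dom c (pi y) by exact: dom_chart_at.
have [sP sh _] := ad c ac; set Q := fwd d @` _ in sP sh.
have oQ : open Q by exact: open_adapted.
have QE u' : Q u' -> [/\ img d u', dom c (pi (bwd d u')) & fwd d (bwd d u') = u'].
  by move=> [z [dz cz] <-]; rewrite chartK//; split => //; exact: img_fwd.
exists [set w | Q w.1].
  by exists y => //; exact: chart_bwdK.
have oQ2 : open [set w : 'rV[R]_n * 'cV[R]_n | Q w.1] by exact: open_fst.
apply: (@Ck_eq _ _ _ _ _ (fun w => quad (invmx (gram g c (pi (bwd d w.1))))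
    (fold_reginv d c (bwd d w.1) *m w.2))) => //.
  move=> [u' p'] /= /QE[du' cu' _].
  by rewrite -(reg_hamiltonianE p' ad ac du' cu').
have lift m q (F : 'rV[R]_n -> 'M[R]_(m, q)) :
    Ck k Q F -> Ck k [set w : 'rV[R]_n * 'cV[R]_n | Q w.1] (fun w => F w.1).
  move=> cF; apply: (@Ck_comp_mx _ _ k _ _ _ _ Q fst F oQ2 oQ) => //.
  exact: Ck_fst.
have PQ u' : Q u' -> img c ((fwd c \o pi \o bwd d) u').
  by move=> /QE[_ cu' _]; exact: img_fwd.
have cG : Ck k Q (fun u => gram g c (pi (bwd d u))).
  apply: (@Ck_eq _ _ _ _ _
    ((fun u => gram g c (bwd c u)) \o (fwd c \o pi \o bwd d)) _ oQ).
    by move=> u' /QE[_ cu' _] /=; rewrite (chartK cu').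
  exact: (Ck_comp_mx oQ (@chart_img_open _ _ _ c) PQ (sP k) (Ck_gram g k ac)).
apply: (Ck_quad oQ2).
  apply: (lift _ _ (fun u => invmx (gram g c (pi (bwd d u))))).
  apply: (Ck_invmx oQ) => //.
  by move=> u' /QE[_ cu' _]; exact: gram_unit_chart.
apply: (Ck_mulmx oQ2); last exact: Ck_snd.
apply: (lift _ _ (fun u => fold_reginv d c (bwd d u))).
apply: (Ck_reginv oQ).
- move=> u' /QE[du' cu' _]; have [_ _] := fold_map_rep ad ac (dom_bwd du') cu'.
  exact.
- apply: (Ck_eq oQ _ (Ck_jacobian oQ (sP k.+1))) => u' /QE[_ _ E].
  by rewrite /rep E.
- apply: (Ck_eq oQ _ (Ck_grad oQ (sh k.+1))) => u' /QE[_ _ E].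
  by rewrite /dcol E.
- apply: (@Ck_eq _ _ _ _ _ (grad (phi \o bwd c) \o (fwd c \o pi \o bwd d)) _ oQ).
    by [].
  apply: (Ck_comp_mx oQ (@chart_img_open _ _ _ c) PQ (sP k)).
  exact: (Ck_grad (@chart_img_open _ _ _ c) (phi_smooth ac k.+1)).
- exact: sh.
Qed.

Lemma fold_rep_unit d c y : atlas d -> atlas c -> dom d y -> dom c (pi y) ->
  ~ Gh y -> rep d c pi y \in unitmx /\
  fold_reginv d c y = ht y *: invmx (rep d c pi y).
Proof.
move=> ad ac dy cy yG; have [KJ _] := fold_reginv_spec ad ac dy cy.
have h0 : ht y != 0.
  by apply/eqP => h0; apply: yG; rewrite /Gh /= -[phi _]height_sqr -/(ht y) h0 expr0n.
have Ju : rep d c pi y \in unitmx.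
  have := mulmx1_unit (_ : (ht y)^-1 *: fold_reginv d c y *m rep d c pi y = 1%:M).
  by case=> //; rewrite -scalemxAl KJ scale_scalar_mx mulVf.
by split => //; rewrite -[LHS](mulmxK Ju) KJ mul_scalar_mx.
Qed.

Lemma reg_hamiltonian_off y p : ~ Gh y ->
  tangent_map pi y \in unitmx /\
  reg_hamiltonian (y, p) = hamiltonian g phi (ct_proj pi (y, p)).
Proof.
move=> yG.
have [Ju K] := fold_rep_unit (atlas_chart_at y) (atlas_chart_at (pi y))
  (dom_chart_at y) (dom_chart_at (pi y)) yG.
split; first exact: Ju.
rewrite /ct_proj hamiltonianE /= /reg_hamiltonian /= K -[phi _]height_sqr -/(ht y).
by rewrite -scalemxAl quadZ.
Qed.

End RegularizedHamiltonian.

(** * Hamilton's equations *)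

Section HamiltonEquations.
Context {R : realType} {n : nat}.
Let X := ('rV[R]_n * 'cV[R]_n)%type.

(** The differential of [F] as the symplectic pairing of its Hamiltonian field with the direction;
    testing on all directions recovers the field. *)
Lemma ham_field_derive (F : X -> R) w v z : differentiable F w ->
  'D_(v, z) F w = ((ham_field F w).1 *m z) ord0 ord0 -
                  (v *m (ham_field F w).2) ord0 ord0.
Proof.
move=> dF.
have -> : (v, z) = \sum_i v ord0 i *: (delta_mx ord0 i, 0) +
                   \sum_i z i ord0 *: (0, delta_mx i ord0) :> X.
  have E1 : \sum_i v ord0 i *: (delta_mx ord0 i, 0) = (v, 0) :> X.
    rewrite [LHS]surjective_pairing !raddf_sum /=; congr (_, _).
      by rewrite -row_sum_delta.
    by rewrite big1// => i _; rewrite scaler0.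
  have E2 : \sum_i z i ord0 *: (0, delta_mx i ord0) = (0, z) :> X.
    rewrite [LHS]surjective_pairing !raddf_sum /=; congr (_, _).
      by rewrite big1// => i _; rewrite scaler0.
    rewrite [RHS]matrix_sum_delta.
    by apply: eq_bigr => i _; rewrite big_ord1.
  by rewrite E1 E2; congr (_, _); rewrite /= ?addr0 ?add0r.
rewrite deriveE// linearD !linear_sum /= addrC; congr (_ + _).
  rewrite mxE; apply: eq_bigr => i _; rewrite linearZ /= -deriveE// !mxE.
  by rewrite mulrC.
rewrite mxE -sumrN; apply: eq_bigr => i _; rewrite linearZ /= -deriveE// !mxE.
by rewrite mulrN opprK.
Qed.

Lemma derive_mulmx {V : normedModType R} m k l (f : V -> 'M[R]_(m, k))
    (g : V -> 'M[R]_(k, l)) x v : differentiable f x -> differentiable g x ->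
  'D_v (fun y => f y *m g y) x = 'D_v f x *m g x + f x *m 'D_v g x.
Proof.
move=> df dg.
have /derivable_mxP dfv : derivable f x v by exact: diff_derivable.
have /derivable_mxP dgv : derivable g x v by exact: diff_derivable.
have E i j : (fun y => (f y *m g y) i j) =
    \sum_s ((fun y => f y i s) * (fun y => g y s j)).
  by apply/funext => y; rewrite fct_sumE mxE.
have D i j s : derivable ((fun y => f y i s) * (fun y => g y s j)) x v.
  exact: derivableM.
rewrite derive_mx; last first.
  by apply/derivable_mxP => i j; rewrite E; apply: derivable_sum => s; exact: D.
apply/matrixP => i j; rewrite mxE E derive_sum; last by move=> s; exact: D.
rewrite !mxE -big_split /=; apply: eq_bigr => s _.
rewrite deriveM// !derive_coord// addrC; congr (_ + _).
by rewrite -[LHS]/(_ * _) mulrC.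
Qed.

(** Both sides are second derivatives of [P] in the directions [v] and [w], so the claim is
    Schwarz's theorem for each component. *)
Lemma jacobian_derive_sym (U : set 'rV[R]_n) (P : 'rV[R]_n -> 'rV[R]_n) u v w :
  open U -> Ck 2 U P -> U u ->
  w *m 'D_v (jacobian P) u = v *m 'D_w (jacobian P) u.
Proof.
move=> oU CP Uu.
have dJ : differentiable (jacobian P) u.
  exact: (Ck_differentiable (Ck_jacobian oU CP) Uu).
have E (a b : 'rV[R]_n) : a *m 'D_b (jacobian P) u = 'D_b ('D_a P) u.
  have <- : 'D_b (fun y => a *m jacobian P y) u = a *m 'D_b (jacobian P) u.
    rewrite (@derive_mulmx _ _ _ _ (fun=> a)) ?derive_cst ?mul0mx ?add0r//.
  apply: near_eq_derive; apply: near_open oU Uu _ => y Uy.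
  by rewrite deriveEjacobian//; exact: Ck_differentiable CP Uy.
rewrite !E; have [_ dP] := CP.
have ddP a : differentiable ('D_a P) u by have [+ _] := dP a; apply.
apply/rowP => j.
apply: (etrans (esym (derive_coord v ord0 j (ddP w)))).
apply: (etrans _ (derive_coord w ord0 j (ddP v))).
have near_coord a : \forall y \near u, ('D_a P y) ord0 j = 'D_a (fun y => P y ord0 j) y.
  apply: near_open oU Uu _ => y Uy; rewrite derive_coord//.
  exact: Ck_differentiable CP Uy.
apply: (etrans (near_eq_derive v (near_coord w))).
apply: (etrans _ (esym (near_eq_derive w (near_coord v)))).
have Cj : Ck 2 U (fun y => P y ord0 j) by exact: Ck_coord.
exact: (derive_sym w v oU Cj Uu).
Qed.

Section PointTransformation.
Variables (U : set 'rV[R]_n) (P : 'rV[R]_n -> 'rV[R]_n).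
Hypothesis oU : open U.
Hypothesis sP : smooth_on U P.
Hypothesis unitJ : forall u, U u -> jacobian P u \in unitmx.

(** The cotangent lift of [P]. As Jacobians act on row vectors from the right, covectors are pulled
    back by the Jacobian and pushed forward by its inverse. *)
Definition point_lift (w : X) : X := (P w.1, invmx (jacobian P w.1) *m w.2).

Let oUX : open [set w : X | U w.1]. Proof. exact: open_fst. Qed.

Let cJ k : Ck k [set w : X | U w.1] (fun w => jacobian P w.1).
Proof.
have cJP : Ck k U (jacobian P) by exact: (Ck_jacobian oU (sP k.+1)).
by apply: (@Ck_comp_mx _ _ k _ _ _ _ U fst (jacobian P) oUX oU) => //; exact: Ck_fst.
Qed.

Let cQ k : Ck k [set w : X | U w.1] (fun w => invmx (jacobian P w.1) *m w.2).
Proof.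
apply: (Ck_mulmx oUX); last exact: Ck_snd.
by apply: (Ck_invmx oUX); [move=> x Ux; exact: unitJ|exact: cJ].
Qed.

Lemma point_lift_differentiable w : U w.1 -> differentiable point_lift w.
Proof.
move=> Uw; apply: differentiable_pair.
  apply: (@differentiable_comp _ _ _ _ fst P).
    by apply: (Ck_differentiable (Ck_fst 1 [set w : X | U w.1])).
  exact: Ck_differentiable (sP 1%N) Uw.
exact: (Ck_differentiable (cQ 1%N)).
Qed.

Lemma derive_fst {W : normedModType R} (f : 'rV[R]_n -> W) (w v : X) :
  differentiable f w.1 -> 'D_v (fun y : X => f y.1) w = 'D_(v.1) f w.1.
Proof.
move=> df.
have dfst : differentiable (fst : X -> _) w.
  by apply: (Ck_differentiable (Ck_fst 1 setT)).
rewrite deriveE; last exact: (@differentiable_comp _ _ _ _ fst f).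
rewrite (@diff_comp _ _ _ _ fst f)//= deriveE// (@diff_lin _ _ _ fst)//.
by move=> x; exact: cvg_fst.
Qed.

Lemma derive_snd (w v : X) : 'D_v (snd : X -> 'cV[R]_n) w = v.2.
Proof.
have csnd : continuous (snd : X -> 'cV[R]_n) by move=> x; exact: cvg_snd.
rewrite deriveE; last exact: linear_differentiable.
by rewrite diff_lin.
Qed.

(* Both sides of [F (u, J(u) q) = H (P u, q)] are differentiated at
   [(u, q) = point_lift w]; the second derivatives of [P] that appear cancel by
   symmetry. *)
Lemma ham_field_point_lift (F H : X -> R) w : U w.1 ->
  (forall w, U w.1 -> F w = H (point_lift w)) ->
  differentiable F w -> differentiable H (point_lift w) ->
  'D_(ham_field F w) point_lift w = ham_field H (point_lift w).
Proof.
move=> Uw FH dF dH.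
set V := ham_field F w; set E := ham_field H (point_lift w).
have dL := point_lift_differentiable Uw.
have Ju := unitJ Uw; set J := jacobian P w.1 in Ju *.
set q := (point_lift w).2.
have dP : differentiable P w.1 by exact: Ck_differentiable (sP 1%N) Uw.
have dJ : differentiable (jacobian P) w.1.
  exact: (Ck_differentiable (Ck_jacobian oU (sP 2%N)) Uw).
pose A (y : X) : X := (y.1, jacobian P y.1 *m y.2).
pose B (y : X) : X := (P y.1, y.2).
pose y0 : X := (w.1, q).
have Ay0 : A y0 = w.
  by rewrite /A /y0 /= /q /= mulKVmx// -surjective_pairing.
have dfst : differentiable (fst : X -> _) y0.
  by apply: (Ck_differentiable (Ck_fst 1 setT)).
have dsnd : differentiable (snd : X -> _) y0.
  by apply: (Ck_differentiable (Ck_snd 1 setT)).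
have dP1 : differentiable (fun y : X => P y.1) y0.
  exact: (@differentiable_comp _ _ _ _ fst P).
have dJ1 : differentiable (fun y : X => jacobian P y.1) y0.
  exact: (@differentiable_comp _ _ _ _ fst (jacobian P)).
have dJ2 : differentiable (fun y : X => jacobian P y.1 *m y.2) y0.
  have cJ2 : Ck 1 [set w : X | U w.1] (fun y : X => jacobian P y.1 *m y.2).
    by apply: (Ck_mulmx oUX); [exact: cJ|exact: Ck_snd].
  exact: (Ck_differentiable (x := y0) cJ2 Uw).
have dA : differentiable A y0 by exact: differentiable_pair.
have dB : differentiable B y0 by exact: differentiable_pair.
have By0 : B y0 = point_lift w by [].
have key v z : (V.1 *m ('D_v (jacobian P) w.1 *m q + J *m z)) ord0 ord0 -
    (v *m V.2) ord0 ord0 =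
    (E.1 *m z) ord0 ord0 - (v *m J *m E.2) ord0 ord0.
  have DA : 'D_(v, z) A y0 = (v, 'D_v (jacobian P) w.1 *m q + J *m z).
    rewrite deriveE// (diff_pair dfst dJ2); congr (_, _).
      by rewrite diff_lin// => x; exact: cvg_fst.
    rewrite -deriveE// (derive_mulmx _ dJ1 dsnd) derive_snd.
    by rewrite (@derive_fst _ (jacobian P) y0).
  have DB : 'D_(v, z) B y0 = (v *m J, z).
    rewrite deriveE// (diff_pair dP1 dsnd); congr (_, _).
      by rewrite -deriveE// (@derive_fst _ P y0)//= deriveEjacobian.
    by rewrite -deriveE// derive_snd.

  have E1 := derive_comp (v, z) Ay0 dA dF.
  have E2 := derive_comp (v, z) By0 dB dH.
  have E3 : 'D_(v, z) (F \o A) y0 = 'D_(v, z) (H \o B) y0.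
    apply: near_eq_derive; apply: (near_open oUX (x := y0) Uw) => y Uy /=.
    have EL : point_lift (A y) = B y by rewrite /point_lift /= mulKmx ?unitJ.
    by rewrite (FH (A y) Uy) EL.
  move: E3; rewrite E1 E2 DA DB !ham_field_derive//.
(* Directions with [v = 0] compare the velocities. *)
have X1 : V.1 *m J = E.1.
  apply/rowP => j; have := key 0 (delta_mx j ord0).
  rewrite derive0 !mul0mx add0r [(0 : 'M[R]_1) _ _]mxE !subr0 mulmxA -!colE.
  by rewrite [LHS]mxE [RHS]mxE.
pose Q (y : X) := invmx (jacobian P y.1) *m y.2.
have dQ : differentiable Q w by exact: Ck_differentiable (cQ 1%N) Uw.
have dPw : differentiable (fun y : X => P y.1) w.
  apply: (@differentiable_comp _ _ _ _ fst P) => //.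
  by apply: (Ck_differentiable (Ck_fst 1 setT)).
have dJw : differentiable (fun y : X => jacobian P y.1) w.
  exact: (Ck_differentiable (cJ 1%N)).
(* Differentiates [y.2 = jacobian P y.1 *m Q y] along the field [V]. *)
have V2 : V.2 = 'D_(V.1) (jacobian P) w.1 *m q + J *m 'D_V Q w.
  rewrite -(derive_snd w V) -(derive_fst V dJ) -(derive_mulmx V dJw dQ).
  apply: near_eq_derive; apply: (near_open oUX (x := w) Uw) => y Uy.
  by rewrite /Q (mulKVmx (unitJ Uy)).
(* Directions with [z = 0] compare the momenta; after exchanging the arguments of the second
   derivative of [P], it cancels the first term of [V2]. *)
have X2 : 'D_V Q w = E.2.
  apply: (can_inj (mulKmx Ju)); apply/colP => j.
  have := key (delta_mx ord0 j) 0.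
  rewrite !mulmx0 addr0 [(0 : 'M[R]_1) _ _]mxE sub0r mulmxA.
  rewrite (jacobian_derive_sym _ _ oU (sP 2%N) Uw) V2 mulmxDr mulmxA.
  rewrite [(_ + _ : 'M[R]_1) _ _]mxE opprD addNKr => /oppr_inj.
  by rewrite -mulmxA -!rowE [LHS]mxE [RHS]mxE.
rewrite deriveE// (diff_pair dPw dQ) -!deriveE// X2.
by rewrite (derive_fst V dP) deriveEjacobian// X1 -surjective_pairing.
Qed.

End PointTransformation.

End HamiltonEquations.

Section Trajectories.
Context {R : realType} {n : nat}.

Lemma ct_fwdK {K : manifold R n} (c : chart R n K) (z : cotangent K) :
  atlas c -> dom c z.1 -> ct_bwd c (ct_fwd c z) = z.
Proof.
case: z => x p /= ac cx; rewrite /ct_bwd /ct_fwd /= chartK//.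
have ax := atlas_chart_at x; have xx := dom_chart_at x.
by rewrite mulmxA [X in X *m _](transK ax ac xx cx) mul1mx.
Qed.

Lemma ct_bwdK {K : manifold R n} (c : chart R n K) w :
  atlas c -> img c w.1 -> ct_fwd c (ct_bwd c w) = w.
Proof.
case: w => u p /= ac cu; rewrite /ct_bwd /ct_fwd /= mulmxA.
have cx := dom_bwd cu; set x := bwd c u in cx *.
have ax := atlas_chart_at x; have xx := dom_chart_at x.
by rewrite [X in X *m _](transK ac ax cx xx) mul1mx chart_bwdK.
Qed.

Context {M : manifold R n}.
Variables (g : metric M) (phi : M -> R).
Hypothesis phi_smooth : smooth_fun phi.
Hypothesis dphi_neq0 :
  forall x, phi x = 0 -> exists v, differential phi x v != 0.
Let N := double_mfd phi_smooth dphi_neq0.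
Let pi : N -> M := @fold_map R n M phi phi_smooth dphi_neq0.
Let ht : N -> R := @height R M phi.
Let Gh : set N := pi @^-1` [set x | phi x = 0].
Let Hh : cotangent N -> R :=
  @reg_hamiltonian R n M g phi phi_smooth dphi_neq0.
Let H := hamiltonian g phi.
Implicit Types (d : chart R n N) (c : chart R n M) (y : N).

Lemma hamiltonian_smooth : smooth_ct H.
Proof.
move=> c ac k.
have oc : open (img c) by exact: chart_img_open.
have oU : open [set w : 'rV[R]_n * 'cV[R]_n | img c w.1] by exact: open_fst.
have E : ct_img c setT = [set w : 'rV[R]_n * 'cV[R]_n | img c w.1].
  by apply/seteqP; split => [w []//|w cw]; split.
rewrite E; apply: (@Ck_eq _ _ _ _ _ (fun w : 'rV[R]_n * 'cV[R]_n =>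
    phi (bwd c w.1) * quad (invmx (gram g c (bwd c w.1))) w.2) _ oU).
  move=> [u q] /= cu; have cx := dom_bwd cu.
  have ax := atlas_chart_at (bwd c u); have xx := dom_chart_at (bwd c u).
  rewrite /H /ct_bwd hamiltonianE /= -(quad_gram g _ ac cx) mulmxA.
  by rewrite [X in X *m _](transK ac ax cx xx) mul1mx.
have cG : Ck k (img c) (fun u => invmx (gram g c (bwd c u))).
  apply: (Ck_invmx oc); last exact: Ck_gram.
  by move=> u /dom_bwd cu; exact: gram_unit_chart.
apply: (CkM oU).
  apply: (@Ck_comp _ _ k _ _ (img c) fst (phi \o bwd c) oU) => //.
    exact: Ck_fst.
  exact: phi_smooth.
apply: (Ck_quad oU); last exact: Ck_snd.
apply: (@Ck_comp_mx _ _ k _ _ _ _ (img c) fst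
  (fun u => invmx (gram g c (bwd c u))) oU oc) => //.
exact: Ck_fst.
Qed.

(** [ct_proj] is defined in the preferred charts. The transition matrices brought in by [d] and [c]
    cancel against those in the change of [rep], leaving the coordinate lift for any pair of
    charts. *)
Lemma ct_proj_chart_pair d c y (p : 'cV[R]_n) : atlas d -> atlas c ->
  dom d y -> dom c (pi y) -> ~ Gh y ->
  ct_fwd c (ct_proj pi (y, p)) =
  point_lift (fwd c \o pi \o bwd d) (ct_fwd d (y, p)).
Proof.
move=> ad ac dy cy yG.
have ay := atlas_chart_at y; have yy := dom_chart_at y.
have ax := atlas_chart_at (pi y); have xx := dom_chart_at (pi y).
have Ju := (fold_rep_unit ay ax yy xx yG).1.
rewrite /ct_fwd /ct_proj /point_lift /=; congr (_, _); first by rewrite chartK.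
rewrite -/(rep d c pi y) -/(trans d (chart_at y) y).
rewrite -/(trans c (chart_at (pi y)) (pi y)).
rewrite (fold_rep_change ay ad ax ac yy dy xx cy).
have Td := trans_unit ad ay dy yy.
have Tc := transK ac ax cy xx.
rewrite -[tangent_map pi y]/(rep (chart_at y) (chart_at (pi y)) pi y).
move: Ju Td Tc; move: (rep _ _ pi y) (trans d _ y) => J Td Ju Tdu.
move: (trans c _ _) (trans _ c _) => Tc Tc' TT.
have Tc'u := (mulmx1_unit TT).2.
have JJ : Td *m J *m Tc' \in unitmx by rewrite !unitmx_mul Tdu Ju Tc'u.
rewrite -[LHS](mulKmx JJ); congr (_ *m _).
have T'T : Tc' *m Tc = 1%:M by exact: mulmx1C.
by rewrite !mulmxA -(mulmxA _ Tc' Tc) T'T mulmx1 -(mulmxA Td J) mulmxV// mulmx1.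
Qed.

Lemma ct_proj_chart d c (z : cotangent N) : atlas d -> atlas c ->
  dom d z.1 -> dom c (pi z.1) -> ~ Gh z.1 ->
  ct_fwd c (ct_proj pi z) = point_lift (fwd c \o pi \o bwd d) (ct_fwd d z).
Proof. by case: z => y p; exact: ct_proj_chart_pair. Qed.

(** Differentiability at time t is local, so the chart [c] below and one chart [d] of the double at
    that time suffice: continuity of the base curves keeps nearby times in them. There the chain
    rule carries the velocity and [ham_field_point_lift] carries the field. *)
Lemma fold_map_trajectory (I : set R) (gamma : R -> cotangent N) :
  trajectory Hh I gamma -> (forall t, I t -> ~ Gh (gamma t).1) ->
  trajectory H I (ct_proj pi \o gamma) /\
  (forall t, I t -> 0 < phi (ct_proj pi (gamma t)).1).
Proof.
move=> [oI iI cg dg] offG; split; last first.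
  move=> t It; rewrite /= lt_neqAle; apply/andP; split.
    by apply/eqP => E; apply: (offG t It); rewrite /Gh /= E.
  by rewrite -[phi _]height_sqr sqr_ge0.
have cpi t : I t -> {for t, continuous (fun s => pi (gamma s).1)}.
  move=> It; apply: (continuous_comp (cg t It)).
  exact: fold_map_continuous.
split => //.
move=> t c It ac cx.
pose y := (gamma t).1; pose d := chart_at y.
have ad : atlas d by exact: atlas_chart_at.
have dy : dom d y by exact: dom_chart_at.
have [sP sh _] := ad c ac; set Q := fwd d @` _ in sP sh.
have oQ : open Q by exact: open_adapted.
pose P := fwd c \o pi \o bwd d.
(* Removing height 0 leaves an open set on which the Jacobian of [P] is invertible, as the lift
   requires. *)
pose U := Q `&` (ht \o bwd d) @^-1` [set s | s != 0].
have oU : open U by apply: (open_preimage oQ (sh 0%N)); exact: open_neq.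
have UE u : U u -> [/\ img d u, dom c (pi (bwd d u)), fwd d (bwd d u) = u &
    ~ Gh (bwd d u)].
  move=> [[z [dz cz] <-]]; rewrite /= chartK// => /eqP z0; split => //.
    exact: img_fwd.
  by move=> /fold_bdry_ht.
have sPU : smooth_on U P by move=> k; apply: Ck_sub (sP k) => u [].
have unitJ u : U u -> jacobian P u \in unitmx.
  move=> /UE[du cu E uG].
  by have [+ _] := fold_rep_unit ad ac (dom_bwd du) cu uG; rewrite /rep E.
have w0 := dg t d It ad dy.
have Uy : U (ct_fwd d (gamma t)).1.
  split; first by exists y.
  rewrite /= chartK//; apply/eqP => h0; apply: (offG t It).
  exact/fold_bdry_ht.
have FH w : U w.1 -> (Hh \o ct_bwd d) w = (H \o ct_bwd c) (point_lift P w).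
  move=> Uw; have [du cu E uG] := UE _ Uw; case: w Uw du cu E uG => u p /= Uu du cu E uG.
  have du' := dom_bwd du.
  rewrite -[(u, p) in RHS](ct_bwdK (w := (u, p)) ad du) -ct_proj_chart//.
  rewrite ct_fwdK//=.
  by have [_ E2] := reg_hamiltonian_off g (ct_bwd d (u, p)).2 uG; exact: E2.
have dF : differentiable (Hh \o ct_bwd d) (ct_fwd d (gamma t)).
  have sHh := reg_hamiltonian_smooth g (dphi_neq0 := dphi_neq0) ad 1%N.
  apply: (Ck_differentiable (x := ct_fwd d (gamma t)) sHh).
  by split => //; exact: img_fwd.
have Ewt : ct_fwd c ((ct_proj pi \o gamma) t) = point_lift P (ct_fwd d (gamma t)).
  by apply: ct_proj_chart => //; exact: offG.
have dH : differentiable (H \o ct_bwd c) (point_lift P (ct_fwd d (gamma t))).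
  rewrite -Ewt.
  apply: (Ck_differentiable (x := ct_fwd c ((ct_proj pi \o gamma) t))
    (hamiltonian_smooth ac 1%N)).
  by split => //; exact: img_fwd.
have dL := point_lift_differentiable oU sPU unitJ Uy.
rewrite Ewt -(ham_field_point_lift oU sPU unitJ Uy FH dF dH).
rewrite (deriveE _ dL).
apply: (near_eq_is_derive _ (is_derive_comp1 w0 dL)).
have n1 : \forall s \near t, I s by exact: open_nbhs_nbhs.
have n2 : \forall s \near t, dom d (gamma s).1.
  exact: (cg t It _ (dom_near dy)).
have n3 : \forall s \near t, dom c (pi (gamma s).1).
  exact: (cpi t It _ (dom_near cx)).
move: n1 n2 n3; apply: filterS3 => s Is ds cs /=.
by apply/esym; apply: ct_proj_chart => //; exact: offG.
Qed.

End Trajectories.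

(** * Transversality *)

Section TransverseLevel.
Context {R : realType} {V : normedModType R}.
Implicit Types (E S U : set V) (F sg : V -> R).

Lemma diff_coord m p (f : V -> 'M[R]_(m, p)) x v i j : differentiable f x ->
  ('d f x v) i j = 'D_v (fun y => f y i j) x.
Proof. by move=> df; rewrite derive_coord// deriveE. Qed.

(** As [X] is tangent to the level of [F] and moves [sg], subtracting the right multiple of [X] from
    a vector tangent to [E] makes it tangent to [S]. The vector [e] is there to make the level of
    [F] regular. *)
Lemma transverse_level E S U F sg (h : R) z X e : open U -> U z ->
  smooth_on U F -> smooth_on U sg ->
  (forall x, U x -> (E x <-> F x = h)) ->
  (forall x, U x -> (S x <-> sg x = 0 /\ F x = h)) ->
  'D_X F z = 0 -> 'D_X sg z != 0 -> 'D_e F z != 0 ->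
  transverse_at E S z X.
Proof.
move=> oU Uz sF ssg EU SU XF Xsg eF.
have sFh : smooth_on U (fun x => F x - h).
  by move=> k; apply: (CkD oU); [exact: sF|exact: Ck_cst].
pose F1 (x : V) : 'rV[R]_1 := (F x - h)%:M.
pose G2 (x : V) : 'rV[R]_(1 + 1) := row_mx (sg x)%:M (F x - h)%:M.
have sF1 : smooth_on U F1 by move=> k; exact: Ck_scalar_mx.
have sG2 : smooth_on U G2 by move=> k; apply: (Ck_row_mx oU); exact: Ck_scalar_mx.
have dF : differentiable F z by exact: Ck_differentiable (sF 1%N) Uz.
have dsg : differentiable sg z by exact: Ck_differentiable (ssg 1%N) Uz.
have dF1 : differentiable F1 z by exact: Ck_differentiable (sF1 1%N) Uz.
have dG2 : differentiable G2 z by exact: Ck_differentiable (sG2 1%N) Uz.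
have DFh v : 'D_v (fun x => F x - h) z = 'D_v F z.
  by rewrite deriveB ?derive_cst ?subr0//; exact: diff_derivable.
have F1E v : 'd F1 z v = ('D_v F z)%:M.
  rewrite [LHS]mx11_scalar (diff_coord v _ _ dF1) -[in RHS]DFh.
  rewrite (_ : (fun y => _) = (fun x => F x - h))//.
  by apply/funext => x; rewrite mxE eqxx.
have G2E v : 'd G2 z v = row_mx ('D_v sg z)%:M ('D_v F z)%:M.
  rewrite -[LHS]hsubmxK; congr row_mx; rewrite [LHS]mx11_scalar mxE.
    rewrite (diff_coord v _ _ dG2) (_ : (fun y => _) = sg)//.
    by apply/funext => x; rewrite row_mxEl mxE eqxx.
  rewrite (diff_coord v _ _ dG2) -[in RHS]DFh.
  rewrite (_ : (fun y => _) = (fun x => F x - h))//.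
  by apply/funext => x; rewrite row_mxEr mxE eqxx.
have linF (a b : R) v w : 'D_(a *: v + b *: w) F z = a * 'D_v F z + b * 'D_w F z.
  by rewrite !deriveE// linearD !linearZ.
have linsg (a b : R) v w :
    'D_(a *: v + b *: w) sg z = a * 'D_v sg z + b * 'D_w sg z.
  by rewrite !deriveE// linearD !linearZ.
have scalar0 (a : R) : (a%:M : 'M[R]_1) = 0 -> a = 0.
  by move=> /matrixP/(_ ord0 ord0); rewrite !mxE eqxx.
have row0 (a b : R) : row_mx (a%:M : 'M[R]_1) (b%:M : 'M[R]_1) = 0 -> a = 0 /\ b = 0.
  rewrite -(row_mx0 R 1 1 1) => ab0; have [a0 b0] := eq_row_mx ab0.
  by split; exact: scalar0.
exists F1, G2; split.
- split.
    exists U; split=> // x Ux.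
    rewrite EU//; split => [Fx|/scalar0 /subr0_eq //].
    by rewrite /F1 Fx subrr raddf0.
  (* The summand [0 *: e] only puts the vector in the shape of [linF]. *)
  move=> w; exists (w ord0 ord0 / 'D_e F z *: e + 0 *: e).
  by rewrite F1E linF mul0r addr0 divfK// -mx11_scalar.
- split.
    exists U; split=> // x Ux.
    rewrite SU//; split => [[sx Fx]|].
      by rewrite /G2 sx Fx subrr raddf0 row_mx0.
    by move=> /row0[sx /subr0_eq Fx].
  move=> w; pose w' : 'rV[R]_(1 + 1) := w.
  pose al := lsubmx w' ord0 ord0; pose be := rsubmx w' ord0 ord0.
  pose x := be / 'D_e F z.
  (* The system is triangular because the derivative of [F] along [X] vanishes: [e] adjusts [F],
     then [X] adjusts [sg]. *)
  exists (x *: e + (al - x * 'D_e sg z) / 'D_X sg z *: X).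
  rewrite G2E linF linsg XF mulr0 addr0 !divfK// addrC subrK.
  by rewrite /al /be -!mx11_scalar hsubmxK.
- move=> v; split => [|[s [a [+ ->]]]]; last first.
    rewrite G2E F1E => /row0[_ Fs0].
    by rewrite -(scale1r s) linF XF mulr0 addr0 Fs0 mulr0 raddf0.
  rewrite F1E => /scalar0 vF.
  pose a := 'D_v sg z / 'D_X sg z.
  exists (1 *: v + (- a) *: X), a; split; last by rewrite scale1r scaleNr subrK.
  rewrite G2E linF linsg vF XF !mulr0 addr0 mul1r mulNr divfK// subrr.
  by rewrite !raddf0 row_mx0.
Qed.

End TransverseLevel.

Section Transversality.
Context {R : realType} {n : nat}.

Lemma reginv0 (J : 'M[R]_n) (a b p : 'cV[R]_n) :
  exists k : R, reginv J a b 0 *m p = k *: b.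
Proof.
pose q : 'M[R]_1 := a^T *m invmx (J *m J^T + a *m a^T) *m p.
exists (2^-1 * q ord0 ord0).
rewrite /reginv scale0r add0r -!scalemxAl -scalerA; congr (_ *: _).
by rewrite -mul_mx_scalar -mx11_scalar /q !mulmxA.
Qed.

(** [K] maps the whole ray into the line of [w], where the quadratic form is (k + l t)^2 times a
    constant. *)
Lemma quad_ray_derive (A K : 'M[R]_n) (p q w : 'cV[R]_n) (k l : R) :
  K *m p = k *: w -> K *m q = l *: w ->
  is_derive (0 : R) 1 (fun t : R => quad A (K *m (p + t *: q)))
    (2 * k * l * quad A w).
Proof.
move=> Kp Kq.
have -> : (fun t : R => quad A (K *m (p + t *: q))) =
    (cst k + l \*: (id : R -> R)) ^+ 2 * cst (quad A w).
  apply/funext => t.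
  rewrite mulmxDr -scalemxAr Kp Kq scalerA -scalerDl quadZ.
  by rewrite !fctE /= [l *: _]mulrC.
have d1 := is_deriveD (is_derive_cst k (0 : R) 1)
  (is_deriveZ l (is_derive_id (0 : R) 1)).
have d2 := is_deriveM (is_deriveX 2 d1) (is_derive_cst (quad A w) (0 : R) 1).
apply: (is_derive_eq d2).
rewrite /= !fctE /= /GRing.scale /=.
ring.
Qed.

Context {M : manifold R n}.
Variables (g : metric M) (phi : M -> R).
Hypothesis phi_smooth : smooth_fun phi.
Hypothesis dphi_neq0 :
  forall x, phi x = 0 -> exists v, differential phi x v != 0.
Let N := double_mfd phi_smooth dphi_neq0.
Let pi : N -> M := @fold_map R n M phi phi_smooth dphi_neq0.
Let ht : N -> R := @height R M phi.
Let Gh : set N := pi @^-1` [set x | phi x = 0].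
Let Hh : cotangent N -> R :=
  @reg_hamiltonian R n M g phi phi_smooth dphi_neq0.

(** Only two momentum derivatives of the Hamiltonian are needed, in the directions [a] and [p]. [K]
    sends both to multiples of [b], so they reduce to [quad_ray_derive], and positive energy makes
    both nonzero. *)
Lemma reg_hamiltonian_cross h : 0 < h ->
  cross_transversely Hh [set z | Hh z = h]
    ([set z | Gh z.1] `&` [set z | Hh z = h]).
Proof.
move=> h0 z d [/= zG zE] ad dz.
have bdryE x : Gh x <-> ht x = 0 by exact: fold_bdry_ht.
have Ez : ct_bwd d (ct_fwd d z) = z by exact: ct_fwdK.
pose y := z.1; pose w0 := ct_fwd d z; pose p := w0.2.
have Ey : bwd d w0.1 = y by exact: chartK.
pose c := chart_at (pi y); have ac : atlas c by exact: atlas_chart_at.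
have cy : dom c (pi y) by exact: dom_chart_at.
have [_ sh _] := ad c ac; set Q := fwd d @` _ in sh.
have oQ : open Q by exact: open_adapted.
have Qy : Q w0.1 by exists y.
have QE u : Q u -> img d u by move=> [x [dx cx] <-]; exact: img_fwd.
pose U := [set w : 'rV[R]_n * 'cV[R]_n | Q w.1].
have oU : open U by exact: open_fst.
pose F := Hh \o ct_bwd d; pose sg (w : 'rV[R]_n * 'cV[R]_n) := (ht \o bwd d) w.1.
have sF : smooth_on U F.
  move=> k; apply: Ck_sub (reg_hamiltonian_smooth g ad k) => w Uw.
  by split => //; exact: QE.
have ssg : smooth_on U sg.
  move=> k; apply: (@Ck_comp _ _ k _ _ Q fst (ht \o bwd d) oU) => //.
  exact: Ck_fst.
have dF : differentiable F w0 := Ck_differentiable (x := w0) (sF 1%N) Qy.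
have hty : ht y = 0 by exact/bdryE.
have [_ Ka] := fold_reginv_spec ad ac dz cy.
pose K := fold_reginv d c y; pose a := dcol d ht y.
pose b := dcol c phi (pi y); pose C := invmx (gram g c (pi y)).
have [k Kp] : exists k, K *m p = k *: b.
  by rewrite /K /fold_reginv -/ht hty; exact: reginv0.
have FE q : F (w0.1, q) = quad C (K *m q).
  rewrite /F /= /Hh (reg_hamiltonianE g q ad ac (QE _ Qy)); last by rewrite Ey.
  by rewrite Ey.
have hE : h = k ^+ 2 * quad C b.
  by rewrite -quadZ -Kp -FE -zE /F /= -[in LHS]Ez.
have DF q l : K *m q = l *: b -> 'D_(0, q) F w0 = 2 * k * l * quad C b.
  move=> Kq; have [_ <-] := quad_ray_derive C Kp Kq.
  have dF0 : differentiable F (w0 + (0 : R) *: (0, q)) by rewrite scale0r addr0.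
  have [_] := line_derive dF0; rewrite scale0r addr0 => <-.
  rewrite (_ : (fun s => _) = fun t => quad C (K *m (p + t *: q)))//.
  apply/funext => t; rewrite -FE; congr F; rewrite [w0 in LHS]surjective_pairing.
  congr (_, _) => /=; first by rewrite scaler0 addr0.
(* Both factors of this product also divide h = k^2 quad C b, which is positive. *)
have kQ0 : k * quad C b != 0.
  by apply: contraTneq h0 => E; rewrite hE expr2 -mulrA E mulr0 ltxx.
apply: (@transverse_level _ _ _ _ U F sg h w0 (ham_field F w0) (0, p) oU Qy sF ssg).
- by move=> w Uw; split => [[]//|]; split => //; exact: QE.
- move=> w Uw; split => [[_ [/bdryE]]|[sw Fw]] //.
  by split; [exact: QE|split => //; exact/bdryE].
(* Conservation of energy: the symplectic pairing of the field with itself is zero. *)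
- have := ham_field_derive (ham_field F w0).1 (ham_field F w0).2 dF.
  by rewrite -surjective_pairing subrr.
(* The height depends on position alone, so its rate of change is the velocity paired with [a], that
   is the momentum derivative of [F] along [a]; here l = 1/2 because K a = b / 2. *)
- rewrite (_ : 'D_(_) sg w0 = k * quad C b)//.
  have dht : differentiable (ht \o bwd d) w0.1 by exact: Ck_differentiable (sh 1%N) Qy.
  rewrite [LHS]derive_fst// grad_derive//.
  have := ham_field_derive 0 a dF; rewrite (DF a 2^-1 Ka) mul0mx.
  rewrite [(0 : 'M[R]_1) _ _]mxE subr0 (_ : 2 * k * 2^-1 = k); last by field.
  by move=> E; rewrite E.
(* Euler's identity: [F] is quadratic in the momentum, so its derivative along [p] is 2 h. *)
- rewrite (DF p k Kp) -!mulrA mulf_neq0 ?pnatr_eq0// mulrCA.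
  by apply: contraTneq h0 => E; rewrite hE expr2 -mulrA E ltxx.
Qed.

End Transversality.

Theorem proposition2p1 (R : realType) (n : nat) (M : manifold R n)
    (g : metric M) (phi : M -> R) (phi_smooth : smooth_fun phi)
    (dphi_neq0 : forall x, phi x = 0 -> exists v, differential phi x v != 0) :
  let Om := [set x | 0 < phi x] in
  let Gam := [set x | phi x = 0] in
  let H := hamiltonian g phi in
  exists (Oh : manifold R n) (pi : Oh -> M),
    let Gh := pi @^-1` Gam in
    [/\ smooth_map pi,
        [/\ range pi = closure Om, double_covering pi Om,
            embedded_hypersurface Gh & diffeo_on Gh Gam pi] &
    exists Hh : cotangent Oh -> R,
    [/\ smooth_ct Hh,
        forall y p, ~ Gh y ->
          tangent_map pi y \in unitmx /\ Hh (y, p) = H (ct_proj pi (y, p)),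
        forall (I : set R) (gamma : R -> cotangent Oh),
          trajectory Hh I gamma -> (forall t, I t -> ~ Gh (gamma t).1) ->
          trajectory H I (ct_proj pi \o gamma) /\
          (forall t, I t -> Om (ct_proj pi (gamma t)).1) &
        forall h : R, 0 < h ->
          let E := [set z | Hh z = h] in
          cross_transversely Hh E ([set z | Gh z.1] `&` E)]].
Proof.
move=> Om Gam H.
exists (double_mfd phi_smooth dphi_neq0).
exists (@fold_map R n M phi phi_smooth dphi_neq0) => Gh; split.
- exact: fold_map_smooth.
- split.
  + rewrite (closure_pos phi_smooth dphi_neq0); exact: range_fold_map.
  + exact: fold_map_covering.
  + exact: fold_bdry_hypersurface.
  + exact: fold_map_diffeo_bdry.
- exists (@reg_hamiltonian R n M g phi phi_smooth dphi_neq0); split.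
  + exact: reg_hamiltonian_smooth.
  + exact: reg_hamiltonian_off.
  + exact: fold_map_trajectory.
  + exact: reg_hamiltonian_cross.
Qed.
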